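(* Let $r\ge1$ and regard the contact algebra $K(2r+1)$ as a $W(1)$-module via $x\cdot D=[\Theta_K(x),D]$, where $\Theta_K(x_1^i\partial_1)=\frac12D_K(x_{2r+1}^i)$. Then $$K(2r+1)\cong\begin{cases}V(0)^{\oplus(p^{2r-1}-1)}\oplus V(p-1)^{\oplus p^{2r-1}}\oplus\Big(\bigoplus_{i=1}^{p-2}L(i)^{\oplus p^{2r-1}}\Big)\oplus L(p-1),&\text{if }2r+4\equiv0\pmod p,\\ V(0)^{\oplus p^{2r-1}}\oplus V(p-1)^{\oplus p^{2r-1}}\oplus\Big(\bigoplus_{i=1}^{p-2}L(i)^{\oplus p^{2r-1}}\Big),&\text{if }2r+4\not\equiv0\pmod p.\end{cases}$$ Consequently, $$[K(2r+1)]=\begin{cases}(2p^{2r-1}-1)[L(0)]+\sum_{i=1}^{p-2}p^{2r-1}[L(i)]+2p^{2r-1}[L(p-1)],&\text{if }2r+4\equiv0\pmod p,\\ 2p^{2r-1}[L(0)]+\sum_{i=1}^{p-2}p^{2r-1}[L(i)]+2p^{2r-1}[L(p-1)],&\text{if }2r+4\not\equiv0\pmod p.\end{cases}$$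
   Context: $\mathbb F$ is an algebraically closed field of characteristic $p>2$, $I=\{0,\dots,p-1\}$. $\mathcal A(2r+1)$ is the truncated polynomial algebra with basis $x^\alpha$, $\alpha\in I^{2r+1}$ ($x^\alpha x^\beta=x^{\alpha+\beta}$, $=0$ if outside $I^{2r+1}$), $\partial_i(x_j)=\delta_{ij}$. For $1\le i\le 2r$: $\sigma(i)=1$, $i'=i+r$ if $i\le r$; $\sigma(i)=-1$, $i'=i-r$ if $i>r$. For $f\in\mathcal A(2r+1)$, $D_K(f)=\sum_{i=1}^{2r+1}f_i\partial_i$ with $f_j=x_j\partial_{2r+1}(f)+\sigma(j')\partial_{j'}(f)$ ($j\le2r$) and $f_{2r+1}=2f-\sum_{j=1}^{2r}\sigma(j)x_jf_{j'}$. $\widetilde K(2r+1)=\mathrm{span}\{D_K(x^\alpha)\mid\alpha\in I^{2r+1}\}$ and $K(2r+1)=[\widetilde K(2r+1),\widetilde K(2r+1)]$. $W(1)$ is the Witt algebra with basis $x_1^i\partial_1$; $W(1)_{[i]}=\mathbb Fx_1^{i+1}\partial_1$, $W(1)_0=\bigoplus_{i\ge0}W(1)_{[i]}$, $W(1)_1=\bigoplus_{i\ge1}W(1)_{[i]}$. For $\lambda\in I$, $\mathbb F_\lambda$ is the one-dimensional $W(1)_0$-module with $x_1\partial_1$ acting by $\lambda$ and $W(1)_1$ by $0$; $V(\lambda)=u(W(1))\otimes_{u(W(1)_0)}\mathbb F_\lambda$ ($u$ = restricted enveloping algebra) and $L(\lambda)$ its unique simple quotient. $[M]$ is the formal sum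 of composition factors of $M$ with multiplicity. *)

(* Defs.v *)
From HB Require Import structures.
From mathcomp Require Import all_boot all_order all_algebra.
Set Implicit Arguments. Unset Strict Implicit. Unset Printing Implicit Defensive.
Import Order.TTheory GRing.Theory Num.Theory.
Local Open Scope ring_scope.

Section Defs.
Variables (F : fieldType) (p : nat).

(* Truncated polynomial algebra A(n): coefficient functions on the    *)
(* exponent set I^n, I = {0,...,p-1}.                                  *)
Definition Mon (n : nat) := {ffun 'I_n -> 'I_p}.
Definition Apoly (n : nat) := {ffun Mon n -> F}.

(* x^alpha x^beta = x^(alpha+beta), 0 if alpha+beta is outside I^n.
   (We never use the pointwise ring structure of ffun.) *)
Definition mulA n (f g : Apoly n) : Apoly n :=
  [ffun gam : Mon n => \sum_(a : Mon n) \sum_(b : Mon n |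
      [forall k, (a k + b k)%N == (gam k : nat)]) f a * g b].

Definition dA n (i : 'I_n) (f : Apoly n) : Apoly n :=
  [ffun a : Mon n => \sum_(b : Mon n |
      [forall k, (b k : nat) == (a k + (k == i))%N]) (b i)%:R * f b].

(* the monomial x_j^e (zero if e >= p) *)
Definition xpow n (j : 'I_n) (e : nat) : Apoly n :=
  [ffun a : Mon n => if [forall k, (a k : nat) == (if k == j then e else 0)%N]
                     then 1 else 0].
Definition xvar n (j : 'I_n) : Apoly n := xpow j 1.
Definition xmon n (al : Mon n) : Apoly n := [ffun a : Mon n => (a == al)%:R].

Definition scaleA n (c : F) (f : Apoly n) : Apoly n := [ffun a => c * f a].

(* W(n): special derivations  sum_i f_i d_i, stored as (f_i)_i.        *)
Definition Wder (n : nat) := {ffun 'I_n -> Apoly n}.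

Definition applyW n (D : Wder n) (g : Apoly n) : Apoly n :=
  \sum_(i < n) mulA (D i) (dA i g).

Definition brW n (D E : Wder n) : Wder n :=
  [ffun i => applyW D (E i) - applyW E (D i)].

(* The contact map D_K on A(2r+1) (indices shifted to 0,...,2r).       *)
Section Contact.
Variable r : nat.
Local Notation n := (2 * r).+1.
Definition tK : 'I_n := ord_max.
Definition primeK (j : 'I_n) : 'I_n :=
  inord (if (j < r)%N then (j + r)%N else (j - r)%N).
Definition sigmaK (j : 'I_n) : F := if (j < r)%N then 1 else -1.

Definition DKcomp (f : Apoly n) (j : 'I_n) : Apoly n :=
  mulA (xvar j) (dA tK f) + scaleA (sigmaK (primeK j)) (dA (primeK j) f).

Definition DK (f : Apoly n) : Wder n :=
  [ffun j : 'I_n => if (j < 2 * r)%N then DKcomp f j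
     else scaleA 2 f -
          \sum_(k < n | (k < 2 * r)%N)
               scaleA (sigmaK k) (mulA (xvar k) (DKcomp f (primeK k)))].

Definition ThetaK (i : 'I_p) : Wder n :=
  [ffun j => scaleA (2%:R)^-1 (DK (xpow tK i) j)].

Definition NK := (n * #|{: Mon n}|)%N.
Definition vecW (D : Wder n) : 'rV[F]_NK :=
  mxvec (\matrix_(i < n, k < #|{: Mon n}|) D i (enum_val k)).
Definition unvecW (v : 'rV[F]_NK) : Wder n :=
  [ffun i => [ffun a : Mon n => vec_mx v i (enum_rank a)]].

(* K(2r+1) = [K~, K~], K~ = span of D_K(x^alpha): row space spanned by the
   brackets [D_K(x^a), D_K(x^b)]. *)
Definition Kgens : 'M[F]_(#|{: Mon n * Mon n}|, NK) :=
  \matrix_(k < #|{: Mon n * Mon n}|, l < NK)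
     vecW (brW (DK (xmon (enum_val k).1)) (DK (xmon (enum_val k).2))) 0 l.
Definition Kspace : 'M[F]_NK := (<< Kgens >>)%MS.

Definition actK (i : 'I_p) : 'M[F]_NK :=
  lin1_mx (fun v : 'rV[F]_NK => vecW (brW (ThetaK i) (unvecW v))).
End Contact.

(* W(1): elements are row vectors w (w_i = coefficient of x^i d).      *)
(* Dmat w : the derivation w acting on A(1) = F^p (row convention):    *)
(* x^i d (x^j) = j x^(i+j-1).                                          *)
Definition Dmat (w : 'rV[F]_p) : 'M[F]_p :=
  \matrix_(j < p, k < p) \sum_(i < p | (i + j == k.+1)%N) (j%:R * w 0 i).
(* a derivation of A(1) is determined by its value on x *)
Definition xvec : 'rV[F]_p := \row_(k < p) ((k : nat) == 1%N)%:R.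
Definition brW1 (w1 w2 : 'rV[F]_p) : 'rV[F]_p := w2 *m Dmat w1 - w1 *m Dmat w2.
(* p-map: w^[p] = D^p, i.e. the derivation D^p(x) d *)
Definition pW1 (w : 'rV[F]_p) : 'rV[F]_p := xvec *m (Dmat w ^+ p).
Definition eW1 (i : 'I_p) : 'rV[F]_p := delta_mx 0 i.

(* W(1)-modules, realised as subquotient data: an ambient space F^N,   *)
(* the matrices by which the basis vectors x^i d act (v |-> v *m A i), *)
(* and the subspace U (row space) which is the module.                 *)
Record Wmod := MkWmod { mN : nat; mA : 'I_p -> 'M[F]_mN; mU : 'M[F]_mN }.

Definition rho (M : Wmod) (w : 'rV[F]_p) : 'M[F]_(mN M) :=
  \sum_(i < p) w 0 i *: mA M i.
Arguments rho : clear implicits.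

Definition stable (M : Wmod) (X : 'M[F]_(mN M)) :=
  forall i, (X *m mA M i <= X)%MS.
Arguments stable : clear implicits.

(* w . v := v *m rho w ; [w1,w2].v = w1.(w2.v) - w2.(w1.v) on U *)
Definition is_module (M : Wmod) :=
  stable M (mU M) /\
  forall w1 w2, mU M *m (rho M (brW1 w1 w2)
                   - (rho M w2 *m rho M w1 - rho M w1 *m rho M w2)) = 0.

Definition is_restricted (M : Wmod) :=
  forall w, mU M *m (rho M (pW1 w) - rho M w ^+ p) = 0.

Definition is_hom (M M' : Wmod) (f : 'M[F]_(mN M, mN M')) :=
  (mU M *m f <= mU M')%MS /\
  forall i, mU M *m (mA M i *m f - f *m mA M' i) = 0.
Arguments is_hom : clear implicits.

(* mU M / Ulo is isomorphic to some module satisfying P *)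
Definition quot_iso (M : Wmod) (Ulo : 'M[F]_(mN M)) (P : Wmod -> Prop) :=
  exists M' (f : 'M[F]_(mN M, mN M')),
    [/\ P M', is_hom M M' f, (mU M *m f == mU M')%MS,
        Ulo *m f = 0 & (\rank (mU M *m f) + \rank Ulo)%N = \rank (mU M)].
Arguments quot_iso : clear implicits.

(* v spans a copy of F_lambda for W(1)_0 : x d acts by lambda, W(1)_1 by 0 *)
Definition hw_vec (lam : nat) (M : Wmod) (v : 'rV[F]_(mN M)) :=
  forall i : 'I_p, ((i : nat) = 1%N -> v *m mA M i = lam%:R *: v) /\
                   ((2 <= i)%N -> v *m mA M i = 0).
Arguments hw_vec : clear implicits.

(* M is (isomorphic to) V(lambda) = u(W(1)) (x)_{u(W(1)_0)} F_lambda :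
   the universal property of the induced module among u(W(1))-modules *)
Definition is_V (lam : nat) (M : Wmod) :=
  [/\ is_module M, is_restricted M &
   exists2 v : 'rV[F]_(mN M), (v <= mU M)%MS /\ hw_vec lam M v &
   forall M', is_module M' -> is_restricted M' ->
   forall w : 'rV[F]_(mN M'), (w <= mU M')%MS -> hw_vec lam M' w ->
   exists f, [/\ is_hom M M' f, v *m f = w &
              forall g, is_hom M M' g -> v *m g = w -> mU M *m g = mU M *m f]].

Definition is_simple (M : Wmod) :=
  [/\ is_module M, mU M != 0 &
   forall X, (X <= mU M)%MS -> stable M X -> X = 0 \/ (X == mU M)%MS].

(* M is (isomorphic to) L(lambda), the unique simple quotient of V(lambda) *)
Definition is_L (lam : nat) (M : Wmod) :=
  is_simple M /\
  exists MV, is_V lam MV /\ exists f, is_hom MV M f /\ (mU MV *m f == mU M)%MS.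

Inductive summand := SV of nat | SL of nat.
Definition summand_pred (s : summand) : Wmod -> Prop :=
  match s with SV l => is_V l | SL l => is_L l end.

Definition decomposes_as (M : Wmod) (s : seq summand) :=
  exists Us : 'I_(size s) -> 'M[F]_(mN M),
    [/\ forall k, (Us k <= mU M)%MS /\ stable M (Us k),
        mxdirect (\sum_k Us k),
        (\sum_k Us k == mU M)%MS &
        forall k, quot_iso (MkWmod (mA M) (Us k)) 0 (summand_pred (nth (SV 0) s k))].

Definition comp_series (M : Wmod) (m : nat) (Us : 'I_m.+1 -> 'M[F]_(mN M)) :=
  [/\ Us ord0 = 0, (Us ord_max == mU M)%MS,
      forall k, stable M (Us k) &
      forall k : 'I_m, let lo := Us (widen_ord (leqnSn m) k) in
                       let hi := Us (lift ord0 k) in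
        [/\ (lo < hi)%MS &
         forall X, (lo <= X)%MS -> (X <= hi)%MS -> stable M X ->
                   (X == lo)%MS \/ (X == hi)%MS]].

Definition factor_is_L (M : Wmod) m (Us : 'I_m.+1 -> 'M[F]_(mN M)) (k : 'I_m)
  (lam : nat) :=
  quot_iso (MkWmod (mA M) (Us (lift ord0 k))) (Us (widen_ord (leqnSn m) k)) (is_L lam).

End Defs.

Arguments decomposes_as {F p} M s.
Arguments comp_series {F p} M m Us.
Arguments factor_is_L {F p} M {m} Us k lam.

Definition Kmod (F : fieldType) (p r : nat) : Wmod F p :=
  @MkWmod F p _ (@actK F p r) (@Kspace F p r).

Definition Kdecomp (p r : nat) : seq summand :=
  let q := (p ^ (2 * r - 1))%N in
  if (p %| 2 * r + 4)%N then
    nseq (q - 1) (SV 0) ++ nseq q (SV p.-1) ++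
    flatten [seq nseq q (SL i) | i <- iota 1 (p - 2)] ++ [:: SL p.-1]
  else
    nseq q (SV 0) ++ nseq q (SV p.-1) ++
    flatten [seq nseq q (SL i) | i <- iota 1 (p - 2)].

Definition Kmult (p r lam : nat) : nat :=
  let q := (p ^ (2 * r - 1))%N in
  if lam == 0%N then (if (p %| 2 * r + 4)%N then 2 * q - 1 else 2 * q)%N
  else if lam == p.-1 then (2 * q)%N else q.

(* Main.v *)
Require Import Defs.
From HB Require Import structures.
From mathcomp Require Import all_boot all_order all_algebra zify ring.
Set Implicit Arguments. Unset Strict Implicit. Unset Printing Implicit Defensive.
Import GRing.Theory.
Local Open Scope ring_scope.

(** Let [T_c] be the module of densities [g (dx)^c] over the truncated polynomial
algebra in one variable, so that [x^i d] sends [x^k] to [(k + i c) x^(k+i-1)].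
It is restricted, and the vector [x^(p-1)] exhibits it as [V(c-1)].  Weight
vectors show that it is simple unless [c] is 0 or 1 modulo [p]; [T_0] has the
constants as its only proper submodule, and [T_1] the exact forms.

The contact bracket satisfies [[D_K f, D_K g] = D_K <f, g>] with
[<f, g> = D_K(f)(g) - 2 (d f/d t) g], hence [x^beta t^k], with [beta] fixed and
[k] varying, spans a copy of [T_c] with [c = |beta|/2 - 1].  Each value of [c]
modulo [p] is taken by [p^(2r-1)] exponents [beta].  The coefficient of
the top monomial in [<f, g>] is [2r + 4] times that of [f (d g/d t)], so [K]
misses exactly the top monomial when [p] divides [2r + 4]; this turns one copy
of [T_1] into its submodule of exact forms.  The statement on composition
factors is then the Jordan-Hölder theorem. *)

(** * Density modules over the Witt algebra *)

(** Half the bracket of [t^i] with [x^beta t^k] has coefficient [k + i (|beta|/2 - 1)], so the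
    highest weight [lam = c - 1] of a block satisfies [|beta| = 2 (lam + 2)]. Adding 2 cyclically to
    one exponent raises [lam] by 1, whence the equal distribution. The top monomial has
    [|beta| = 2r(p-1) = -2r] modulo [p], so [2r + 4 = 0] forces [lam = 0] there: this is why the
    truncated block is a copy of [T_1]. The two reducible types are linked by the derivative
    [T_0 -> T_1], whose image is [L(p-1)]. The obstacle is that isomorphism types are known only
    through maps and a universal property, inside one ambient space. Each block is therefore carried
    by an embedding matrix together with a coordinate matrix, and submodules are stacked block by
    block. The statement on multiplicities is an equivalence, so it also requires that no quotient
    is isomorphic to two different [L(lam)]; weights of generators and the vanishing of [d^p] settle
    this. *)

Lemma row_pid_mx (F : fieldType) n k (i : 'I_n) :
  row i (pid_mx k : 'M[F]_n) = if (i < k)%N then delta_mx 0 i else 0.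
Proof. by apply/rowP=> l; rewrite !mxE; case: ifP; rewrite !mxE ?andbF // andbT eqxx eq_sym. Qed.

Lemma dvdn_add_small j k p : (j < p)%N -> (k < p)%N -> (p %| j + k)%N ->
  j = 0%N \/ (j + k)%N = p.
Proof. by move=> jp kp /dvdnP[[|[|q]]] h; [left|right|]; lia. Qed.

Lemma mulmx_rowP (F : fieldType) m n (A B : 'M[F]_(m, n)) :
  (forall v : 'rV_m, v *m A = v *m B) -> A = B.
Proof. by move=> h; apply/row_matrixP=> i; rewrite !rowE. Qed.

(** * Leibniz formula for iterated operators *)

Section Leibniz.
Variables (R : comNzRingType) (D1 D2 D3 : {additive R -> R}).
Hypothesis D3M : forall g h, D3 (g * h) = D1 g * h + g * D2 h.

(** The three operators differ because a product of densities of weights [a] and [b] has weight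
    [a + b], and each weight has its own Lie derivative. *)
Lemma iter_leibniz n g h :
  iter n D3 (g * h) =
  \sum_(i < n.+1) (iter (n - i) D1 g * iter i D2 h) *+ 'C(n, i).
Proof.
elim: n => [|n IHn]; first by rewrite big_ord_recl big_ord0 bin0 addr0 mulr1n.
rewrite iterS {}IHn raddf_sum /=.
under eq_bigr => i _ do rewrite raddfMn /= D3M -!iterS mulrnDl.
rewrite big_split /= [RHS]big_ord_recl [X in X + _]big_ord_recl.
rewrite [X in _ + X = _]big_ord_recr /= [X in _ = _ + X]big_ord_recr /=.
rewrite !bin0 subn0 !binn !subnn /=.
under [X in _ = _ + (X + _)]eq_bigr => i _ do rewrite /bump /= add1n binS mulrnDr subSS.
rewrite big_split /= -!addrA; congr (_ + _); rewrite !addrA; congr (_ + _ + _).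
apply: eq_bigr => i _; rewrite /bump /= add1n; congr (_ * _ *+ _).
by rewrite -iterS -subSn ?subSS.
Qed.

Lemma iter_leibniz_pchar p g h : p \in [pchar R] ->
  iter p D3 (g * h) = iter p D1 g * h + g * iter p D2 h.
Proof.
move=> charR; have p_pr := pcharf_prime charR; have := prime_gt0 p_pr.
case: p charR p_pr => // p charR p_pr _.
rewrite iter_leibniz big_ord_recl big_ord_recr /= /bump /= add1n subnn binn.
rewrite bin0 big1 ?add0r // => i _.
rewrite /bump add1n -mulr_natr.
have /eqP -> : ('C(p.+1, i.+1)%:R == 0 :> R).
  by rewrite -(dvdn_pcharf charR) prime_dvd_bin //= !ltnS.
by rewrite mulr0.
Qed.
End Leibniz.

Lemma sub_mul0mx (F : fieldType) m n q k (x : 'M[F]_(k, n)) (U : 'M[F]_(m, n))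
    (Z : 'M[F]_(n, q)) : (x <= U)%MS -> U *m Z = 0 -> x *m Z = 0.
Proof. by case/submxP=> y ->; rewrite -mulmxA => ->; rewrite mulmx0. Qed.

(** One step of a composition chain in the form that [comp_series] asks for, with the type of the
    quotient recorded. Both submodules keep the ambient matrices, since no quotient space is
    formed. *)
Definition simple_factor (F : fieldType) (p : nat) N (A : 'I_p -> 'M[F]_N) (lo hi : 'M[F]_N) lam :=
  [/\ [/\ @stable F p (MkWmod A hi) lo, @stable F p (MkWmod A hi) hi & (lo < hi)%MS],
      forall X : 'M_N, (lo <= X)%MS -> (X <= hi)%MS -> @stable F p (MkWmod A hi) X ->
        (X == lo)%MS \/ (X == hi)%MS &
      @quot_iso F p (MkWmod A hi) lo (is_L lam)].

Lemma mulmx_eq (F : fieldType) m n q k (U : 'M[F]_(m, n)) (x : 'M[F]_(k, n))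
    (A B : 'M[F]_(n, q)) : (x <= U)%MS -> U *m (A - B) = 0 -> x *m A = x *m B.
Proof.
move=> xU h; apply/eqP; rewrite -subr_eq0 -mulmxBr; apply/eqP; exact: sub_mul0mx h.
Qed.

(** By rank-nullity the kernel of [f] on [U] has the rank of [lo], so the rank equation in
    [quot_iso] makes [lo] the whole kernel. *)
Lemma quot_ker (F : fieldType) n m k q (U : 'M[F]_(k, n)) (lo : 'M[F]_(q, n))
    (f : 'M[F]_(n, m)) (x : 'rV[F]_n) :
  (lo <= U)%MS -> lo *m f = 0 -> (\rank (U *m f) + \rank lo)%N = \rank U ->
  (x <= U)%MS -> x *m f = 0 -> (x <= lo)%MS.
Proof.
move=> loU lof rk xU xf.
have lok : (lo <= U :&: kermx f)%MS by rewrite sub_capmx loU; apply/sub_kermxP.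
have : (U :&: kermx f <= lo)%MS.
  rewrite -(geq_leqif (mxrank_leqif_sup lok)).
  by have := mxrank_mul_ker U f; lia.
by apply: submx_trans; rewrite sub_capmx xU; apply/sub_kermxP.
Qed.

Section WittModules.
Variables (F : fieldType) (p' : nat).
Local Notation p := p'.+1.
Hypothesis charF : p \in [pchar F].
Hypothesis p_gt2 : (2 < p)%N.

Let p_pr : prime p := pcharf_prime charF.
Let p_gt1 : (1 < p)%N := prime_gt1 p_pr.
Let natp0 : p%:R = 0 :> F := pcharf0 charF.
Let p'_gt0 : (0 < p')%N. Proof. by lia. Qed.
Let i1 : 'I_p := inord 1.
Let i1E : i1 = 1%N :> nat. Proof. by rewrite inordK //; lia. Qed.

Local Notation b k := (poly_rV 'X^k : 'rV[F]_p).

(* The action of [u * d/dx] on the density [g * (dx)^c]. *)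
Definition lie (c : nat) (u g : {poly F}) : {poly F} :=
  u * g^`() + (u^`() * g) *+ c.

Definition densA (c : nat) (i : 'I_p) : 'M[F]_p :=
  \matrix_(k, l) ((k + i * c)%:R *+ (l.+1 == k + i)%N).

(* [V(lam)] is the density module [dens lam.+1], generated by [x^(p-1)]. *)
Definition dens (c : nat) : Wmod F p := MkWmod (densA c) 1%:M.

(** Multiplication by [X] turns the derivative into the degree operator, which is diagonal on
    coefficients; the coefficient at [l] is thus read at [l + 1] in [X * lie c u g]. *)
Lemma coef_lie c u g l :
  (lie c u g)`_l = \sum_(i < l.+2) (u`_i * g`_(l.+1 - i)) *+ (l.+1 - i + i * c).
Proof.
have coefXD (h : {poly F}) k : ('X * h^`())`_k = h`_k *+ k.
  by rewrite coefXM; case: k => [|k]; rewrite ?mulr0n ?coef_deriv.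
have -> : (lie c u g)`_l = ('X * lie c u g)`_l.+1 by rewrite coefXM.
rewrite /lie mulrDr mulrCA mulrnAr ['X * (u^`() * g)]mulrA coefD.
rewrite coefMn !coefM -sumrMnl -big_split; apply: eq_bigr => i _ /=.
by rewrite !coefXD mulrnAr mulrnAl -mulrnA -mulrnDr.
Qed.

(** In characteristic [p] the derivative of [X^p] vanishes, so truncation commutes with Lie
    derivatives, and identities in the modules can be checked on untruncated polynomials. The only
    dropped terms that reach degree below [p] pair [X^p] with a constant, and their coefficient is a
    multiple of [p]. *)
Lemma rho_lie c u g :
  poly_rV (lie c u g) = poly_rV g *m rho (dens c) (poly_rV u) :> 'rV_p.
Proof.
apply/rowP=> l; rewrite !mxE coef_lie.
pose H (i k : nat) := (u`_i * g`_k) *+ (k + i * c).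
rewrite -[LHS]/(\sum_(i < l.+2) H i (l.+1 - i)%N).
rewrite (@big_ord_widen _ _ _ l.+2 p.+1 (fun i => H i (l.+1 - i)%N)) //=; last first.
  by rewrite ltnS ltn_ord.
rewrite big_mkcond big_ord_recr /=.
have -> : (if (p'.+1 < l.+2)%N then H p'.+1 (l.+1 - p'.+1)%N else 0) = 0.
  case: ifP => // hl; have -> : (l.+1 - p'.+1 = 0)%N by have := ltn_ord l; lia.
  by rewrite /H add0n -mulr_natr natrM natp0 mul0r mulr0.
rewrite addr0.
under [RHS]eq_bigr => k _ do rewrite /rho /= summxE mulr_sumr.
rewrite exchange_big; apply: eq_bigr => i _ /=.
under eq_bigr => k _ do rewrite !mxE.
case: ifP => hil; last first.
  rewrite big1 // => k _; case: eqP => hl; last by rewrite !mulr0.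
  by move: hil; rewrite hl; lia.
case: (ltnP (l.+1 - i) p) => hk; last first.
  have i0 : (i : nat) = 0%N by have := ltn_ord l; lia.
  have lp : l.+1 = p by have := ltn_ord l; lia.
  rewrite i0 subn0 lp /H mul0n addn0 -mulr_natr natp0 mulr0 big1 // => k _.
  by case: eqP => [h|]; rewrite ?mulr0 //; have := ltn_ord k; lia.
rewrite (bigD1 (Ordinal hk)) //= big1 ?addr0 => [|k].
  have -> : (l.+1 == l.+1 - i + i)%N by rewrite subnK //; lia.
  by rewrite /H -mulr_natr mulrA [u`_i * _]mulrC.
rewrite -val_eqE /= => hk'; case: eqP => hl; last by rewrite !mulr0.
by move: hk'; rewrite hl addnK eqxx.
Qed.

Lemma Dmat_rho w : Dmat w = rho (dens 0) w :> 'M[F]_p.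
Proof.
apply/matrixP=> j k; rewrite mxE /rho summxE big_mkcond; apply: eq_bigr => i _ /=.
by rewrite !mxE muln0 addn0 eq_sym addnC; case: eqP => _; rewrite ?mulr0 // mulrC.
Qed.

Lemma brW1E u1 u2 :
  brW1 (poly_rV u1) (poly_rV u2) = poly_rV (u1 * u2^`() - u2 * u1^`()) :> 'rV[F]_p.
Proof. by rewrite /brW1 !Dmat_rho -!rho_lie /lie !mulr0n !addr0 -linearB. Qed.

Lemma mulmx_rhoX c u g n :
  poly_rV g *m rho (dens c) (poly_rV u) ^+ n = poly_rV (iter n (lie c u) g) :> 'rV_p.
Proof.
elim: n => [|n IHn]; first by rewrite expr0 mulmx1.
by rewrite exprSr mulmxA IHn -rho_lie iterS.
Qed.

Lemma pW1E u : pW1 (poly_rV u) = poly_rV (iter p (lie 0 u) 'X) :> 'rV[F]_p.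
Proof.
rewrite /pW1 Dmat_rho.
have -> : xvec F p = poly_rV 'X by apply/rowP=> k; rewrite !mxE coefX.
exact: mulmx_rhoX.
Qed.

Lemma dens_module c : is_module (dens c).
Proof.
split=> [i|w1 w2]; first exact: submx1.
rewrite mul1mx; apply/eqP; rewrite subr_eq0; apply/eqP/mulmx_rowP => v /=.
rewrite -[v]rVpolyK -[w1]rVpolyK -[w2]rVpolyK brW1E mulmxBr !mulmxA -!rho_lie -linearB.
congr poly_rV; rewrite /lie.
rewrite !(derivB, derivD, derivMn, derivM); ring.
Qed.

Fact lie_additive c u : additive (lie c u).
Proof. by move=> g h; rewrite /lie derivB !mulrBr mulrnBl; ring. Qed.
HB.instance Definition _ c u := GRing.isAdditive.Build _ _ (lie c u) (lie_additive c u).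

Lemma lieM a b u g h : lie (a + b) u (g * h) = lie a u g * h + g * lie b u h.
Proof. by rewrite /lie derivM; ring. Qed.

Lemma lie_deriv u g : lie 1 u g^`() = (lie 0 u g)^`().
Proof. by rewrite /lie mulr0n addr0 mulr1n derivM addrC. Qed.

(** The [p]-th power of the derivation [u d] is a derivation, fixed by its value [U] at [X]: this is
    weight 0. The derivative carries weight 0 to weight 1 and gives the value [U'] on [dx].
    Splitting [g (dx)^(c+1)] as [g (dx)^c] times [dx], the Leibniz rule for [p]-th powers does the
    induction on [c]. *)
Lemma lie_iter c u g :
  iter p (lie c u) g = lie c (iter p (lie 0 u) 'X) g.
Proof.
have charP : p \in [pchar {poly F}] by rewrite (rmorph_pchar polyC).
have it1 n h : iter n (lie 1 u) h^`() = (iter n (lie 0 u) h)^`().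
  by elim: n => [|n IHn] //; rewrite !iterS IHn lie_deriv.
have lie1 : iter p (lie 1 u) 1 = (iter p (lie 0 u) 'X)^`() by rewrite -it1 derivX.
set U := iter p (lie 0 u) 'X in lie1 *.
have itM a b g1 g2 : iter p (lie (a + b) u) (g1 * g2)
      = iter p (lie a u) g1 * g2 + g1 * iter p (lie b u) g2.
  exact: (iter_leibniz_pchar (lieM a b u)).
elim: c g => [|c IHc] g; last first.
  rewrite -{1}[g]mulr1 -[c.+1]addn1 itM IHc lie1 /lie; ring.
have it0M g1 g2 := itM 0%N 0%N g1 g2; rewrite addn0 in it0M.
rewrite /lie mulr0n addr0.
have itD n g1 g2 : iter n (lie 0 u) (g1 + g2) = iter n (lie 0 u) g1 + iter n (lie 0 u) g2.
  by elim: n => [|n IHn] //; rewrite !iterS IHn raddfD.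
have itC a : iter p (lie 0 u) a%:P = 0.
  rewrite iterSr /lie derivC mulr0 mulr0n addr0.
  by elim: p' => // n IHn; rewrite iterS IHn /lie deriv0 mulr0 mulr0n addr0.
elim/poly_ind: g => [|q a IHq]; first by rewrite deriv0 mulr0 -[X in iter _ _ X]polyC0 itC.
rewrite itD itC it0M IHq -/U derivD derivC derivM derivX; ring.
Qed.

Lemma dens_restricted c : is_restricted (dens c).
Proof.
move=> w; rewrite mul1mx; apply/eqP; rewrite subr_eq0; apply/eqP/mulmx_rowP => v /=.
rewrite -[v]rVpolyK -[w]rVpolyK mulmx_rhoX lie_iter pW1E.
by rewrite -rho_lie.
Qed.

Lemma natF_eq0 n : (n%:R == 0 :> F) = (p %| n)%N.
Proof. by rewrite -(dvdn_pcharf charF). Qed.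

Lemma natF_inj a b : (a < p)%N -> (b < p)%N -> a%:R = b%:R :> F -> a = b.
Proof.
wlog le_ab : a b / (a <= b)%N => [hw|] lta ltb.
  by case/orP: (leq_total a b) => h e; [|symmetry]; apply: hw.
move/eqP; rewrite eq_sym -subr_eq0 -natrB // natF_eq0 => /dvdn_leq.
by case: (posnP (b - a)) => [|h /(_ isT)]; lia.
Qed.

(** Weights lie in the prime field, which Frobenius fixes. The power [p - 1] of a shifted weight
    operator is therefore 0 on one weight and 1 on the others, which yields weight projections. *)
Lemma fermat_natB a b (x := a%:R - b%:R : F) : x != 0 -> x ^+ p' = 1.
Proof.
move=> x0; apply: (mulfI x0); rewrite mulr1 -exprS -(pFrobenius_autE charF) /x.
by rewrite rmorphB /= !pFrobenius_aut_nat.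
Qed.

Lemma poly_rV_delta (k : 'I_p) : poly_rV 'X^k = delta_mx 0 k :> 'rV[F]_p.
Proof. by apply/rowP=> l; rewrite !mxE coefXn eqxx. Qed.

Lemma poly_rVXn_ge k : (p <= k)%N -> poly_rV 'X^k = 0 :> 'rV[F]_p.
Proof.
by move=> hk; apply/rowP=> l; rewrite !mxE coefXn; have := ltn_ord l; case: eqP => //; lia.
Qed.

Lemma rho_eW1 (M : Wmod F p) i : rho M (eW1 F i) = mA M i.
Proof.
rewrite /rho (bigD1 i) //= big1 => [|j hj]; rewrite !mxE ?eqxx.
  by rewrite scale1r addr0.
by rewrite (negPf hj) scale0r.
Qed.

(** At [k = i = 0] the truncated predecessor comes with coefficient 0; for [k] from [p] on both
    sides vanish, for [k = p] and [i = 0] because the coefficient is [p]. *)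
Lemma densA_Xn c k (i : 'I_p) :
  poly_rV 'X^k *m densA c i = (k + i * c)%:R *: poly_rV 'X^((k + i).-1) :> 'rV[F]_p.
Proof.
rewrite -[densA c i]/(mA (dens c) i) -rho_eW1 /eW1 -poly_rV_delta -rho_lie //.
rewrite -linearZ /=; congr poly_rV; rewrite /lie !derivXn.
rewrite mulrnAr -exprD mulrnAl -exprD scaler_nat mulrnDr [X in _ = _ + X]mulrnA.
move: (nat_of_ord i) => {}i; case: k i => [|k] [|i]; rewrite ?mulr0n ?mul0rn ?add0r //=.
- by rewrite addn0.
- by rewrite addnC.
- by rewrite [(k + _)%N]addnC addSnnS.
Qed.

(** * The universal property of the density modules *)

Lemma densA0_falling c j : (j <= p')%N ->
  exists2 a : F, a != 0 &
    poly_rV 'X^p' *m densA c ord0 ^+ j = a *: poly_rV 'X^(p' - j) :> 'rV[F]_p.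
Proof.
elim: j => [_|j IHj hj]; first by exists 1; rewrite ?oner_eq0 // expr0 mulmx1 subn0 scale1r.
have [a a0 ha] := IHj (ltnW hj).
(* The scalar is a falling factorial of [p - 1] with no factor divisible by [p]; hence [x^(p-1)]
   reaches every monomial. *)
exists (a * (p' - j)%:R).
  rewrite mulf_neq0 // natF_eq0; apply/negP=> /dvdn_leq; lia.
by rewrite exprSr mulmxA ha -scalemxAl densA_Xn scalerA /= mul0n !addn0 subnS.
Qed.

Lemma module_comm0 (M : Wmod F p) (x : 'rV_(mN M)) (i : 'I_p) :
  is_module M -> (x <= mU M)%MS ->
  x *m mA M ord0 *m mA M i
    = x *m mA M i *m mA M ord0 - i%:R *: (x *m mA M (inord i.-1)).
Proof.
move=> [_ hM] hx; have := sub_mul0mx hx (hM (eW1 F i) (eW1 F ord0)).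
have -> : brW1 (eW1 F i) (eW1 F ord0) = - (i%:R *: eW1 F (inord i.-1)) :> 'rV[F]_p.
  rewrite /eW1 -!poly_rV_delta brW1E // expr0 derivC mulr0 sub0r mul1r derivXn.
  by rewrite -scaler_nat linearN linearZ /= inordK //; have := ltn_ord i; lia.
have -> : rho M (- (i%:R *: eW1 F (inord i.-1))) = - (i%:R *: mA M (inord i.-1)).
  rewrite -rho_eW1 /rho scaler_sumr -sumrN; apply: eq_bigr => j _.
  by rewrite !mxE scalerA scaleNr.
rewrite !rho_eW1 mulmxBr => /eqP; rewrite subr_eq0 mulmxBr !mulmxA mulmxN -scalemxAr.
by move/eqP=> ->; rewrite addrC subrK.
Qed.

(** The derivative kills [X] after two steps, so the [p]-map sends [d] to 0. *)
Lemma restricted_pow0 (M : Wmod F p) (x : 'rV_(mN M)) :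
  is_restricted M -> (x <= mU M)%MS -> x *m mA M ord0 ^+ p = 0.
Proof.
move=> hM hx; have := sub_mul0mx hx (hM (eW1 F ord0)).
rewrite rho_eW1 /eW1 -poly_rV_delta pW1E //.
have -> : iter p (lie 0 'X^(@ord0 p')) 'X = 0 :> {poly F}.
  have [q p'E] : exists q, p' = q.+1 by case: (p') p_gt1 => // q _; exists q.
  have lie0 : iter q (lie 0 1) 0 = 0 :> {poly F}.
    by elim: q {p'E} => // q IHq; rewrite iterS IHq /lie deriv0 mulr0 mulr0n addr0.
  by rewrite expr0 p'E !iterSr /lie !mulr0n !addr0 derivX mulr1 derivC mulr0 lie0.
rewrite linear0 mulmxBr => /eqP; rewrite subr_eq0 => /eqP <-.
by rewrite /rho big1 ?mulmx0 // => i _; rewrite mxE scale0r.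
Qed.

Lemma stable_mul (M : Wmod F p) (X : 'M_(mN M)) (x : 'rV_(mN M)) i :
  @stable F p M X -> (x <= X)%MS -> (x *m mA M i <= X)%MS.
Proof. by move=> hX hx; apply: submx_trans (hX i); apply: submxMr. Qed.

Lemma stable_mulX (M : Wmod F p) (X : 'M_(mN M)) (x : 'rV_(mN M)) i n :
  @stable F p M X -> (x <= X)%MS -> (x *m mA M i ^+ n <= X)%MS.
Proof.
move=> hX hx; elim: n => [|n IHn]; first by rewrite expr0 mulmx1.
by rewrite exprSr mulmxA stable_mul.
Qed.

(** The exponent [p - 1] contributes -1 to the weight, which is why [V(lam)] consists of densities
    of weight [lam.+1]. *)
Lemma dens_hw lam : @hw_vec F p lam (dens lam.+1) (poly_rV 'X^p').
Proof.
move=> i; rewrite densA_Xn; split=> [->|hi].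
  by rewrite mul1n addn1 addnS -addSn natrD natp0 add0r.
by rewrite poly_rVXn_ge ?scaler0 //; lia.
Qed.

(** The iterates of [d] on [x^(p-1)] form a basis, so the map is forced: iterates of [v] go to the
    same iterates of [w]. What remains is that it commutes with every [x^i d]. *)
Lemma dens_univ lam (M' : Wmod F p) (w : 'rV_(mN M'))
    (v := poly_rV 'X^p' : 'rV_(mN (dens lam.+1))) :
  is_module M' -> is_restricted M' -> (w <= mU M')%MS -> hw_vec lam w ->
  exists f, [/\ @is_hom F p (dens lam.+1) M' f, v *m f = w &
    forall g, @is_hom F p (dens lam.+1) M' g -> v *m g = w ->
      mU (dens lam.+1) *m g = mU (dens lam.+1) *m f].
Proof.
move=> M'mod M'res wM whw.
pose E : 'I_p -> 'M[F]_p := densA lam.+1.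
pose C := \matrix_(j < p) (v *m E ord0 ^+ j); pose W := \matrix_(j < p) (w *m mA M' ord0 ^+ j).
have Cfull : C \in unitmx.
  rewrite -row_full_unit -sub1mx; apply/row_subP=> k; rewrite rowE mulmx1 -poly_rV_delta.
  have [a a0] := @densA0_falling lam.+1 (p' - k) (leq_subr _ _).
  have -> : (p' - (p' - k) = k)%N by have := ltn_ord k; lia.
  move=> h; have lt : (p' - k < p)%N by lia.
  have := row_sub (Ordinal lt) C; rewrite rowK /= h; apply: submx_trans.
  by rewrite -(eqmx_scale _ a0).
pose f := invmx C *m W.
have Cf (j : 'I_p) : v *m E ord0 ^+ j *m f = w *m mA M' ord0 ^+ j.
  have <- : row j C = v *m E ord0 ^+ j by rewrite rowK.
  by rewrite -row_mul mulmxA mulmxV // mul1mx rowK.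
clearbody f.
(* From [n = p] on both sides vanish, as both modules are restricted. *)
have CfE (n : nat) : v *m E ord0 ^+ n *m f = w *m mA M' ord0 ^+ n.
  case: (ltnP n p) => hn; first exact: (Cf (Ordinal hn)).
  rewrite -(subnKC hn) !exprD !mulmxA (@restricted_pow0 M' w) //.
  by rewrite (@restricted_pow0 (dens lam.+1) v) ?mul0mx ?submx1 //; apply: dens_restricted.
have stM' := M'mod.1.
have Ecomm (x : 'rV_p) (i : 'I_p) : x *m E ord0 *m E i
    = x *m E i *m E ord0 - i%:R *: (x *m E (inord i.-1)).
  exact: (@module_comm0 (dens lam.+1) x i (dens_module _) (submx1 _)).
have fU n : (v *m E ord0 ^+ n *m f <= mU M')%MS by rewrite CfE; apply: stable_mulX.
have f0 : E ord0 *m f = f *m mA M' ord0.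
  apply: (can_inj (mulKmx Cfull)); apply/row_matrixP=> j.
  rewrite !mulmxA !row_mul rowK CfE.
  by have := CfE j.+1; rewrite !exprSr !mulmxA.
(* Moving [x^i d] past one [d] leaves a multiple of [x^(i-1) d] at the smaller [n], which the
   induction covers for all [i]; at [n = 0] the highest weight conditions on [v] and [w] agree. *)
have f_hom n i : v *m E ord0 ^+ n *m E i *m f = v *m E ord0 ^+ n *m f *m mA M' i.
  elim: n i => [|n IHn] i.
    rewrite expr0 mulmx1; have := dens_hw lam i; have := whw i.
    have vf : v *m f = w by have := CfE 0%N; rewrite !expr0 !mulmx1.
    rewrite vf -/E -/v; case: i => [[|[|i]] hi] [h1 h2] [h3 h4].
    - have := CfE 1%N; rewrite !expr1; have -> : Ordinal hi = ord0 by apply: val_inj. by [].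
    - by rewrite (h3 _) // (h1 _) // -scalemxAl vf.
    - by rewrite (h4 _) // (h2 _) // mul0mx.
  rewrite exprSr mulmxA.
  rewrite Ecomm mulmxBl -scalemxAl !IHn.
  by rewrite -!(mulmxA _ (E ord0) f) f0 !mulmxA IHn module_comm0 ?fU.
exists f; split.
- split; last first.
    move=> i; rewrite mul1mx; apply/eqP; rewrite subr_eq0; apply/eqP.
    apply: (can_inj (mulKmx Cfull)); apply/row_matrixP=> j.
    by rewrite !mulmxA !row_mul rowK f_hom.
  rewrite mul1mx; have: (f <= C *m f)%MS by rewrite -{1}[f](mulKmx Cfull) submxMl.
  by move/submx_trans; apply; apply/row_subP=> j; rewrite row_mul rowK fU.
- by have := CfE 0%N; rewrite !expr0 !mulmx1.
- move=> g [_ ghom] vg; rewrite !mul1mx; apply: (can_inj (mulKmx Cfull)).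
  apply/row_matrixP=> j; rewrite !row_mul !rowK CfE.
  elim: (nat_of_ord j) => [|n IHn]; first by rewrite !expr0 !mulmx1.
  have /eqP := ghom ord0; rewrite mul1mx subr_eq0 => /eqP.
  rewrite -[mA _ _]/(E ord0) => g0.
  by rewrite !exprSr !mulmxA -IHn -(mulmxA _ (E ord0) g) g0 mulmxA.
Qed.

Lemma dens_V lam : is_V lam (dens lam.+1).
Proof.
split; [exact: dens_module | exact: dens_restricted |].
exists (poly_rV 'X^p'); first by split; [exact: submx1 | exact: dens_hw].
by move=> M' M'mod M'res w wM whw; apply: dens_univ.
Qed.

(** * Submodules of the density modules *)

Lemma rV_sum_Xn (v : 'rV[F]_p) : v = \sum_(k < p) v 0 k *: b k.
Proof. by rewrite {1}[v]row_sum_delta; apply: eq_bigr => k _; rewrite poly_rV_delta. Qed.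

Lemma Xn_sub_pid (k : 'I_p) m : (b k <= (pid_mx m : 'M[F]_p))%MS = (k < m)%N.
Proof.
rewrite poly_rV_delta; case: ltnP => hk.
  have := row_sub k (pid_mx m : 'M[F]_p); congr (_ <= _)%MS.
  by apply/rowP=> l; rewrite !mxE hk andbT eqxx eq_sym.
apply/negP=> /submxP[y] /rowP /(_ k); rewrite !mxE !eqxx big1 => [/eqP|l _].
  by rewrite oner_eq0.
by rewrite !mxE; case: eqP => [->|_]; rewrite ?mulr0 // ltnNge hk mulr0.
Qed.

Lemma pid_subP q m (X : 'M[F]_(q, p)) :
  ((pid_mx m : 'M[F]_p) <= X)%MS <-> (forall k : 'I_p, (k < m)%N -> (b k <= X)%MS).
Proof.
split=> [h k hk|h]; first by apply: submx_trans h; rewrite Xn_sub_pid.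
apply/row_subP=> k; rewrite row_pid_mx; case: ifP => hk; last exact: sub0mx.
by rewrite -poly_rV_delta; apply: h.
Qed.

Lemma Xn_weight c d l n : b l *m (densA c i1 - d%:R%:M) ^+ n
  = ((l + c)%:R - d%:R) ^+ n *: b l.
Proof.
elim: n => [|n IHn]; first by rewrite !expr0 mulmx1 scale1r.
rewrite exprSr mulmxA IHn -scalemxAl mulmxBr densA_Xn // i1E addn1 mul_mx_scalar.
by rewrite -scalerBl scalerA exprSr mul1n.
Qed.

(** Distinct exponents below [p] have distinct weights, so [1 - P^(p-1)] projects onto the line of
    [x^k]. *)
Lemma weight_component c (X : 'M[F]_p) (v : 'rV[F]_p) (k : 'I_p) :
  @stable F p (dens c) X -> (v <= X)%MS -> v 0 k != 0 -> (b k <= X)%MS.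
Proof.
move=> stX vX vk; pose P := densA c i1 - (k + c)%:R%:M.
have vP n : (v *m P ^+ n <= X)%MS.
  elim: n => [|n IHn]; first by rewrite expr0 mulmx1.
  rewrite exprSr mulmxA mulmxBr addmx_sub ?eqmx_opp ?mul_mx_scalar ?scalemx_sub //.
  exact: (@stable_mul (dens c)).
have -> : b k = (v 0 k)^-1 *: (v - v *m P ^+ p').
  rewrite {2 3}[v]rV_sum_Xn mulmx_suml -sumrB (bigD1 k) //= big1 ?addr0 => [|l hl].
    by rewrite -scalemxAl Xn_weight subrr expr0n gtn_eqF ?scale0r ?scaler0 ?subr0 ?scalerA ?mulVf ?scale1r //; lia.
  rewrite -scalemxAl Xn_weight fermat_natB ?scale1r ?subrr // subr_eq0 !natrD.
  rewrite (inj_eq (addIr _)); apply: contra hl => /eqP h.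
  by apply/eqP/val_inj/(natF_inj) => //; apply: ltn_ord.
by rewrite scalemx_sub // addmx_sub // eqmx_opp.
Qed.

(** The dimensions [m] for which [1, x, ..., x^(m-1)] span a submodule of the densities of weight
    [c]. *)
Definition dens_level c m :=
  [|| m == 0%N, m == p, (m == 1%N) && (c%:R == 0 :> F) | (m == p') && (c%:R == 1 :> F)].

(** A submodule is spanned by monomials, and [d] lowers exponents, so it consists of all [x^k] with
    [k < m]. As [x^m] is missing, any [x^i d] that moves some [x^k] with [k < m] to [x^m] must do so
    with coefficient [k + i c = 0]. *)
Lemma stable_dens c (X : 'M[F]_p) : @stable F p (dens c) X ->
  exists2 m, dens_level c m & (X == (pid_mx m : 'M[F]_p))%MS.
Proof.
move=> stX; pose S (k : nat) := (b k <= X)%MS.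
have Sdown k : (k.+1 < p)%N -> S k.+1 -> S k.
  move=> hk /(@stable_mul (dens c) _ _ ord0 stX).
  rewrite densA_Xn //= mul0n !addn0 => h.
  have k0 : k.+1%:R != 0 :> F by rewrite (natF_eq0); apply/negP=> /dvdn_leq; lia.
  by move: h; rewrite (eqmx_scale _ k0).
pose m := find (fun k => ~~ S k) (iota 0 p).
have m_le : (m <= p)%N by rewrite -[X in (_ <= X)%N](size_iota 0 p); apply: find_size.
have Slt k : (k < m)%N -> S k.
  move=> hk; have := before_find 0%N hk; rewrite nth_iota ?add0n; last lia.
  by move/negbT; rewrite negbK.
have Sm : (m < p)%N -> ~~ S m.
  move=> hm; have := @nth_find _ 0%N (fun k => ~~ S k) (iota 0 p).
  by rewrite has_find size_iota -/m nth_iota // add0n => ->.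
have Sge k : (m <= k)%N -> (k < p)%N -> ~~ S k.
  elim: k => [|k IHk] hk kp; first by have -> : 0%N = m by [lia|]; apply: Sm; lia.
  case: (leqP m k) => h; last by have -> : k.+1 = m by [lia|]; apply: Sm; lia.
  by apply/negP=> /(Sdown _ kp) hS; have := IHk h (ltnW kp); rewrite hS.
have Sup k (i : 'I_p) : (k < m)%N -> (m < p)%N -> (k + i)%N = m.+1 -> (k + i * c)%:R = 0 :> F.
  move=> km mp ki; apply/eqP/negPn/negP=> h0.
  have := @stable_mul (dens c) _ _ i stX (Slt _ km).
  rewrite densA_Xn // ki (eqmx_scale _ h0) => h; have := Sm mp; by rewrite /S h.
exists m; last first.
  apply/andP; split; last by apply/pid_subP=> k /Slt.
  apply/row_subP=> k; rewrite [row k X]rV_sum_Xn; apply: summx_sub => l _.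
  have [->|h] := eqVneq (row k X 0 l) 0; first by rewrite scale0r sub0mx.
  apply: scalemx_sub; rewrite Xn_sub_pid ltnNge; apply/negP=> hl.
  have := Sge _ hl (ltn_ord l); by rewrite /S (weight_component stX (row_sub k X) h).
rewrite /dens_level; case: eqVneq => //= m0; case: eqVneq => //= mp.
have lt_mp : (m < p)%N by lia.
(* The conditions from [x^2 d] and [x^3 d] suffice. The latter operator exists only for [p > 3], so
   the extreme values [m = 1] and [m = p - 1] are settled by [x^2 d] alone. *)
have E2 : (m.-1 + 2 * c)%:R = 0 :> F.
  by rewrite -(Sup m.-1 (inord 2)) ?inordK //; lia.
have two0 : 2%:R != 0 :> F by rewrite (natF_eq0); apply/negP=> /dvdn_leq; lia.
case: (eqVneq m 1%N) => m1 /=.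
  by move: E2; rewrite m1 add0n natrM => /eqP; rewrite mulf_eq0 (negPf two0) /= => ->.
case: (eqVneq m p') => mp' /=.
  apply/eqP/(mulfI two0); rewrite mulr1 -natrM.
  have : (m.-1 + 2 * c + 2)%:R = 2%:R :> F by rewrite natrD E2 add0r.
  have -> : (m.-1 + 2 * c + 2 = p + 2 * c)%N by lia.
  by rewrite natrD natp0 add0r.
have E3 : (m.-2 + 3 * c)%:R = 0 :> F.
  by rewrite -(Sup m.-2 (inord 3)) ?inordK //; lia.
(* The difference of the two conditions gives [c = 1]; the first one then gives [m + 1 = 0], which
   is excluded here. *)
have c1 : c%:R = 1 :> F.
  have : (m.-2 + 3 * c + 1)%:R = (m.-1 + 2 * c + c)%:R :> F by congr (_%:R); lia.
  by rewrite natrD [in RHS]natrD E2 E3 !add0r.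
have : m.+1%:R = 0 :> F.
  have -> : m.+1 = (m.-1 + 2)%N by lia.
  by rewrite -E2 natrD [in RHS]natrD natrM c1 mulr1.
move/eqP; rewrite (natF_eq0) => /dvdn_leq; lia.
Qed.

Lemma pid_ltmx m1 m2 : (m1 < m2 <= p)%N -> ((pid_mx m1 : 'M[F]_p) < (pid_mx m2 : 'M[F]_p))%MS.
Proof.
case/andP=> h12 h2; rewrite ltmxE; apply/andP; split.
  by apply/pid_subP=> k hk; rewrite Xn_sub_pid; lia.
apply/negP=> /pid_subP; have h1 : (m1 < p)%N by lia.
by move/(_ (Ordinal h1) h12); rewrite Xn_sub_pid ltnn.
Qed.

Lemma dens_level_le c m : dens_level c m -> (m <= p)%N.
Proof. by case/or4P=> [/eqP ->|/eqP ->|/andP[/eqP -> _]|/andP[/eqP -> _]]; lia. Qed.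

Lemma simple_between c m1 m2 (X : 'M[F]_p) :
  (forall m, (m1 < m < m2)%N -> ~~ dens_level c m) -> (m1 <= m2 <= p)%N ->
  ((pid_mx m1 : 'M[F]_p) <= X)%MS -> (X <= (pid_mx m2 : 'M[F]_p))%MS -> @stable F p (dens c) X ->
  (X == (pid_mx m1 : 'M[F]_p))%MS \/ (X == (pid_mx m2 : 'M[F]_p))%MS.
Proof.
move=> hm /andP[hm12 hm2] h1 h2 /stable_dens[m lm Xm].
have mp := dens_level_le lm.
have hm1 : (m1 <= m)%N.
  rewrite leqNgt; apply/negP=> h; move: h1; rewrite (eqmxP Xm) => h1.
  have /pid_ltmx : (m < m1 <= p)%N by lia.
  by rewrite ltmxE h1 andbF.
have hm2' : (m <= m2)%N.
  rewrite leqNgt; apply/negP=> h; move: h2; rewrite (eqmxP Xm) => h2.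
  have /pid_ltmx : (m2 < m <= p)%N by lia.
  by rewrite ltmxE h2 andbF.
have [e|ne1] := eqVneq m m1; first by left; rewrite -e.
have [e|ne2] := eqVneq m m2; first by right; rewrite -e.
by have := hm m; rewrite lm => /(_ ltac:(lia)).
Qed.

Lemma stable_pid c m : dens_level c m -> @stable F p (dens c) (pid_mx m).
Proof.
move=> lm i; apply/row_subP=> k; rewrite row_mul.
rewrite row_pid_mx; case: ifP => hk; last by rewrite mul0mx sub0mx.
rewrite -poly_rV_delta.
rewrite densA_Xn //=.
case/or4P: lm hk => [/eqP ->|/eqP ->|/andP[/eqP -> /eqP c0]|/andP[/eqP -> /eqP c1]] hk //.
- by rewrite pid_mx_1 submx1.
- have -> : k = 0%N :> nat by lia.
  by rewrite add0n natrM c0 mulr0 scale0r sub0mx.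
case: (ltnP (k + i).-1 p) => hl; last by rewrite poly_rVXn_ge // scaler0 sub0mx.
have [e|ne] := eqVneq ((k + i).-1) p'.
  rewrite natrD natrM c1 mulr1 -natrD.
  have -> : (k + i = p)%N by lia.
  by rewrite natp0 scale0r sub0mx.
by apply: scalemx_sub; rewrite (Xn_sub_pid (Ordinal hl)) ltn_neqAle ne -ltnS.
Qed.

(** * Simple quotients and composition factors of the density modules *)

Definition trivW : Wmod F p := MkWmod (fun _ : 'I_p => 0 : 'M[F]_1) 1%:M.

(* The exact forms inside [dens 1]. *)
Definition exactW : Wmod F p := MkWmod (densA 1) (pid_mx p' : 'M[F]_p).

Lemma simple_dens c m : dens_level c m -> (0 < m)%N ->
  (forall m', (0 < m' < m)%N -> ~~ dens_level c m') ->
  is_simple (MkWmod (densA c) (pid_mx m : 'M[F]_p)).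
Proof.
move=> lm m0 hm; have mp := dens_level_le lm; split.
- split; first exact: (stable_pid lm).
  by move=> w1 w2; have [_ h] := dens_module c; apply: (sub_mul0mx (submx1 _) (h w1 w2)).
- by rewrite -mxrank_eq0 rank_pid_mx //= -lt0n.
- move=> X hX stX; have /= := @simple_between c 0 m X.
  rewrite pid_mx_0 sub0mx => /(_ hm mp isT hX stX)[] h; [left|by right].
  by apply/eqP; rewrite -submx0; case/andP: h.
Qed.

(** [densA 0 ord0] is the matrix of [d/dx], read as the exterior derivative from functions to
    1-forms. Functions appear with weight [p] instead of 0 because this is the index of [V(p-1)];
    only the residue of the weight matters. *)
Lemma exactW_map (i : 'I_p) :
  densA p i *m densA 0 ord0 = densA 0 ord0 *m densA 1 i :> 'M[F]_p.
Proof.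
apply/row_matrixP=> k; rewrite !rowE -poly_rV_delta !mulmxA !densA_Xn // -!scalemxAl.
rewrite !densA_Xn // !scalerA !mul0n !muln1 !addn0 natrD natrM natp0 mulr0 addr0.
by case: (nat_of_ord k) => [|l]; rewrite ?mul0r ?scale0r //= addn0 addSn.
Qed.

Lemma exactW_img : (densA 0 ord0 == (pid_mx p' : 'M[F]_p))%MS.
Proof.
apply/andP; split.
  apply/row_subP=> k; rewrite rowE -poly_rV_delta densA_Xn //= mul0n !addn0.
  have [->|k0] := posnP k; first by rewrite scale0r sub0mx.
  have hk : (k.-1 < p)%N by have := ltn_ord k; lia.
  by rewrite scalemx_sub // (Xn_sub_pid (Ordinal hk)) /=; have := ltn_ord k; lia.
apply/pid_subP=> k hk; have hk1 : (k.+1 < p)%N by lia.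
have := submxMl (b k.+1) (densA 0 ord0); rewrite densA_Xn //= mul0n !addn0.
rewrite (eqmx_scale _ _) // (natF_eq0); apply/negP=> /dvdn_leq; lia.
Qed.

Lemma natF_neq0 n : (0 < n < p)%N -> n%:R != 0 :> F.
Proof. by move=> h; rewrite (natF_eq0); apply/negP=> /dvdn_leq; lia. Qed.

Lemma dens_level_mid lam m : (0 < lam < p')%N -> (0 < m < p)%N ->
  ~~ dens_level lam.+1 m.
Proof.
move=> hl hm; rewrite /dens_level !negb_or !negb_and; apply/and4P; split; try lia.
  by rewrite (@natF_neq0 lam.+1) ?orbT //; lia.
by rewrite -subr_eq0 -(natrB _ (ltn0Sn lam)) subn1 (@natF_neq0 lam) ?orbT //; lia.
Qed.

Lemma dens_level1 m : (0 < m < p')%N -> ~~ dens_level 1 m.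
Proof.
move=> hm; rewrite /dens_level oner_eq0 !negb_or !negb_and; apply/and4P.
by split; rewrite ?orbT //; lia.
Qed.

Lemma dens_levelp m : (1 < m < p)%N -> ~~ dens_level p m.
Proof.
move=> hm; rewrite /dens_level natp0 [0 == 1]eq_sym oner_eq0 !negb_or !negb_and; apply/and4P.
by split; rewrite ?orbT //; lia.
Qed.

Lemma L_dens lam : (0 < lam < p')%N -> is_L lam (dens lam.+1).
Proof.
move=> hl; have := @simple_dens lam.+1 p; rewrite pid_mx_1 => simp; split.
  apply: simp => //; first by rewrite /dens_level eqxx orbT.
  by move=> m' hm; apply: dens_level_mid.
exists (dens lam.+1); split; first exact: dens_V.
exists 1%:M; rewrite mul1mx; split; last exact/eqmxP.
by split=> [|i]; rewrite mul1mx ?mul1mx ?mulmx1 ?subrr.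
Qed.

(** The exterior derivative presents the exact forms as the quotient of [V(p-1)] by the
    constants. *)
Lemma L_exactW : is_L p' exactW.
Proof.
split.
  apply: simple_dens; [by rewrite /dens_level eqxx eqxx !orbT | lia | exact: dens_level1].
exists (dens p); split; first exact: dens_V.
exists (densA 0 ord0); rewrite mul1mx; split; last exact: exactW_img.
by split=> [|i]; rewrite mul1mx ?exactW_map ?subrr //; case/andP: exactW_img.
Qed.

Lemma Xn_coef (k : 'I_p) n : b n *m delta_mx k 0 = (k == n :> nat)%:R%:M :> 'M[F]_1.
Proof. by rewrite -colE; apply/matrixP=> i j; rewrite !ord1 !mxE coefXn eqxx mulr1n. Qed.

(** Lie derivatives of 1-forms are exact, and exact forms have no [x^(p-1)] term. This coefficient
    is the map from [V(0)] onto the trivial module. *)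
Lemma densA1_top (i : 'I_p) : densA 1 i *m delta_mx ord_max 0 = 0 :> 'M[F]_(p, 1).
Proof.
apply/row_matrixP=> k; rewrite rowE -poly_rV_delta mulmxA densA_Xn // -scalemxAl Xn_coef.
rewrite row0 muln1; case: eqP => [e|_]; last by rewrite raddf0 scaler0.
have -> : (k + i = p)%N by move: e; rewrite /=; lia.
by rewrite natp0 scale0r.
Qed.

Lemma one_rank (x : 'M[F]_(p, 1)) : x != 0 -> (x == (1%:M : 'M[F]_1))%MS.
Proof.
move=> x0; rewrite submx1 sub1mx /row_full eqn_leq rank_leq_col lt0n mxrank_eq0; exact: x0.
Qed.

Lemma L_trivW : is_L 0 trivW.
Proof.
split.
  split.
  - by split=> [i|w1 w2]; rewrite ?mulmx0 ?sub0mx // /rho !big1 ?mulmx0 ?subrr ?mulmx0 // => i _; rewrite scaler0.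
  - by rewrite -mxrank_eq0 mxrank1.
  - move=> X _ _; have [->|X0] := eqVneq X 0; [by left|right].
    by rewrite submx1 sub1mx /row_full eqn_leq rank_leq_col lt0n mxrank_eq0.
exists (dens 1); split; first exact: dens_V.
exists (delta_mx ord_max 0); rewrite mul1mx; split.
  by split=> [|i]; rewrite ?submx1 // mul1mx densA1_top mulmx0 subrr.
apply: one_rank; apply/negP=> /eqP/matrixP/(_ ord_max 0); rewrite !mxE !eqxx => /eqP.
by rewrite oner_eq0.
Qed.

Lemma simple_factor_dens c m1 m2 lam :
  dens_level c m1 -> dens_level c m2 -> (m1 < m2)%N ->
  (forall m, (m1 < m < m2)%N -> ~~ dens_level c m) ->
  @quot_iso F p (MkWmod (densA c) (pid_mx m2 : 'M[F]_p)) (pid_mx m1) (is_L lam) ->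
  simple_factor (densA c) (pid_mx m1) (pid_mx m2) lam.
Proof.
move=> l1 l2 m12 hm q; have m2p := dens_level_le l2; split=> //.
  split; [exact: (stable_pid l1) | exact: (stable_pid l2) |].
  by apply: pid_ltmx => //; rewrite m12.
by move=> X h1 h2 stX; apply: simple_between stX; rewrite ?(ltnW m12).
Qed.

Let level0 c : dens_level c 0. Proof. by rewrite /dens_level eqxx. Qed.
Let levelp c : dens_level c p. Proof. by rewrite /dens_level eqxx orbT. Qed.
Let level11 : dens_level 1 p'. Proof. by rewrite /dens_level !eqxx !orbT. Qed.
Let levelp1 : dens_level p 1. Proof. by rewrite /dens_level natp0 !eqxx !orbT. Qed.

Lemma factor_mid lam : (0 < lam < p')%N ->
  simple_factor (densA lam.+1) (pid_mx 0) (pid_mx p : 'M[F]_p) lam.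
Proof.
move=> hl; apply: simple_factor_dens => // [m hm|]; first exact: dens_level_mid.
exists (dens lam.+1), 1%:M; rewrite pid_mx_1 pid_mx_0 !mul1mx mul0mx mxrank0 addn0.
split=> //; [exact: L_dens | | exact/eqmxP].
by split=> [|i]; rewrite !mul1mx ?mulmx1 ?subrr.
Qed.

Lemma factor_exact : simple_factor (densA 1) (pid_mx 0) (pid_mx p' : 'M[F]_p) p'.
Proof.
apply: (simple_factor_dens (level0 _) level11 _ dens_level1); first lia.
exists exactW, 1%:M; rewrite pid_mx_0 mulmx1 mul0mx mxrank0 addn0; split=> //.
- exact: L_exactW.
- by split=> [|i]; rewrite mulmx1 ?mul1mx ?subrr ?mulmx0.
- exact/eqmxP.
Qed.

Lemma pid_mul_delta m (k : 'I_p) :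
  (pid_mx m : 'M[F]_p) *m delta_mx k 0 = (k < m)%:R *: delta_mx k 0 :> 'M[F]_(p, 1).
Proof.
rewrite -colE; apply/matrixP=> i j; rewrite !ord1 !mxE eqxx andbT.
by case: (eqVneq i k) => [->|ne] /=; rewrite ?eqxx ?mulr1 // val_eqE (negPf ne) mulr0.
Qed.

Lemma delta_one (k : 'I_p) : ((delta_mx k 0 : 'M[F]_(p, 1)) == (1%:M : 'M[F]_1))%MS.
Proof.
apply: one_rank; apply/negP=> /eqP/matrixP/(_ k 0); rewrite !mxE !eqxx => /eqP.
by rewrite oner_eq0.
Qed.

Lemma factor_exact_quo : simple_factor (densA 1) (pid_mx p') (pid_mx p : 'M[F]_p) 0.
Proof.
apply: simple_factor_dens => //; first by move=> m hm; lia.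
exists trivW, (delta_mx ord_max 0); rewrite !pid_mul_delta ltnn ltnSn scale0r scale1r.
split=> //; first exact: L_trivW.
- split=> [|i]; first by rewrite submx1.
  by rewrite pid_mx_1 mul1mx densA1_top mulmx0 subrr.
- exact: delta_one.
- by rewrite mxrank_delta !rank_pid_mx.
Qed.

Lemma factor_const : simple_factor (densA p) (pid_mx 0) (pid_mx 1 : 'M[F]_p) 0.
Proof.
apply: simple_factor_dens => //; first by move=> m hm; lia.
exists trivW, (delta_mx ord0 0); rewrite !pid_mul_delta ltnn ltnSn scale0r scale1r.
split=> //; first exact: L_trivW.
- split=> [|i]; first by rewrite submx1.
  rewrite mulmx0 subr0 mulmxA; apply/row_matrixP=> k; rewrite row_mul row0 row_mul.
  rewrite row_pid_mx; case: ifP => hk; last by rewrite !mul0mx.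
  rewrite -poly_rV_delta; have -> : k = 0%N :> nat by lia.
  by rewrite densA_Xn // natrM natp0 mulr0 scale0r mul0mx.
- exact: delta_one.
- by rewrite mxrank_delta !rank_pid_mx.
Qed.

Lemma factor_const_quo : simple_factor (densA p) (pid_mx 1) (pid_mx p : 'M[F]_p) p'.
Proof.
apply: (simple_factor_dens levelp1 (levelp _) _ dens_levelp); first lia.
have rk : \rank (densA 0 ord0 : 'M[F]_p) = p'.
  by rewrite (eqmxP exactW_img) rank_pid_mx.
exists exactW, (densA 0 ord0); rewrite pid_mx_1 mul1mx; split.
- exact: L_exactW.
- by split=> [|i]; rewrite mul1mx ?exactW_map ?subrr //; case/andP: exactW_img.
- exact: exactW_img.
- apply/row_matrixP=> k; rewrite row_mul row0.
  rewrite row_pid_mx; case: ifP => hk; last by rewrite !mul0mx.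
  rewrite -poly_rV_delta; have -> : k = 0%N :> nat by lia.
  by rewrite densA_Xn // mul0n scale0r.
- by rewrite rk rank_pid_mx // mxrank1 addn1.
Qed.

(** * Highest weights and the distinction of the simple modules *)

Lemma hom_act (M M' : Wmod F p) f (x : 'rV_(mN M)) i :
  @is_hom F p M M' f -> (x <= mU M)%MS -> x *m mA M i *m f = x *m f *m mA M' i.
Proof. by case=> _ h xM; rewrite -!mulmxA; apply: mulmx_eq xM (h i). Qed.

Lemma hom_rho (M M' : Wmod F p) f (x : 'rV_(mN M)) w :
  @is_hom F p M M' f -> (x <= mU M)%MS -> x *m rho M w *m f = x *m f *m rho M' w.
Proof.
move=> fh xM; rewrite /rho !mulmx_sumr mulmx_suml; apply: eq_bigr => i _.
by rewrite -!scalemxAr -scalemxAl (hom_act _ fh).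
Qed.

Lemma hom_actX (M M' : Wmod F p) f (x : 'rV_(mN M)) i n : is_module M ->
  @is_hom F p M M' f -> (x <= mU M)%MS -> x *m mA M i ^+ n *m f = x *m f *m mA M' i ^+ n.
Proof.
move=> [st _] fh xM; elim: n => [|n IHn]; first by rewrite !expr0 !mulmx1.
by rewrite !exprSr !mulmxA (hom_act _ fh) ?IHn // stable_mulX.
Qed.

(** [is_L] speaks of a simple image of some [V(lam)]; its restrictedness, which the universal
    property asks for, is inherited from [V(lam)]. *)
Lemma restricted_hom_img (M M' : Wmod F p) f :
  @is_hom F p M M' f -> (mU M *m f == mU M')%MS -> is_module M ->
  is_restricted M -> is_restricted M'.
Proof.
move=> fh /andP[_ fs] [st _] res w; apply: (sub_mul0mx fs).
apply/row_matrixP=> k; rewrite row0 -mulmxA row_mul; set x := row k _.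
have xM : (x <= mU M)%MS by apply: row_sub.
have xX n : (x *m rho M w ^+ n <= mU M)%MS.
  elim: n => [|n IHn]; first by rewrite expr0 mulmx1.
  rewrite exprSr mulmxA /rho mulmx_sumr; apply: summx_sub => i _.
  by rewrite -scalemxAr scalemx_sub // stable_mul.
have fX n : x *m rho M w ^+ n *m f = x *m f *m rho M' w ^+ n.
  elim: n => [|n IHn]; first by rewrite !expr0 !mulmx1.
  by rewrite !exprSr !mulmxA (hom_rho _ fh) ?IHn.
by rewrite mulmxA mulmxBr -fX -(hom_rho _ fh xM) -mulmxBl -mulmxBr (sub_mul0mx xM (res w)) mul0mx.
Qed.

(** Were the image of the generator zero, the surjection and the zero map would agree by uniqueness
    in the universal property. *)
Lemma L_hw lam (M : Wmod F p) : is_L lam M ->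
  is_restricted M /\ exists2 w : 'rV_(mN M), (w <= mU M)%MS /\ w != 0 & hw_vec lam w.
Proof.
case=> -[Mmod M0 _] [MV [[Vmod Vres [v [vU vhw] univ]] [f [fh fs]]]].
have Mres := restricted_hom_img fh fs Vmod Vres; split=> //.
have whw : hw_vec lam (v *m f).
  by move=> i; have [h1 h2] := vhw i; split=> hi;
    rewrite -(hom_act _ fh) //; [rewrite h1 // scalemxAl | rewrite h2 // mul0mx].
have wU : (v *m f <= mU M)%MS by apply: submx_trans fh.1; apply: submxMr.
exists (v *m f) => //; split=> //; apply/negP=> /eqP w0.
have [f0 [_ _ uniq]] := univ M Mmod Mres _ wU whw.
have h0 : @is_hom F p MV M 0 by split=> [|i]; rewrite ?mulmx0 ?sub0mx // mul0mx subrr mulmx0.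
have : mU MV *m f = mU MV *m 0 by rewrite (uniq f) // (uniq 0) // mulmx0 w0.
rewrite mulmx0 => e; case/negP: M0; case/andP: fs => _.
by rewrite e => /submx0null ->.
Qed.

(** The module is a quotient of a density module, whose weight spaces are lines spanned by
    monomials, and each monomial is a multiple of an iterate of [d/dx] on [x^(p-1)]. Each
    application of [d/dx] lowers the weight by 1. *)
Lemma hw_line lam d (M : Wmod F p) (w w2 : 'rV_(mN M)) :
  is_simple M -> is_restricted M -> (w <= mU M)%MS -> w != 0 -> hw_vec lam w ->
  (w2 <= mU M)%MS -> w2 != 0 -> w2 *m mA M i1 = d%:R *: w2 ->
  exists j C, [/\ (j < p)%N, w2 = C *: (w *m mA M ord0 ^+ j) & lam%:R = (d + j)%:R :> F].
Proof.
move=> [Mmod M0 simp] res wU w0 whw w2U w20 w2d.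
have [g [gh gw _]] := dens_univ Mmod res wU whw.
have gU : (g <= mU M)%MS by have := gh.1; rewrite mul1mx.
have dmod := dens_module lam.+1.
have gact (x : 'rV_p) i : x *m densA lam.+1 i *m g = x *m g *m mA M i.
  exact: (hom_act _ gh (submx1 x)).
have gM : (mU M <= g)%MS.
  have /= := simp <<g>>%MS; rewrite genmxE gU => /(_ isT)[].
  - move=> i; rewrite genmxE (eqmxMr _ (genmxE g)); apply/row_subP=> k.
    by rewrite row_mul rowE -gact submxMl.
  - move=> e; case/negP: w0; rewrite -gw -submx0 -e genmxE submxMl //.
  - by case/andP=> _; rewrite genmxE.
have [y yE] := submxP (submx_trans w2U gM).
pose P := densA lam.+1 i1 - d%:R%:M.
have Pg n : y *m P ^+ n *m g = w2 *m (mA M i1 - d%:R%:M) ^+ n.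
  elim: n => [|n IHn]; first by rewrite !expr0 !mulmx1.
  rewrite !exprSr !mulmxA mulmxBr mulmxBl gact IHn mulmxBr; congr (_ - _).
  by rewrite !mul_mx_scalar -scalemxAl IHn.
have Pw2 : w2 *m (mA M i1 - d%:R%:M) ^+ p' = 0.
  have powS n : (0 < n)%N -> w2 *m (mA M i1 - d%:R%:M) ^+ n = 0.
    by case: n => // n _; rewrite exprS mulmxA mulmxBr w2d mul_mx_scalar subrr mul0mx.
  exact: powS.
(* A preimage [y] of [w2] may be replaced by its component of weight [d], because [P^(p-1)] maps it
   to 0 in the quotient. *)
have w2E : w2 = (y - y *m P ^+ p') *m g by rewrite mulmxBl Pg Pw2 subr0.
have yP : y - y *m P ^+ p' = \sum_(l < p | (l + lam.+1)%:R == d%:R :> F) y 0 l *: b l.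
  rewrite {1 2}[y]rV_sum_Xn mulmx_suml -sumrB [RHS]big_mkcond; apply: eq_bigr => l _.
  rewrite -scalemxAl Xn_weight //; case: eqVneq => [->|ne].
    by rewrite subrr expr0n gtn_eqF ?scale0r ?scaler0 ?subr0 //; lia.
  by rewrite fermat_natB ?subr_eq0 // scale1r subrr.
case: (pickP (fun l : 'I_p => (l + lam.+1)%:R == d%:R :> F)) => [l0 hl0|none]; last first.
  by move: w20; rewrite w2E yP big_pred0 // mul0mx eqxx.
have {}yP : y - y *m P ^+ p' = y 0 l0 *: b l0.
  rewrite yP (bigD1 l0) //= big1 ?addr0 // => l /andP[hl ne].
  case/negP: ne; rewrite -(eqP hl0) !natrD (inj_eq (addIr _)) in hl.
  by apply/eqP/val_inj/(natF_inj (ltn_ord _) (ltn_ord _))/eqP.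
have l0p := ltn_ord l0.
have [a a0] := densA0_falling lam.+1 (leq_subr l0 p').
rewrite subKn -1?ltnS // => ba; exists (p' - l0)%N, (y 0 l0 * a^-1); split; first by rewrite ltnS leq_subr.
  rewrite w2E yP -gw -(hom_actX _ _ dmod gh (submx1 _)) ba -!scalemxAl scalerA mulfVK //.
apply: (addIr (l0.+1)%:R); rewrite -!natrD.
have -> : (d + (p' - l0) + l0.+1 = d + p)%N by move: l0p; clear; lia.
by rewrite [in RHS]natrD natp0 addr0 -(eqP hl0) -addSnnS addnC.
Qed.

(** Generators of weights [a] and [d] are placed in the same simple module, and each is a multiple
    of an iterate of [d/dx] on the other. The two lengths add up to 0 modulo [p]: either the weights
    agree, or the sum is [p] and a nonzero vector is a multiple of its image under
    [(d/dx)^p = 0]. *)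
Lemma quot_iso_L_inj (M : Wmod F p) (lo : 'M_(mN M)) a d :
  (a < p)%N -> (d < p)%N -> (lo <= mU M)%MS -> stable (mU M) ->
  quot_iso lo (is_L a) -> quot_iso lo (is_L d) -> a = d.
Proof.
move=> ap dp loU stU [M1 [f1 [L1 h1 s1 k1 r1]]] [M2 [f2 [L2 h2 s2 k2 r2]]].
have [res1 [w1 [w1U w10] w1hw]] := L_hw L1.
have [_ [w2 [w2U w20] w2hw]] := L_hw L2.
have /submxP[y yE] : (w2 <= mU M *m f2)%MS by case/andP: s2 => _; apply: submx_trans.
pose x := y *m mU M; have xU : (x <= mU M)%MS by apply: submxMl.
have {yE} w2E : w2 = x *m f2 by rewrite yE mulmxA.
have f12 (z : 'rV_(mN M)) : (z <= mU M)%MS -> z *m f2 = 0 -> z *m f1 = 0.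
  move=> zU z2; have /submxP[u ->] := quot_ker loU k2 r2 zU z2.
  by rewrite -mulmxA k1 mulmx0.
have f21 (z : 'rV_(mN M)) : (z <= mU M)%MS -> z *m f1 = 0 -> z *m f2 = 0.
  move=> zU z2; have /submxP[u ->] := quot_ker loU k1 r1 zU z2.
  by rewrite -mulmxA k2 mulmx0.
pose w := x *m f1.
have wU : (w <= mU M1)%MS by apply: submx_trans h1.1; apply: submxMr.
have w0 : w != 0 by apply: contra w20 => /eqP h; rewrite w2E (f21 x xU h).
have whw : hw_vec d w.
  move=> i; have xiU : (x *m mA M i <= mU M)%MS by apply: stable_mul.
  have [e1 e2] := w2hw i; split=> hi; rewrite -(hom_act _ h1) //.
    apply/eqP; rewrite /w scalemxAl -subr_eq0 -mulmxBl; apply/eqP; apply: f12.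
      by rewrite addmx_sub // eqmx_opp scalemx_sub.
    by rewrite mulmxBl (hom_act _ h2) // -w2E e1 // -scalemxAl -w2E subrr.
  by apply: f12 => //; rewrite (hom_act _ h2) // -w2E e2.
have [j [C [jp wE aj]]] := hw_line L1.1 res1 w1U w10 w1hw wU w0 ((whw i1).1 i1E).
have [k [B [kp w1E dk]]] := hw_line L1.1 res1 wU w0 whw w1U w10 ((w1hw i1).1 i1E).
have jk : (j + k)%:R = 0 :> F.
  by apply: (addrI d%:R); rewrite addr0 -natrD addnA natrD -aj -natrD -dk.
move/eqP: jk; rewrite natF_eq0 => /(dvdn_add_small jp kp)[j0|qE].
  by apply: natF_inj => //; rewrite aj j0 addn0.
case/negP: w10; apply/eqP.
by rewrite w1E wE -scalemxAl -mulmxA mulmxE -exprD qE restricted_pow0 // !scaler0.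
Qed.

End WittModules.

(** * Composition chains *)

Lemma adds_mul0mx (F : fieldType) m1 m2 n k (X : 'M[F]_(m1, n)) (Y : 'M[F]_(m2, n))
    (Z : 'M[F]_(n, k)) : X *m Z = 0 -> Y *m Z = 0 -> (X + Y)%MS *m Z = 0.
Proof.
by move=> hX hY; apply/eqP; rewrite -submx0 addsmxMr hX hY addsmx_sub !sub0mx.
Qed.

Section Chains.
Variables (F : fieldType) (p : nat).

(** * Transport of composition steps along an embedded block *)

Section Transport.
Variables (N q : nat) (A : 'I_p -> 'M[F]_N) (E : 'I_p -> 'M[F]_q).
Variables (B : 'M[F]_(q, N)) (Q : 'M[F]_(N, q)) (X : 'M[F]_N).
Hypothesis BQ : B *m Q = 1%:M.
Hypothesis BA : forall i, B *m A i = E i *m B.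
Hypothesis stX : forall i, (X *m A i <= X)%MS.
Hypothesis XQ : X *m Q = 0.

Let freeB : row_free B.
Proof. by apply/row_freeP; exists Q. Qed.

(** [Q] kills [X] and retracts [B], so it recovers [Y] from its lift; lifting therefore preserves
    and reflects inclusions. *)
Lemma lift_mulQ (Y : 'M[F]_q) : ((X + Y *m B)%MS *m Q :=: Y)%MS.
Proof.
apply: eqmx_trans (addsmxMr _ _ _) _; rewrite XQ -mulmxA BQ mulmx1; exact: adds0mx.
Qed.

Lemma lift_sub (Y1 Y2 : 'M[F]_q) :
  (X + Y1 *m B <= X + Y2 *m B)%MS = (Y1 <= Y2)%MS.
Proof.
apply/idP/idP=> h; last by rewrite addsmxS // submxMr.
by have := submxMr Q h; rewrite !lift_mulQ.
Qed.

Lemma rank_lift (Y : 'M[F]_q) : \rank (X + Y *m B)%MS = (\rank X + \rank Y)%N.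
Proof.
rewrite mxrank_disjoint_sum ?mxrankMfree //; apply/eqP; rewrite -submx0; apply/rV_subP=> v.
rewrite sub_capmx => /andP[/submxP[x xE] /submxP[y yE]].
have : v *m Q = 0 by rewrite xE -mulmxA XQ mulmx0.
by rewrite {1}yE -!mulmxA BQ mulmx1 => y0; rewrite yE mulmxA y0 mul0mx submx0.
Qed.

Lemma lift_stable (Y : 'M[F]_q) : (forall i, (Y *m E i <= Y)%MS) ->
  forall i, ((X + Y *m B)%MS *m A i <= X + Y *m B)%MS.
Proof.
move=> stY i; rewrite addsmxMr addsmxS // -mulmxA BA mulmxA; exact: submxMr.
Qed.

(** [Q] is only a linear map, yet on [X + hi *m B] it commutes with the action, [B] being
    equivariant and [X] stable. Hence [Q] followed by [f] identifies the lifted quotient. *)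
Lemma lift_simple_factor lo hi lam : simple_factor E lo hi lam ->
  simple_factor A (X + lo *m B)%MS (X + hi *m B)%MS lam.
Proof.
case=> -[stlo sthi lohi] simp [M' [f [LM' fh fs flo frk]]]; split.
- split; [exact: lift_stable | exact: lift_stable |].
  by move: lohi; rewrite !ltmxE !lift_sub.
- move=> Z loZ Zhi stZ.
  have AQ i : (X + hi *m B)%MS *m (A i *m Q - Q *m E i) = 0.
    apply: adds_mul0mx; rewrite mulmxBr !mulmxA.
      by rewrite XQ mul0mx subr0 (sub_mul0mx (stX i) XQ).
    by rewrite -[hi *m B *m Q]mulmxA BQ mulmx1 -[hi *m B *m A i]mulmxA BA -!mulmxA BQ mulmx1 subrr.
  have hlo : (lo <= <<Z *m Q>>)%MS by have := submxMr Q loZ; rewrite lift_mulQ genmxE.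
  have hhi : (<<Z *m Q>> <= hi)%MS by have := submxMr Q Zhi; rewrite lift_mulQ genmxE.
  have XZ : (X <= Z)%MS by apply: submx_trans loZ; apply: addsmxSl.
  (* A subspace between the two lifts contains [X], so it is the lift of its own image under [Q]. *)
  have ZE : (Z :=: X + <<Z *m Q>>%MS *m B)%MS.
    apply/eqmxP; rewrite addsmx_sub XZ /=; apply/andP; split; last first.
      rewrite (eqmxMr _ (genmxE _)); apply/rV_subP=> v /submxP[y ->].
      have /sub_addsmxP[u uE] : (y *m Z <= X + hi *m B)%MS by apply: submx_trans Zhi; apply: submxMl.
      rewrite !mulmxA uE !mulmxDl -[u.1 *m X *m Q]mulmxA XQ mulmx0 mul0mx add0r.
      rewrite !mulmxA -[_ *m B *m Q]mulmxA BQ mulmx1.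
      have -> : u.2 *m hi *m B = y *m Z - u.1 *m X by rewrite uE addrC mulmxA addKr.
      by rewrite addmx_sub ?submxMl // eqmx_opp (submx_trans _ XZ) ?submxMl.
    apply/rV_subP=> v vZ.
    have /sub_addsmxP[u uE] := submx_trans vZ Zhi.
    rewrite (eqmx_trans (adds_eqmx (eqmx_refl X) (eqmxMr B (genmxE (Z *m Q)))) (eqmx_refl _)).
    have vQ : v *m Q = u.2 *m hi.
      by rewrite uE mulmxDl -mulmxA XQ mulmx0 add0r !mulmxA -[_ *m B *m Q]mulmxA BQ mulmx1.
    rewrite uE mulmxA -vQ addmx_sub_adds ?submxMl //.
    by rewrite !submxMr.
  case: (simp _ hlo hhi) => [i|hZ|hZ].
  + rewrite !genmxE (eqmxMr _ (genmxE _)) -mulmxA.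
    rewrite -(mulmx_eq Zhi (AQ i)) mulmxA; exact: submxMr.
  + left; apply/eqmxP; apply: eqmx_trans ZE _.
    exact: adds_eqmx (eqmx_refl _) (eqmxMr B (eqmxP hZ)).
  + right; apply/eqmxP; apply: eqmx_trans ZE _.
    exact: adds_eqmx (eqmx_refl _) (eqmxMr B (eqmxP hZ)).
- have fE (Y : 'M_q) : ((X + Y *m B)%MS *m (Q *m f) :=: Y *m f)%MS.
    by rewrite mulmxA; apply: eqmxMr; apply: lift_mulQ.
  exists M', (Q *m f); split=> //.
  + split=> [|i]; first by rewrite fE; case: fh.
    apply: adds_mul0mx; rewrite mulmxBr !mulmxA.
      by rewrite XQ !mul0mx subr0 (sub_mul0mx (stX i) XQ) mul0mx.
    rewrite -[hi *m B *m Q]mulmxA BQ mulmx1 -[hi *m B *m A i]mulmxA BA -!mulmxA.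
    by rewrite [B *m (Q *m _)]mulmxA BQ mul1mx -mulmxBr; case: fh => _ /(_ i).
  + by rewrite !fE.
  + by apply/eqP; rewrite -submx0 fE flo sub0mx.
  + rewrite /= in frk *; rewrite fE !rank_lift; lia.
Qed.
End Transport.

(** The list runs from the bottom up. The chain ends with an equality of row spaces, since matrices
    with the same span may differ. *)
Inductive comp_chain N (A : 'I_p -> 'M[F]_N) : 'M[F]_N -> 'M[F]_N -> seq nat -> Prop :=
| comp_chain0 lo hi : (lo == hi)%MS -> comp_chain A lo hi [::]
| comp_chainS lo mid hi lam ts : simple_factor A lo mid lam ->
    comp_chain A mid hi ts -> comp_chain A lo hi (lam :: ts).

Lemma simple_factor_eqmxl N (A : 'I_p -> 'M[F]_N) lo lo' hi lam :
  (lo == lo')%MS -> simple_factor A lo hi lam -> simple_factor A lo' hi lam.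
Proof.
move=> /eqmxP e [[h1 h2 h3] h4 [M' [f [fL fh fs flo frk]]]]; split.
- split=> // [i|]; first by rewrite -!e -(eqmxMr _ e); apply: h1.
  by move: h3; rewrite !ltmxE !e.
- move=> X; rewrite -!e; exact: h4.
- exists M', f; split=> //; last by rewrite -e.
  by apply/eqP; rewrite -submx0 -(eqmxMr _ e) flo sub0mx.
Qed.

Lemma comp_chain_cat N (A : 'I_p -> 'M[F]_N) U1 U2 U3 s t :
  comp_chain A U1 U2 s -> comp_chain A U2 U3 t -> comp_chain A U1 U3 (s ++ t).
Proof.
elim=> {U1 U2 s} [lo hi e|lo mid hi lam ts h _ IH] ht; last first.
  exact: comp_chainS h (IH ht).
case: ht e => [lo' hi' e'|lo' mid hi' lam ts h ht] e.
  by apply: comp_chain0; apply/eqmxP; apply: eqmx_trans (eqmxP e) (eqmxP e').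
by apply: comp_chainS ht; apply: simple_factor_eqmxl h; rewrite andbC.
Qed.

Lemma comp_chainP N (A : 'I_p -> 'M[F]_N) lo hi ts : comp_chain A lo hi ts ->
  exists R : nat -> 'M[F]_N, [/\ R 0%N = lo, (R (size ts) == hi)%MS &
    forall k, (k < size ts)%N -> simple_factor A (R k) (R k.+1) (nth 0%N ts k)].
Proof.
elim=> {lo hi ts} [lo hi e|lo mid hi lam ts h _ [R [R0 Rs Rk]]]; first by exists (fun=> lo).
exists (fun k => if k is k'.+1 then R k' else lo); split=> // -[_|k hk] /=.
  by rewrite R0.
exact: Rk.
Qed.

(** This is the Zassenhaus argument: with [I] the intersection of [hi] and [R1], both [hi / lo] and
    [R1 / R0] are the quotient of [I] by the same submodule. *)
Lemma factor_transfer N (A : 'I_p -> 'M[F]_N) (lo hi R0 R1 : 'M[F]_N) lam :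
  let st X := forall i, (X *m A i <= X)%MS in
  st lo -> st hi -> st R0 -> st R1 -> (lo <= hi)%MS -> (R0 <= R1)%MS ->
  (hi <= hi :&: R1 + lo)%MS -> (R1 <= hi :&: R1 + R0)%MS ->
  (hi :&: R0 <= lo)%MS -> (lo :&: R1 <= R0)%MS ->
  @quot_iso F p (MkWmod A R1) R0 (is_L lam) ->
  @quot_iso F p (MkWmod A hi) lo (is_L lam).
Proof.
move=> st stlo sthi st0 st1 lohi R01 hiE R1E hi0 lo1 [M' [g [LM' gh gs g0 grk]]].
set I := (hi :&: R1)%MS in hiE R1E; pose C := (I :\: lo)%MS.
have Ihi : (I <= hi)%MS by apply: capmxSl.
have IR1 : (I <= R1)%MS by apply: capmxSr.
have stI i : (I *m A i <= I)%MS.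
  by rewrite sub_capmx (submx_trans (submxMr _ Ihi)) // (submx_trans (submxMr _ IR1)).
have CI : (C <= I)%MS by apply: diffmxSl.
have Clo : (C :&: lo = 0)%MS by apply: capmx_diff.
have IClo : (I <= C + lo)%MS by rewrite -(addsmx_diff_cap_eq I lo) addsmxS ?capmxSr.
(* The isomorphism must be a matrix on the ambient space: project along [lo] onto a complement
   inside [I], then apply [g]. On [I] this equals [g], as the discarded part lies in [R0]. *)
pose f := proj_mx C lo *m g.
have fI k (x : 'M_(k, N)) : (x <= I)%MS -> x *m f = x *m g.
  move=> xI; apply/eqP; rewrite eq_sym -subr_eq0 mulmxA -mulmxBl; apply/eqP.
  have xlo := proj_mx_compl_sub (submx_trans xI IClo).
  apply: sub_mul0mx g0; apply: submx_trans lo1.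
  rewrite sub_capmx xlo addmx_sub ?(submx_trans xI IR1) // eqmx_opp.
  exact: submx_trans (proj_mx_sub _ _ _) (submx_trans CI IR1).
have flo k (x : 'M_(k, N)) : (x <= lo)%MS -> x *m f = 0.
  by move=> xlo; rewrite mulmxA proj_mx_0 ?mul0mx.
clearbody f.
have hiE' : (hi :=: I + lo)%MS by apply/eqmxP; rewrite hiE addsmx_sub Ihi lohi.
have R1E' : (R1 :=: I + R0)%MS by apply/eqmxP; rewrite R1E addsmx_sub IR1 R01.
have hif : (hi *m f :=: R1 *m g)%MS.
  apply: eqmx_trans (eqmxMr f hiE') _; apply: eqmx_trans (addsmxMr _ _ _) _.
  apply: eqmx_trans _ (eqmx_sym (eqmxMr g R1E')); apply: eqmx_trans _ (eqmx_sym (addsmxMr _ _ _)).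
  by rewrite g0 (flo _ lo) // (fI _ I).
exists M', f; split=> //.
- split; first by rewrite /= hif; case: gh.
  move=> i /=; apply: (sub_mul0mx hiE); apply: adds_mul0mx; rewrite mulmxBr !mulmxA.
    rewrite (fI _ (I *m A i)) // (fI _ I) //; case: gh => _ /(_ i) /= h.
    by rewrite -!mulmxA -mulmxBr (sub_mul0mx IR1 h).
  by rewrite (flo _ (lo *m A i)) ?(flo _ lo) ?mul0mx ?subrr.
- by rewrite /= !hif.
- exact: flo.
- rewrite /= -(mxrank_mul_ker hi f); congr (_ + _)%N; apply: eqmx_rank.
  rewrite sub_capmx lohi; apply/andP; split; first by apply/sub_kermxP/flo.
  apply/rV_subP=> v; rewrite sub_capmx => /andP[vhi /sub_kermxP vf].
  have /sub_addsmxP[u uE] := submx_trans vhi hiE.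
  have uI : (u.1 *m I <= I)%MS by apply: submxMl.
  have := vf; rewrite uE mulmxDl (flo _ (u.2 *m lo)) ?submxMl // addr0 fI // => ug.
  have uR0 := quot_ker R01 g0 grk (submx_trans uI IR1) ug.
  rewrite addmx_sub ?submxMl //; apply: submx_trans hi0.
  by rewrite sub_capmx uR0 (submx_trans uI Ihi).
Qed.

(** * The Jordan-Hölder theorem *)

Section JordanHolder.
Variables (N : nat) (A : 'I_p -> 'M[F]_N) (U : 'M[F]_N) (n : nat).
Variables (R : nat -> 'M[F]_N) (ty : nat -> nat).
Hypothesis R0 : R 0%N = 0.
Hypothesis Rn : (R n == U)%MS.
Hypothesis Rsf : forall k, (k < n)%N -> simple_factor A (R k) (R k.+1) (ty k).

Let st (X : 'M[F]_N) := forall i, (X *m A i <= X)%MS.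

(** The indices at which the filtration induced by [R] on [X] grows. *)
Definition jump (X : 'M[F]_N) k := ~~ (X :&: R k.+1 <= R k)%MS.

Let stR k : (k <= n)%N -> st (R k).
Proof.
case: k => [_ i|k hk]; first by rewrite R0 mul0mx sub0mx.
by have [[]] := Rsf hk.
Qed.

Let RS k : (k < n)%N -> (R k <= R k.+1)%MS.
Proof. by move=> hk; have [[_ _ /ltmxW]] := Rsf hk. Qed.

Let Rle j k : (j <= k <= n)%N -> (R j <= R k)%MS.
Proof.
elim: k => [|k IHk] /andP[hjk hk]; first by move: hjk; rewrite leqn0 => /eqP ->.
move: hjk; rewrite leq_eqVlt => /orP[/eqP -> //|hjk].
by apply: submx_trans (RS hk); apply: IHk; rewrite (ltnW hk) andbT -ltnS.
Qed.

Let jump_full X k : st X -> (k < n)%N -> jump X k -> (R k.+1 <= X :&: R k.+1 + R k)%MS.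
Proof.
move=> stX hk; rewrite /jump => hj; have [_ simp _] := Rsf hk.
have hs : ((X :&: R k.+1)%MS + R k <= R k.+1)%MS by rewrite addsmx_sub capmxSr RS.
have [i||/andP[_ //]] := simp _ (addsmxSr (X :&: R k.+1)%MS (R k)) hs.
  rewrite addsmxMr addsmxS //; last exact: (stR (ltnW hk)).
  rewrite sub_capmx (submx_trans (submxMr _ (capmxSl _ _)) (stX i)) /=.
  exact: submx_trans (submxMr _ (capmxSr _ _)) (stR hk i).
by case/andP=> h _; case/negP: hj; apply: submx_trans h; apply: addsmxSl.
Qed.

Lemma jump_mono X Y k : (X <= Y)%MS -> jump X k -> jump Y k.
Proof. by move=> XY; apply: contra; apply: submx_trans; apply: capmxS. Qed.

(** The new jump is the least [j] such that [R j.+1] meets [hi] outside [lo]; as nothing lies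
    strictly between, [hi] is then the sum of [lo] and that intersection. *)
Lemma jordan_step lo hi : st lo -> st hi -> (lo < hi)%MS -> (hi <= U)%MS ->
  (forall X : 'M_N, (lo <= X)%MS -> (X <= hi)%MS -> st X -> (X == lo)%MS \/ (X == hi)%MS) ->
  exists2 j, [/\ (j < n)%N, jump hi j, ~~ jump lo j &
                 @quot_iso F p (MkWmod A hi) lo (is_L (ty j))] &
    forall k, (k < n)%N -> jump hi k -> ~~ jump lo k -> k = j.
Proof.
move=> stlo sthi lohi hiU simp; have lohiW := ltmxW lohi.
have ex : exists j, ~~ (hi :&: R j <= lo)%MS && (j <= n)%N.
  exists n; rewrite leqnn andbT; apply/negP=> h; move: lohi; rewrite ltmxE => /andP[_ /negP].
  apply; apply: submx_trans h; rewrite sub_capmx submx_refl (eqmxP Rn); exact: hiU.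
case: (ex_minnP ex) => -[|j] /andP[hj jn] jmin.
  by case/negP: hj; rewrite R0 capmx0 sub0mx.
have hij : (hi :&: R j <= lo)%MS.
  apply: contraT => h; have := jmin j; rewrite h (ltnW jn) => /(_ isT); by rewrite ltnn.
have hiE k : (k < n)%N -> ~~ (hi :&: R k.+1 <= lo)%MS -> (hi <= hi :&: R k.+1 + lo)%MS.
  move=> kn hk; have hs : ((hi :&: R k.+1)%MS + lo <= hi)%MS by rewrite addsmx_sub capmxSl.
  have [i||/andP[_ //]] := simp _ (addsmxSr (hi :&: R k.+1)%MS lo) hs.
    rewrite addsmxMr addsmxS //.
    rewrite sub_capmx (submx_trans (submxMr _ (capmxSl _ _)) (sthi i)) /=.
    exact: submx_trans (submxMr _ (capmxSr _ _)) (stR kn i).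
  by case/andP=> h _; case/negP: hk; apply: submx_trans h; apply: addsmxSl.
have jhi : jump hi j.
  apply: contra hj => h; apply: submx_trans hij; by rewrite sub_capmx capmxSl.
have jlo : ~~ jump lo j.
  apply/negP=> jl; case/negP: hj; have Rj := jump_full stlo jn jl.
  apply/rV_subP=> v; rewrite sub_capmx => /andP[vhi vR].
  have /sub_addsmxP[u uE] := submx_trans vR Rj.
  have ulo : (u.1 *m (lo :&: R j.+1)%MS <= lo)%MS.
    exact: submx_trans (submxMl _ _) (capmxSl _ _).
  rewrite uE addmx_sub //; apply: submx_trans hij; rewrite sub_capmx submxMl andbT.
  have -> : u.2 *m R j = v - u.1 *m (lo :&: R j.+1)%MS by rewrite uE addrC addKr.
  by rewrite addmx_sub // eqmx_opp (submx_trans ulo).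
exists j.
  split=> //; have [_ _ q] := Rsf jn.
  apply: factor_transfer q => //; [exact: (stR (ltnW jn)) | exact: (stR jn) | exact: RS
    | exact: hiE | exact: jump_full |].
  by move: jlo; rewrite /jump negbK.
(* Below [j], [hi] meets the filtration inside [lo]; above [j], [hi] is the sum of [lo] and a part
   already in [R k]. In both cases a jump of [hi] is one of [lo]. *)
move=> k kn khi klo; case: (ltngtP k j) => // kj.
  case/negP: khi; apply: submx_trans (_ : (lo :&: R k.+1 <= _)%MS).
    rewrite sub_capmx capmxSr andbT; apply: submx_trans hij; rewrite capmxS //.
    by apply: Rle; rewrite kj ltnW.
  by move: klo; rewrite /jump negbK.
case/negP: khi; apply/rV_subP=> v; rewrite sub_capmx => /andP[vhi vR].
have /sub_addsmxP[u uE] := submx_trans vhi (hiE j jn hj).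
have jk : (R j.+1 <= R k)%MS by apply: Rle; rewrite kj ltnW.
have uR : (u.1 *m (hi :&: R j.+1)%MS <= R k)%MS.
  exact: submx_trans (submxMl _ _) (submx_trans (capmxSr _ _) jk).
rewrite uE addmx_sub //; move: klo; rewrite /jump negbK; apply: submx_trans.
rewrite sub_capmx submxMl /=.
have -> : u.2 *m lo = v - u.1 *m (hi :&: R j.+1)%MS by rewrite uE addrC addKr.
by rewrite addmx_sub // eqmx_opp (submx_trans uR) // RS.
Qed.

(** The bijection sends a step to its new jump: jumps accumulate along the series, from none at 0 to
    all indices at [U]. *)
Lemma jordan_holder m (Us : 'I_m.+1 -> 'M[F]_N) :
  comp_series (MkWmod A U) m Us ->
  exists2 phi : 'I_m -> 'I_n, bijective phi &
    forall k, factor_is_L (MkWmod A U) Us k (ty (phi k)).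
Proof.
move=> [U0 Um stU sU].
have lohi (k : 'I_m) : (Us (widen_ord (leqnSn m) k) < Us (lift ord0 k))%MS by have [] := sU k.
have UsS (j : nat) (hj : (j < m)%N) : (Us (inord j) < Us (inord j.+1))%MS.
  have := lohi (Ordinal hj); congr (Us _ < Us _)%MS; apply: val_inj; rewrite /= inordK //; lia.
have mono (i j : nat) : (i <= j <= m)%N -> (Us (inord i) <= Us (inord j))%MS.
  elim: j => [|j IHj] /andP[hij hj]; first by move: hij; rewrite leqn0 => /eqP ->.
  move: hij; rewrite leq_eqVlt => /orP[/eqP -> //|hij].
  by apply: submx_trans (ltmxW (UsS j hj)); apply: IHj; lia.
have UsU j : (Us j <= U)%MS.
  have := mono j m; rewrite inord_val => h; case/andP: Um => Um _; apply: submx_trans Um.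
  have -> : ord_max = inord m :> 'I_m.+1 by apply: val_inj; rewrite /= inordK.
  by apply: h; rewrite leqnn andbT -ltnS.
have step (k : 'I_m) : exists j : 'I_n,
    [/\ jump (Us (lift ord0 k)) j, ~~ jump (Us (widen_ord (leqnSn m) k)) j,
        factor_is_L (MkWmod A U) Us k (ty j) &
        forall j' : 'I_n, jump (Us (lift ord0 k)) j' ->
          ~~ jump (Us (widen_ord (leqnSn m) k)) j' -> j' = j].
  have [_ sk] := sU k.
  have [j [jn h1 h2 h3] h4] := jordan_step (stU _) (stU _) (lohi k) (UsU _) sk.
  exists (Ordinal jn); split; [exact: h1 | exact: h2 | exact: h3 |].
  by move=> j' a b; apply: val_inj; exact: (h4 _ (ltn_ord j') a b).
have [phi phiP] := fin_all_exists step; exists phi; last by move=> k; have [] := phiP k.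
have wE (k : 'I_m) : widen_ord (leqnSn m) k = inord k.
  by apply: val_inj; rewrite /= inordK //; have := ltn_ord k; lia.
have lE (k : 'I_m) : lift ord0 k = inord k.+1.
  by apply: val_inj; rewrite /= inordK // ltnS.
have inj : injective phi.
  have neq (k k' : 'I_m) : (k < k')%N -> phi k <> phi k'.
    move=> kk e; have [h1 _ _ _] := phiP k; have [_ /negP h2 _ _] := phiP k'; case: h2.
    rewrite -e wE; rewrite lE in h1; apply: jump_mono h1; apply: mono.
    by rewrite kk ltnW.
  move=> k k' e; apply: val_inj; case: (ltngtP k k') => // /neq; first by case.
  by case; symmetry.
have surj (j : 'I_n) : exists k, phi k = j.
  have ex : exists i, jump (Us (inord i)) j && (i <= m)%N.
    exists m; rewrite leqnn andbT; have -> : inord m = ord_max :> 'I_m.+1.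
      by apply: val_inj; rewrite /= inordK.
    have [[_ _ lt] _ _] := Rsf (ltn_ord j); move: lt; rewrite ltmxE => /andP[_ /negP h].
    apply/negP=> h'; apply: h; apply: submx_trans h'; rewrite sub_capmx submx_refl andbT.
    case/andP: Um => _ /(submx_trans _); apply; rewrite /= -(eqmxP Rn).
    by apply: Rle; rewrite ltn_ord leqnn.
  case: (ex_minnP ex) => -[|k] /andP[hk km] kmin.
    case/negP: hk; have -> : inord 0 = ord0 :> 'I_m.+1 by apply: val_inj; rewrite /= inordK.
    by rewrite U0 cap0mx sub0mx.
  exists (Ordinal km); symmetry; have [_ _ _] := phiP (Ordinal km); apply.
    by rewrite lE.
  rewrite wE /=; apply/negP=> h; have := kmin k; rewrite h (ltnW km) => /(_ isT).
  by rewrite ltnn.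
have [psi psiP] := fin_all_exists surj.
by exists psi => // k; apply: inj; rewrite psiP.
Qed.
End JordanHolder.

End Chains.

Lemma sums_mul0mx (F : fieldType) (I : finType) (P : pred I) n k (X : I -> 'M[F]_n)
    (Z : 'M[F]_(n, k)) :
  (forall i, P i -> X i *m Z = 0) -> (\sum_(i | P i) X i)%MS *m Z = 0.
Proof.
move=> hX; apply/row_matrixP=> j; rewrite row_mul row0.
have /sub_sumsmxP[u ->] := row_sub j (\sum_(i | P i) X i)%MS.
by rewrite mulmx_suml big1 // => i Pi; rewrite -mulmxA hX // mulmx0.
Qed.

(** Factors from the bottom up. [V] occurs only as [V(0)], with the exact forms below a trivial
    quotient, and as [V(p-1)], with the constants at the bottom. *)
Definition summand_factors (p' : nat) (s : summand) : seq nat :=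
  match s with SV l => if l == 0%N then [:: p'; 0%N] else [:: 0%N; p'] | SL l => [:: l] end.

(** * Ordering the blocks by type *)

Section BlockOrdering.
Variables (p' : nat) (Bt : finType) (lam : Bt -> nat) (top : Bt) (dv : bool).
Local Notation p := p'.+1.

Definition cut b := dv && (b == top).

Definition block_type b : summand :=
  if cut b then SL p' else if lam b == 0%N then SV 0 else
  if lam b == p' then SV p' else SL (lam b).

Hypothesis p_gt2 : (2 < p)%N.
Hypothesis lam_lt : forall b, (lam b < p)%N.
Hypothesis lam_top : dv -> lam top = 0%N.

Lemma lam_cut b : cut b -> lam b = 0%N.
Proof. by case/andP=> hd /eqP ->; apply: lam_top. Qed.

Let fl (P : pred Bt) := filter P (enum Bt).

Definition block_list :=
  fl (fun b => (lam b == 0%N) && ~~ cut b) ++ fl (fun b => lam b == p') ++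
  flatten [seq fl (fun b => lam b == i) | i <- iota 1 (p - 2)] ++ (if dv then [:: top] else [::]).

Lemma mem_block_list b : b \in block_list.
Proof.
have memf (P : pred Bt) : (b \in fl P) = P b by rewrite mem_filter mem_enum andbT.
rewrite !mem_cat !memf; case: (boolP (cut b)) => [/andP[-> /eqP ->]|hc].
  by rewrite inE eqxx !orbT.
rewrite andbT; case: eqVneq => //= l0; case: eqVneq => //= lp; apply/orP; left.
apply/flattenP; exists (fl (fun b' => lam b' == lam b)); last by rewrite memf eqxx.
by apply/mapP; exists (lam b) => //; rewrite mem_iota; have := lam_lt b; lia.
Qed.

Variable q : nat.
Hypothesis card_lam : forall l, (l < p)%N -> #|[pred b | lam b == l]| = q.

Lemma map_filter_const (P : pred Bt) s : (forall b, P b -> block_type b = s) ->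
  map block_type (fl P) = nseq #|P| s.
Proof.
move=> hP; have -> : #|P| = count P (enum Bt).
  by rewrite -sum1_count big_enum_cond /= -sum1_card; apply: eq_bigl.
by rewrite /fl; elim: (enum Bt) => //= b l IH; case: ifP => //= hb; rewrite (hP b hb) IH.
Qed.

Lemma block_list_types : map block_type block_list =
  nseq (q - dv) (SV 0) ++ nseq q (SV p') ++
  flatten [seq nseq q (SL i) | i <- iota 1 (p - 2)] ++ (if dv then [:: SL p'] else [::]).
Proof.
rewrite !map_cat map_flatten; congr (_ ++ (_ ++ (_ ++ _))).
- rewrite (@map_filter_const _ (SV 0)); last first.
    by move=> b /andP[/eqP l0 /negPf hc]; rewrite /block_type hc l0.
  congr nseq; rewrite -(card_lam (ltn0Sn p')) /cut; case: dv lam_top => [l0|_] /=.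
    rewrite [in RHS](cardD1 top) !inE l0 // eqxx addKn; apply: eq_card => b.
    by rewrite !inE andbC.
  by rewrite subn0; apply: eq_card => b; rewrite [RHS]inE unfold_in /= ?andbT.
- rewrite (@map_filter_const _ (SV p')); last first.
    move=> b /eqP lb; rewrite /block_type; case: ifP => [/lam_cut l0|_]; first by move: lb; rewrite l0; lia.
    by rewrite lb eqxx ifF //; apply/negbTE; lia.
  by rewrite -(card_lam (ltnSn p')).
- congr flatten; rewrite -map_comp; apply/eq_in_map => i; rewrite mem_iota => hi /=.
  rewrite (@map_filter_const _ (SL i)); last first.
    move=> b /eqP lb; rewrite /block_type; case: ifP => [/lam_cut l0|_]; first by move: lb hi; rewrite l0; lia.
    by rewrite lb !ifF //; apply/negbTE; lia.
  by rewrite -(card_lam (_ : (i < p)%N)) //; lia.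
- by rewrite /block_type /cut; case: dv => //=; rewrite eqxx.
Qed.

(** A list that meets every block and is no longer than the number of blocks has no repetition; its
    length is read off from the types. *)
Lemma uniq_block_list : (0 < q)%N -> #|Bt| = (p * q)%N -> uniq block_list.
Proof.
move=> q_gt0 cB; apply: (@leq_size_uniq _ (enum Bt)); first exact: enum_uniq.
  by move=> b _; apply: mem_block_list.
rewrite -cardE cB -(size_map block_type) block_list_types !size_cat !size_nseq.
rewrite size_flatten /shape -map_comp (@eq_map _ _ _ (fun=> q)); last by move=> i; rewrite /= size_nseq.
have -> : sumn [seq q | _ <- iota 1 (p - 2)] = ((p - 2) * q)%N.
  by rewrite -[in RHS](size_iota 1 (p - 2)); elim: (iota 1 (p - 2)) => //= a l ->; rewrite mulSn.
have : (q - dv + (q + (p - 2) * q) + dv = p * q)%N by case: (dv); nia.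
by case: (dv) => /=; lia.
Qed.

End BlockOrdering.

(** * Assembling the blocks *)

Section Assembly.
Variables (F : fieldType) (p' N : nat).
Local Notation p := p'.+1.
Hypothesis charF : p \in [pchar F].
Hypothesis p_gt2 : (2 < p)%N.
Variables (A : 'I_p -> 'M[F]_N) (U : 'M[F]_N) (Bt : finType) (lam : Bt -> nat).
Variables (top : Bt) (dv : bool) (Bm : Bt -> 'M[F]_(p, N)) (Q : Bt -> 'M[F]_(N, p)).

Local Notation cut := (cut top dv).
Local Notation block_type := (block_type p' lam top dv).

Definition Lm b : 'M[F]_p := pid_mx (if cut b then p' else p).

Hypothesis lam_lt : forall b, (lam b < p)%N.
Hypothesis lam_top : dv -> lam top = 0%N.
Hypothesis BQ : forall b' b, Bm b' *m Q b = if b' == b then 1%:M else 0.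
Hypothesis BA : forall b i, Bm b *m A i = densA F (lam b).+1 i *m Bm b.
Hypothesis UE : (U == \sum_b <<Lm b *m Bm b>>)%MS.

Definition Wb b : 'M[F]_N := <<Lm b *m Bm b>>%MS.

Let BQ1 b : Bm b *m Q b = 1%:M. Proof. by rewrite BQ eqxx. Qed.
Let freeB b : row_free (Bm b). Proof. by apply/row_freeP; exists (Q b). Qed.

Let lam_cut := lam_cut lam_top.

Lemma level_Lm b : dens_level F p' (lam b).+1 (if cut b then p' else p).
Proof.
rewrite /dens_level; case: ifP => [/lam_cut -> |_]; rewrite eqxx ?orbT //.
by rewrite [1%:R == 1]eqxx !orbT.
Qed.

Lemma Lm_stable b i : (Lm b *m densA F (lam b).+1 i <= Lm b)%MS.
Proof. exact: (stable_pid charF p_gt2 (level_Lm b)). Qed.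

Lemma Wb_stable b i : (Wb b *m A i <= Wb b)%MS.
Proof.
rewrite genmxE (eqmxMr _ (genmxE _)) -mulmxA BA mulmxA; apply: submxMr; exact: Lm_stable.
Qed.

Lemma Wb_mulQ b : (Wb b *m Q b :=: Lm b)%MS.
Proof. by apply: eqmx_trans (eqmxMr _ (genmxE _)) _; rewrite -mulmxA BQ1 mulmx1. Qed.

Lemma Wb_mulQ0 b b' : b' != b -> Wb b' *m Q b = 0.
Proof.
move=> ne; apply/eqP; rewrite -submx0 (eqmxMr _ (genmxE _)) -mulmxA BQ (negPf ne) mulmx0.
exact: sub0mx.
Qed.

Lemma block_pred b : @summand_pred F p (block_type b) (MkWmod (densA F (lam b).+1) (Lm b)).
Proof.
rewrite /Lm /block_type; case: ifP => [/lam_cut ->|_]; first exact: (L_exactW charF p_gt2).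
rewrite pid_mx_1; case: eqP => [->|/eqP l0]; first exact: (dens_V charF p_gt2 0).
case: eqP => [->|/eqP lp]; first exact: (dens_V charF p_gt2 p').
by apply: (L_dens charF p_gt2); have := lam_lt b; lia.
Qed.

Lemma block_iso b :
  @quot_iso F p (MkWmod A (Wb b)) 0 (@summand_pred F p (block_type b)).
Proof.
exists (MkWmod (densA F (lam b).+1) (Lm b)), (Q b); split=> /=.
- exact: block_pred.
- split=> [|i] /=; first by rewrite Wb_mulQ.
  apply: (@sub_mul0mx _ _ _ _ _ _ (Lm b *m Bm b)); first by rewrite genmxE.
  rewrite mulmxBr !mulmxA -[_ *m Bm b *m Q b]mulmxA BQ1 mulmx1 -[_ *m Bm b *m A i]mulmxA BA.
  by rewrite -!mulmxA BQ1 mulmx1 subrr.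
- by rewrite !Wb_mulQ submx_refl.
- exact: mul0mx.
- by rewrite mxrank0 addn0 Wb_mulQ genmxE mxrankMfree.
Qed.

(** [Q b] vanishes on all blocks but [b] and is injective on that one, so the sum is direct. *)
Lemma decomposition (bs : seq Bt) : uniq bs -> (forall b, b \in bs) ->
  decomposes_as (MkWmod A U) (map block_type bs).
Proof.
move=> ubs allb; pose nb (k : 'I_(size (map block_type bs))) := nth top bs k.
have klt (k : 'I_(size (map block_type bs))) : (k < size bs)%N.
  by rewrite -(size_map block_type bs).
have subU b : (Wb b <= U)%MS by rewrite (eqmxP UE) (sumsmx_sup b).
exists (fun k => Wb (nb k)); split.
- by move=> k; split=> [|i]; [exact: subU | exact: Wb_stable].
- apply/mxdirect_sumsP=> k _; apply/eqP; rewrite -submx0; apply/rV_subP=> v.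
  rewrite sub_capmx => /andP[v1 v2].
  have vQ : v *m Q (nb k) = 0.
    apply: (sub_mul0mx v2); apply: sums_mul0mx => j /= jk; apply: Wb_mulQ0.
    by rewrite nth_uniq.
  move: v1; rewrite genmxE => /submxP[y yE]; move: vQ.
  rewrite {1}yE -!mulmxA BQ1 mulmx1 => y0.
  by rewrite yE mulmxA y0 mul0mx sub0mx.
- apply/andP; split; first by apply/sumsmx_subP=> k _; apply: subU.
  rewrite /= (eqmxP UE); apply/sumsmx_subP=> b _.
  have hb : (index b bs < size (map block_type bs))%N by rewrite size_map index_mem.
  by apply: (sumsmx_sup (Ordinal hb)) => //; rewrite /nb /= nth_index.
- move=> k; have -> : nth (SV 0) (map block_type bs) k = block_type (nb k).
    by rewrite (nth_map top).
  exact: block_iso.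
Qed.

Lemma block_chain b (X : 'M[F]_N) : (forall i, (X *m A i <= X)%MS) -> X *m Q b = 0 ->
  comp_chain A X (X + Lm b *m Bm b)%MS (summand_factors p' (block_type b)).
Proof.
move=> stX XQ.
have lift lo hi l := @lift_simple_factor _ _ _ _ A _ (Bm b) (Q b) X (BQ1 b) (BA b) stX XQ lo hi l.
have start hi l : simple_factor (densA F (lam b).+1) (pid_mx 0) hi l ->
    simple_factor A X (X + hi *m Bm b)%MS l.
  move=> /lift; apply: simple_factor_eqmxl; rewrite pid_mx_0 mul0mx addsmxSl andbT.
  by rewrite addsmx_sub submx_refl sub0mx.
have fin (Y : 'M[F]_N) : comp_chain A Y Y [::] by apply: comp_chain0; rewrite submx_refl.
rewrite /block_type /Lm; case: ifP => [hc|_] /=.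
  by apply: comp_chainS (fin _); apply: start; rewrite (lam_cut hc); apply: factor_exact.
case: eqP => [l0|/eqP l0] /=.
  apply: comp_chainS (start _ _ _) _; first by rewrite l0; apply: factor_exact.
  by apply: comp_chainS (fin _); apply: lift; rewrite l0; apply: factor_exact_quo.
case: eqP => [lp|/eqP lp] /=; last first.
  by apply: comp_chainS (fin _); apply: start; apply: factor_mid => //; have := lam_lt b; lia.
have -> : p' == 0%N = false by apply/negbTE; lia.
apply: comp_chainS (start _ _ _) _; first by rewrite lp; apply: factor_const.
by apply: comp_chainS (fin _); apply: lift; rewrite lp; apply: factor_const_quo.
Qed.

(** The coordinates of the blocks still to come vanish on the sum built so far; this transversality
    lets the next block be stacked on top. *)
Lemma full_chain (bs : seq Bt) : uniq bs ->
  exists X ts, [/\ comp_chain A 0 X ts,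
    perm_eq ts (flatten (map (summand_factors p') (map block_type bs))),
    forall b, b \notin bs -> X *m Q b = 0,
    (forall i, (X *m A i <= X)%MS) &
    (forall b, b \in bs -> (Lm b *m Bm b <= X)%MS) /\ (X <= \sum_b Wb b)%MS].
Proof.
elim: bs => [_|b bs IH /= /andP[nb ubs]].
  exists 0, [::]; split=> //; rewrite ?sub0mx //.
  - by apply: comp_chain0; rewrite submx_refl.
  - by move=> b _; rewrite mul0mx.
  - by move=> i; rewrite mul0mx.
have [X [ts [ch pts XQ stX [Xb XU]]]] := IH ubs.
exists (X + Lm b *m Bm b)%MS, (ts ++ summand_factors p' (block_type b)); split.
- by apply: comp_chain_cat ch _; apply: block_chain => //; apply: XQ.
- by rewrite perm_catC perm_cat2l.
- move=> b'; rewrite inE negb_or => /andP[ne nb']; apply: adds_mul0mx; first exact: XQ.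
  by rewrite -mulmxA BQ eq_sym (negPf ne) mulmx0.
- by apply: (lift_stable (E := densA F (lam b).+1)) => //; apply: Lm_stable.
- split=> [b'|]; last first.
    by rewrite addsmx_sub XU (sumsmx_sup b) // genmxE.
  rewrite inE => /orP[/eqP ->|hb']; first exact: addsmxSr.
  exact: submx_trans (Xb _ hb') (addsmxSl _ _).
Qed.

Lemma count_nth_card (ts : seq nat) l :
  #|[set j : 'I_(size ts) | nth 0%N ts j == l]| = count_mem l ts.
Proof.
rewrite -sum1_count (big_nth 0%N) big_mkord -sum1_card; apply: eq_bigl => j.
by rewrite inE.
Qed.

Theorem composition_factors (bs : seq Bt) (M := MkWmod A U) :
  uniq bs -> (forall b, b \in bs) ->
  [/\ decomposes_as M (map block_type bs),
      exists m Us, comp_series M m Us &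
  forall m Us, comp_series M m Us ->
     (forall k : 'I_m, exists2 l, (l < p)%N & factor_is_L M Us k l) /\
     (forall l, (l < p)%N ->
        exists2 S : {set 'I_m},
          #|S| = count_mem l (flatten (map (summand_factors p') (map block_type bs))) &
          forall k, k \in S <-> factor_is_L M Us k l)].
Proof.
move=> ubs allb; split; first exact: decomposition.
  have [X [ts [/comp_chainP[R [R0 Rs Rk]] _ _ stX [Xb XU]]]] := full_chain ubs.
  have XE : (X == U)%MS.
    apply/eqmxP; apply: eqmx_trans _ (eqmx_sym (eqmxP UE)); apply/eqmxP; rewrite XU.
    by apply/sumsmx_subP=> b _; rewrite genmxE; apply: Xb.
  exists (size ts), (fun k : 'I_(size ts).+1 => R k); split=> //=.
  - by apply/eqmxP; apply: eqmx_trans (eqmxP Rs) (eqmxP XE).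
  - case=> -[|k] hk i /=; first by rewrite R0 mul0mx sub0mx.
    by have [[_ h _] _ _] := Rk k hk; apply: h.
  - move=> k; have [[_ _ lt] simp _] := Rk k (ltn_ord k); split; first exact: lt.
    move=> Y; exact: simp.
have [X [ts [/comp_chainP[R [R0 Rs Rk]] pts _ stX [Xb XU]]]] := full_chain ubs.
have XE : (X == U)%MS.
  apply/eqmxP; apply: eqmx_trans _ (eqmx_sym (eqmxP UE)); apply/eqmxP; rewrite XU.
  by apply/sumsmx_subP=> b _; rewrite genmxE; apply: Xb.
have Rn : (R (size ts) == U)%MS by apply/eqmxP; apply: eqmx_trans (eqmxP Rs) (eqmxP XE).
move=> m Us cs; have [phi bphi phiL] := jordan_holder R0 Rn Rk cs.
have ts_lt (j : 'I_(size ts)) : (nth 0%N ts j < p)%N.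
  have : nth 0%N ts j \in ts by rewrite mem_nth.
  rewrite (perm_mem pts) -map_comp => /flattenP[s /mapP[b _ ->] /=].
  rewrite /block_type; case: ifP => _ /=; first by rewrite inE => /eqP ->.
  case: ifP => _ /=; first by rewrite !inE => /orP[] /eqP ->.
  case: ifP => _ /=; last by rewrite inE => /eqP ->; apply: lam_lt.
  by case: ifP => _; rewrite !inE => /orP[] /eqP ->.
split=> [k|l lp]; first by exists (nth 0%N ts (phi k)).
(* [S] collects the steps matched with a factor of type [l]. That every step with quotient [L(l)]
   belongs to it is where a quotient has to determine its [lam]. *)
exists [set k | nth 0%N ts (phi k) == l].
  rewrite -(seq.permP pts) -count_nth_card.
  have -> : [set k | nth 0%N ts (phi k) == l] = phi @^-1: [set j : 'I_(size ts) | nth 0%N ts j == l].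
    by apply/setP=> k; rewrite !inE.
  by rewrite on_card_preimset //; apply: onW_bij.
move=> k; rewrite inE; split=> [/eqP <-|hL]; first exact: phiL.
have [_ _ stU sU] := cs; have [lt _] := sU k.
apply/eqP; exact: (@quot_iso_L_inj F p' charF p_gt2 (MkWmod A (Us (lift ord0 k)))
  (Us (widen_ord (leqnSn m) k)) _ _ (ts_lt (phi k)) lp (ltmxW lt) (stU _) (phiL k) hL).
Qed.

End Assembly.

(** * The contact bracket *)

Section ContactBracket.
Variables (R : comPzRingType) (I : finType) (h : pred I) (t : I) (pr : I -> I).
Variables (s x : I -> R) (d : I -> R -> R).
Hypothesis htE : forall i, h i = (i != t).
Hypothesis hpr : forall j, h j -> h (pr j).
Hypothesis prK : forall j, h j -> pr (pr j) = j.
Hypothesis prN : forall j, h j -> pr j != j.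
Hypothesis spr : forall j, h j -> s (pr j) = - s j.
Hypothesis ss : forall j, s j * s j = 1.
Hypothesis dD : forall i f g, d i (f + g) = d i f + d i g.
Hypothesis dM : forall i f g, d i (f * g) = d i f * g + f * d i g.
Hypothesis dC : forall i j f, d i (d j f) = d j (d i f).
Hypothesis dx : forall i j, d i (x j) = (i == j)%:R.
Hypothesis ds : forall i j, d i (s j) = 0.

Local Notation T := (d t).

(** An abstract form of the contact field: [ccomp f] is its coefficient vector, [cap f g] its value
    on [g], and [cbr] the bracket [<f, g>]. The signs [s j] are ring elements killed by every [d i],
    so that [ring] can treat them. *)
Definition hcomp f j := x j * T f + s (pr j) * d (pr j) f.
Definition ccomp f j :=
  if h j then hcomp f j else 2 * f - \sum_(k | h k) s k * (x k * hcomp f (pr k)).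
Definition cap f g := \sum_i ccomp f i * d i g.
Definition cbr f g := cap f g - 2 * (g * T f).

(* The contact distribution is spanned by the [Y j], which satisfy the
   Heisenberg relations, and the contact field of [f] is
   [2 f T + \sum_j s (pr j) (Y (pr j) f) (Y j)]. *)
Definition Y j f := d j f + s j * (x (pr j) * T f).
Definition hbr f g := \sum_(j | h j) s (pr j) * (Y (pr j) f * Y j g).

Let d0 i : d i 0 = 0.
Proof. by apply: (addIr (d i 0)); rewrite -dD !add0r. Qed.
Let dN i f : d i (- f) = - d i f.
Proof. by apply: (addIr (d i f)); rewrite -dD !addNr d0. Qed.
Let dMs i j f : d i (s j * f) = s j * d i f.
Proof. by rewrite dM ds mul0r add0r. Qed.
Let Tx j : h j -> T (x j) = 0.
Proof. by rewrite htE dx eq_sym => /negPf ->. Qed.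

Lemma sum_pr (V : zmodType) (G : I -> V) : \sum_(k | h k) G k = \sum_(j | h j) G (pr j).
Proof.
rewrite (reindex_onto pr pr) => [|j hj]; last exact: prK.
apply: eq_bigl => j; apply/andP/idP=> [[hj /eqP e]|hj]; first by rewrite -e; apply: hpr.
by rewrite hpr // prK.
Qed.

Lemma hcompE f j : h j -> hcomp f j = s (pr j) * Y (pr j) f.
Proof.
by move=> hj; rewrite /hcomp /Y prK // mulrDr mulrA ss mul1r addrC.
Qed.

Lemma capE f g : cap f g = 2 * (f * T g) + hbr f g.
Proof.
rewrite /cap (bigD1 t) //= {1}/ccomp htE eqxx /= mulrBl -mulrA -addrA; congr (_ + _).
rewrite sum_pr mulr_suml -sumrN.
rewrite (eq_bigl h) => [|i]; last by rewrite htE.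
rewrite -big_split /=; apply: eq_bigr => j hj; rewrite /ccomp hj prK // spr // hcompE // spr //.
rewrite /Y; ring.
Qed.

Lemma YD j f g : Y j (f + g) = Y j f + Y j g.
Proof. by rewrite /Y !dD; ring. Qed.
Lemma YN j f : Y j (- f) = - Y j f.
Proof. by rewrite /Y !dN; ring. Qed.
Lemma YM j f g : Y j (f * g) = Y j f * g + f * Y j g.
Proof. by rewrite /Y !dM; ring. Qed.
Lemma Ys j k f : Y j (s k * f) = s k * Y j f.
Proof. by rewrite /Y !dMs; ring. Qed.
Lemma Y_sum j (P : pred I) G : Y j (\sum_(k | P k) G k) = \sum_(k | P k) Y j (G k).
Proof. by apply: (big_morph _ (YD j)); rewrite /Y !d0; ring. Qed.

Lemma YT j f : h j -> T (Y j f) = Y j (T f).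
Proof.
by move=> hj; rewrite /Y dD dMs dM Tx ?hpr // mul0r add0r dC.
Qed.

Lemma Y_comm j k f : h j -> h k ->
  Y j (Y k f) = Y k (Y j f) + (if k == pr j then 2 * (s (pr j) * T f) else 0).
Proof.
move=> hj hk; rewrite /Y !dD !dMs !dM !dx.
have [htj htk] : t == pr j = false /\ t == pr k = false.
  by split; apply/negbTE; rewrite eq_sym -htE hpr.
rewrite htj htk (dC j k) (dC t j) (dC t k).
have -> : (j == pr k) = (k == pr j).
  by apply/eqP/eqP=> ->; rewrite prK.
case: eqP => [->|_] /=; last by ring.
by rewrite prK // spr //; ring.
Qed.

Lemma hbrC f g : hbr g f = - hbr f g.
Proof.
rewrite /hbr sum_pr -sumrN; apply: eq_bigr => j hj; rewrite prK // spr //; ring.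
Qed.

(** Moving [Y k] past the [Y] inside [hbr] gives commutators only in the summands [j = k] and
    [j = pr k]. They cancel what the product rule yields when [Y k] differentiates the factor
    without [T] in [f * T g] and [g * T f]. *)
Lemma Y_cbr k f g : h k -> Y k (cbr f g) = cap f (Y k g) - cap g (Y k f).
Proof.
move=> hk; rewrite /cbr !capE [hbr g (Y k f)]hbrC !YD YN.
have two (z : R) : Y k (2 * z) = 2 * Y k z by rewrite -[2]/(1 + 1) !mulrDl !mul1r YD.
rewrite !two !YM -!YT //.
have -> : Y k (hbr f g) = hbr (Y k f) g + hbr f (Y k g)
     + 2 * (T f * Y k g) - 2 * (Y k f * T g); last by ring.
(* Both corrections are written as sums supported at one index, so that the identity can be checked
   summand by summand. *)
have -> : 2 * (T f * Y k g) = \sum_(j | h j) (if j == k then 2 * (T f * Y j g) else 0).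
  by rewrite (bigD1 k) //= eqxx big1 ?addr0 // => j /andP[_ /negPf ->].
have -> : 2 * (Y k f * T g) = \sum_(j | h j) (if j == pr k then 2 * (Y (pr j) f * T g) else 0).
  rewrite (bigD1 (pr k)) ?hpr //= eqxx prK // big1 ?addr0 // => j /andP[_ /negPf ->] //.
rewrite /hbr Y_sum -!big_split -sumrB /=; apply: eq_bigr => j hj.
rewrite Ys YM (Y_comm f hk (hpr hj)) (Y_comm g hk hj).
have -> : (pr j == pr k) = (j == k).
  by apply/eqP/eqP=> [e|-> //]; rewrite -(prK hj) e prK.
have s1 : s (pr j) * s (pr j) = 1 by apply: ss.
case: (eqVneq j k) => [e|ne]; case: (eqVneq j (pr k)) => [e'|ne'].
- by have := prN hk; rewrite -e' -e eqxx.
- rewrite -e; ring: s1.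
- by rewrite -e' spr //; ring: (ss j).
- by ring.
Qed.

Let capM f g1 g2 : cap f (g1 * g2) = cap f g1 * g2 + g1 * cap f g2.
Proof.
rewrite /cap mulr_suml mulr_sumr -big_split; apply: eq_bigr => i _ /=; rewrite dM; ring.
Qed.
Let capD f g1 g2 : cap f (g1 + g2) = cap f g1 + cap f g2.
Proof. by rewrite /cap -big_split; apply: eq_bigr => i _ /=; rewrite dD; ring. Qed.
Let cap0 f : cap f 0 = 0.
Proof. by rewrite /cap big1 // => i _; rewrite d0 mulr0. Qed.
Let capN f g : cap f (- g) = - cap f g.
Proof. by rewrite /cap -sumrN; apply: eq_bigr => i _; rewrite dN mulrN. Qed.
Let caps f k g : cap f (s k * g) = s k * cap f g.
Proof. by rewrite /cap mulr_sumr; apply: eq_bigr => i _; rewrite dMs; ring. Qed.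
Let capx f k : cap f (x k) = ccomp f k.
Proof.
rewrite /cap (bigD1 k) //= dx eqxx mulr1 big1 ?addr0 // => i /negPf ik.
by rewrite dx ik mulr0.
Qed.
Let cap_sum f (P : pred I) G : cap f (\sum_(k | P k) G k) = \sum_(k | P k) cap f (G k).
Proof. by apply: (big_morph _ (capD f) (cap0 f)). Qed.

Lemma hcomp_cbr f g j : h j ->
  cap f (hcomp g j) - cap g (hcomp f j) = hcomp (cbr f g) j.
Proof. by move=> hj; rewrite !hcompE // !caps Y_cbr ?hpr // mulrBr. Qed.

(** The last component is [2 f] minus a combination of horizontal ones. The field of [f] sends [x k]
    to its own component [k]; the terms this produces sum to [hbr], and the others fall under the
    horizontal case. *)
Lemma ccomp_cbr f g j :
  cap f (ccomp g j) - cap g (ccomp f j) = ccomp (cbr f g) j.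
Proof.
rewrite /ccomp; case: ifP => hj; first exact: hcomp_cbr.
have two F z : cap F (2 * z) = 2 * cap F z by rewrite -[2]/(1 + 1) !mulrDl !mul1r capD.
rewrite !capD !capN !two !cap_sum.
have E F G : \sum_(k | h k) cap F (s k * (x k * hcomp G (pr k)))
    = hbr F G + \sum_(k | h k) s k * (x k * cap F (hcomp G (pr k))).
  rewrite /hbr -big_split; apply: eq_bigr => k hk /=.
  rewrite caps capM capx /ccomp hk !hcompE ?hpr // prK // mulrDr; congr (_ + _).
  by rewrite spr //; ring: (ss k).
rewrite !E [hbr g f]hbrC.
under [X in _ = _ - X]eq_bigr => k hk do rewrite -hcomp_cbr ?hpr // mulrBr mulrBr.
rewrite sumrB /cbr !capE [hbr g f]hbrC; ring.
Qed.

(** A function of [t] alone has [Y j f = s j * (x (pr j) * T f)], so [hbr] becomes [T f] times the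
    horizontal Euler operator. The leftover quadratic form in [x] vanishes because [s] changes sign
    under [pr]. *)
Lemma cbr_flat f g : (forall z : R, 2 * z = 0 -> z = 0) ->
  (forall j, h j -> d j f = 0) ->
  cbr f g = 2 * (f * T g) + T f * (\sum_(j | h j) x j * d j g) - 2 * (g * T f).
Proof.
move=> two0 df; rewrite /cbr capE; congr (_ + _ - _).
have S0 : \sum_(j | h j) s j * (x j * x (pr j)) = 0.
  apply: two0; rewrite -[2]/(1 + 1) mulrDl !mul1r {1}sum_pr -big_split big1 // => j hj /=.
  by rewrite prK // spr //; ring.
have -> : hbr f g = \sum_(j | h j) (T f * (x j * d j g) + T f * T g * (s j * (x j * x (pr j)))).
  apply: eq_bigr => j hj; rewrite /Y df ?hpr // prK // spr //; ring: (ss j).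
by rewrite big_split /= -!mulr_sumr S0 mulr0 addr0.
Qed.

Lemma cbr_var j g : h j -> cbr (x j) g = x j * T g + s j * d (pr j) g.
Proof.
move=> hj; rewrite /cbr capE Tx // /hbr (bigD1 (pr j)) ?hpr //= big1 => [|k /andP[hk ne]].
  by rewrite /Y prK // !Tx // dx eqxx mulr1n spr //; ring: (ss j).
rewrite /Y dx Tx //; case: eqP => [e|_]; last by rewrite mulr0n; ring.
by case/negP: ne; rewrite -e prK.
Qed.

(** * Integration by parts for the contact bracket *)

Section Integral.
Variables (F : fieldType) (J : R -> F).
Hypothesis JD : forall f g, J (f + g) = J f + J g.
Hypothesis Jd : forall i f, J (d i f) = 0.
Hypothesis two0 : 2 != 0 :> F.

Let J0 : J 0 = 0.
Proof. by apply: (addIr (J 0)); rewrite -JD !add0r. Qed.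
Let JN f : J (- f) = - J f.
Proof. by apply: (addIr (J f)); rewrite -JD !addNr J0. Qed.
Let J_sum (P : pred I) G : J (\sum_(k | P k) G k) = \sum_(k | P k) J (G k).
Proof. by apply: (big_morph _ JD J0). Qed.
Let J2 f : J (2 * f) = 2 * J f.
Proof. by rewrite -[2 in LHS]/(1 + 1) mulrDl mul1r JD -mulr2n mulr_natl. Qed.

Let JY j f : h j -> J (Y j f) = 0.
Proof.
move=> hj; rewrite /Y JD Jd add0r; have -> : s j * (x (pr j) * T f) = T (s j * (x (pr j) * f)).
  by rewrite dMs dM Tx ?hpr // mul0r add0r.
exact: Jd.
Qed.

(** Integrating [hbr f g] by parts gives [- S], with both [Y] on [g]; exchanging [j] and [pr j], the
    Heisenberg relation gives [2 S = - 2 #|h| J (f * T g)]. The terms [2 f T g] and [- 2 g T f]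
    contribute 2 each, whence the 4. *)
Lemma J_cbr f g : J (cbr f g) = (#|h| + 4)%:R * J (f * T g).
Proof.
have Tfg : J (g * T f) = - J (f * T g).
  apply/eqP; rewrite -subr_eq0 opprK -JD; apply/eqP; rewrite -[RHS](Jd t (g * f)) dM; congr J; ring.
pose S := \sum_(j | h j) J (s (pr j) * (f * Y (pr j) (Y j g))).
have hS : J (hbr f g) = - S.
  rewrite /hbr J_sum -sumrN; apply: eq_bigr => j hj; apply/eqP.
  rewrite -subr_eq0 opprK -JD; apply/eqP; rewrite -[RHS](JY (s (pr j) * (f * Y j g)) (hpr hj)).
  by congr J; rewrite Ys YM; ring.
have S2 : S = - S - \sum_(j | h j) 2 * J (f * T g).
  rewrite {1}/S sum_pr -sumrN -sumrB; apply: eq_bigr => j hj.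
  rewrite -J2 -JN -JN -JD; congr J; rewrite prK // (Y_comm g hj (hpr hj)) eqxx spr //.
  by ring: (ss j).
have {}S2 : S = - (#|h|%:R * J (f * T g)).
  apply: (mulfI two0); rewrite mulrDl mul1r {1}S2 sumr_const -mulr_natl; ring.
rewrite /cbr capE !JD JN !J2 hS S2 Tfg; ring.
Qed.
End Integral.

End ContactBracket.

(** * The truncated polynomial algebra as a commutative ring *)

Section TruncatedAlgebra.
Variables (F : fieldType) (p' n : nat).
Local Notation p := p'.+1.
Local Notation Mon := (Mon p n).
Local Notation Apoly := (Apoly F p n).

Definition mk_mon (v : 'I_n -> nat) : Mon := [ffun k => inord (v k)].

Lemma sum_mon (V : zmodType) (G : Mon -> V) (v : 'I_n -> nat) :
  \sum_(a : Mon | [forall k, (a k : nat) == v k]) G a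
    = if [forall k, (v k < p)%N] then G (mk_mon v) else 0.
Proof.
case: ifP => [/forallP hv|/negbT].
  rewrite (bigD1 (mk_mon v)) /=; last by apply/forallP=> k; rewrite ffunE inordK.
  rewrite big1 ?addr0 // => a /andP[/forallP ha /negP[]]; apply/eqP/ffunP=> k.
  by apply: val_inj; rewrite ffunE /= inordK // (eqP (ha k)).
rewrite negb_forall => /existsP[k hk]; rewrite big1 // => a /forallP/(_ k)/eqP e.
by move: hk; rewrite -e ltn_ord.
Qed.

Local Notation adds a b g := ([forall k, (a k + b k)%N == (g k : nat)]).

Lemma mulAE (f g : Apoly) (c : Mon) :
  Defs.mulA f g c = \sum_(a : Mon) \sum_(b : Mon) if adds a b c then f a * g b else 0.
Proof. by rewrite ffunE; apply: eq_bigr => a _; rewrite big_mkcond. Qed.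

Lemma mulAC : commutative (@Defs.mulA F p n).
Proof.
move=> f g; apply/ffunP=> c; rewrite !mulAE exchange_big; apply: eq_bigr => a _.
apply: eq_bigr => b _; rewrite mulrC; congr (if _ then _ else _).
by apply: eq_forallb => k; rewrite addnC.
Qed.

Lemma mulA_assoc_aux (f g h : Apoly) (e : Mon) :
  Defs.mulA f (Defs.mulA g h) e = \sum_(a : Mon) \sum_(b : Mon) \sum_(c : Mon)
    if [forall k, (a k + (b k + c k))%N == (e k : nat)] then f a * (g b * h c) else 0.
Proof.
rewrite mulAE; apply: eq_bigr => a _.
under eq_bigr => d _ do rewrite mulAE.
transitivity (\sum_(b : Mon) \sum_(c : Mon) \sum_(d : Mon | [forall k, (d k : nat) == (b k + c k)%N])
    if adds a d e then f a * (g b * h c) else 0).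
  transitivity (\sum_(d : Mon) \sum_(b : Mon) \sum_(c : Mon) if adds b c d then
      if adds a d e then f a * (g b * h c) else 0 else 0).
    apply: eq_bigr => d _; case: ifP => _; last first.
      by rewrite !big1 // => b _; rewrite big1 // => c _; case: ifP.
    rewrite mulr_sumr; apply: eq_bigr => b _; rewrite mulr_sumr; apply: eq_bigr => c _.
    by case: ifP; rewrite ?mulr0.
  rewrite exchange_big; apply: eq_bigr => b _; rewrite exchange_big; apply: eq_bigr => c _ /=.
  rewrite -big_mkcond; apply: eq_bigl => d; apply: eq_forallb => k; by rewrite eq_sym.
apply: eq_bigr => b _; apply: eq_bigr => c _; rewrite sum_mon.
case: (boolP [forall k, (a k + (b k + c k))%N == (e k : nat)]) => [/forallP h0|/negP h0].
  have h1 k : (b k + c k < p)%N by have := h0 k; have := ltn_ord (e k); lia.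
  rewrite (introT forallP h1) ifT //; apply/forallP=> k; rewrite ffunE inordK //; exact: h0.
case: ifP => // /forallP h1; rewrite ifF //; apply/negP=> /forallP h2; apply: h0.
by apply/forallP=> k; have := h2 k; rewrite ffunE inordK.
Qed.

Lemma mulA_assoc : associative (@Defs.mulA F p n).
Proof.
move=> f g h; apply/ffunP=> e; rewrite [RHS](congr1 (fun z : Apoly => z e) (mulAC _ _)).
rewrite !mulA_assoc_aux [RHS]exchange_big; apply: eq_bigr => a _.
rewrite [RHS]exchange_big; apply: eq_bigr => b _; apply: eq_bigr => c _.
rewrite mulrA mulrC; congr (if _ then _ else _); apply: eq_forallb => k.
by congr (_ == _); lia.
Qed.

Definition oneA : Apoly := [ffun a : Mon => [forall k, (a k : nat) == 0%N]%:R].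

Lemma mul1A : left_id oneA (@Defs.mulA F p n).
Proof.
move=> g; apply/ffunP=> c; rewrite mulAE.
transitivity (\sum_(a : Mon | [forall k, (a k : nat) == 0%N]) \sum_(b : Mon)
    if adds a b c then g b else 0).
  rewrite [RHS]big_mkcond; apply: eq_bigr => a _; rewrite ffunE; case: ifP => ha.
    by apply: eq_bigr => b _; rewrite mul1r.
  by rewrite big1 // => b _; rewrite mul0r; case: ifP.
rewrite (sum_mon _ (fun=> 0%N)) ifT; last by apply/forallP.
rewrite -big_mkcond (big_pred1 c) // => b; apply/forallP/eqP=> [h|-> k]; last first.
  by rewrite ffunE inordK.
by apply/ffunP=> k; apply: val_inj; have := h k; rewrite ffunE inordK // add0n => /eqP.
Qed.

Lemma mulADl : left_distributive (@Defs.mulA F p n) +%R.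
Proof.
move=> f g h; apply/ffunP=> c; rewrite [RHS]ffunE !mulAE -big_split; apply: eq_bigr => a _ /=.
rewrite -big_split; apply: eq_bigr => b _ /=; rewrite ffunE mulrDl.
by case: ifP; rewrite ?addr0.
Qed.

(** A separate name, because finite functions come with the pointwise product; only their additive
    structure is taken over. *)
Definition tpoly := Apoly.
HB.instance Definition _ := GRing.Zmodule.on tpoly.
HB.instance Definition _ :=
  GRing.Zmodule_isComPzRing.Build tpoly mulA_assoc mulAC mul1A mulADl.

Lemma tpolyM (f g : tpoly) : f * g = Defs.mulA f g. Proof. by []. Qed.

Hypothesis charF : p \in [pchar F].
Let natp0 : p%:R = 0 :> F := pcharf0 charF.

Definition up_mon (a : Mon) i : Mon := mk_mon (fun k => a k + (k == i))%N.

Lemma dAE i (f : Apoly) (a : Mon) :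
  dA i f a = if (a i < p')%N then (a i).+1%:R * f (up_mon a i) else 0.
Proof.
rewrite ffunE (sum_mon (fun b : Mon => (b i)%:R * f b)).
have -> : [forall k, (a k + (k == i) < p)%N] = (a i < p')%N.
  apply/forallP/idP=> [/(_ i)|hi k]; first by rewrite eqxx addn1.
  by case: eqP => [->|_]; rewrite ?addn1 ?addn0 // ltn_ord.
by case: ifP => // hi; rewrite ffunE eqxx addn1 inordK.
Qed.

Lemma dAD i (f g : tpoly) : dA i (f + g) = dA i f + dA i g :> tpoly.
Proof.
apply/ffunP=> a; rewrite [RHS]ffunE !ffunE -big_split; apply: eq_bigr => b _ /=.
by rewrite ffunE mulrDr.
Qed.

Lemma dAM_aux i (f g : Apoly) (c : Mon) : Defs.mulA (dA i f) g c =
  \sum_(a : Mon) \sum_(b : Mon) if [forall k, (a k + b k == c k + (k == i))%N] then (a i)%:R * (f a * g b) else 0.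
Proof.
rewrite mulAE.
transitivity (\sum_(a : Mon) \sum_(b : Mon) \sum_(a' : Mon) if adds a' b c then
   if [forall k, (a k : nat) == (a' k + (k == i))%N] then (a i)%:R * (f a * g b) else 0 else 0).
  rewrite [RHS]exchange_big [LHS]exchange_big; apply: eq_bigr => b _ /=.
  rewrite [RHS]exchange_big; apply: eq_bigr => a' _ /=.
  case: ifP => _; last by rewrite big1.
  rewrite ffunE mulr_suml big_mkcond; apply: eq_bigr => a _.
  by case: ifP => // _; rewrite mulrA.
apply: eq_bigr => a _; apply: eq_bigr => b _.
have [a0|a0] := posnP (a i).
  rewrite a0 mul0r [RHS]if_same big1 // => a' _; by rewrite !if_same.
transitivity (\sum_(a' : Mon | [forall k, (a' k : nat) == (a k - (k == i))%N])
    if adds a' b c then (a i)%:R * (f a * g b) else 0).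
  rewrite [RHS]big_mkcond; apply: eq_bigr => a' _.
  have -> : [forall k, (a' k : nat) == (a k - (k == i))%N]
          = [forall k, (a k : nat) == (a' k + (k == i))%N].
    apply: eq_forallb => k; case: (eqVneq k i) => [->|_] /=; [rewrite addn1|rewrite addn0 subn0 eq_sym //].
    by rewrite subn1 -(eqn_add2r 1) !addn1 (prednK a0) eq_sym.
  by case: ifP; case: ifP.
rewrite sum_mon ifT; last by apply/forallP=> k; have := ltn_ord (a k); lia.
congr (if _ then _ else _); apply: eq_forallb => k; rewrite ffunE inordK; last first.
  by have := ltn_ord (a k); lia.
case: (eqVneq k i) => [->|_] /=; last by rewrite subn0 addn0.
by rewrite subn1 addn1 -eqSS -addSn (prednK a0).
Qed.

(** Pairs with [a + b = c + e_i] carry the weight [a i + b i = c i + 1]. For [c i = p - 1] this is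
    [p = 0], in agreement with [x^c] having coefficient 0 in every derivative along [i]. *)
Lemma dAM i (f g : tpoly) : dA i (f * g) = (dA i f : tpoly) * g + f * dA i g.
Proof.
rewrite [X in _ = _ + X]mulrC; apply/ffunP=> c; rewrite [RHS]ffunE !tpolyM !dAM_aux.
rewrite [X in _ = _ + X]exchange_big -big_split /=.
under [RHS]eq_bigr => a _ do rewrite -big_split /=.
rewrite dAE; case: ifP => hi.
  rewrite mulAE mulr_sumr; apply: eq_bigr => a _; rewrite mulr_sumr; apply: eq_bigr => b _.
  have -> : adds a b (up_mon c i) = [forall k, (a k + b k == c k + (k == i))%N].
    apply: eq_forallb => k; rewrite ffunE inordK //.
    by case: eqP => [->|_]; rewrite ?addn1 ?addn0.
  have -> : [forall k, (b k + a k == c k + (k == i))%N] = [forall k, (a k + b k == c k + (k == i))%N].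
    by apply: eq_forallb => k; rewrite addnC.
  case: forallP => [/(_ i)|]; rewrite ?mulr0 ?addr0 // eqxx addn1 => /eqP <-.
  by rewrite natrD; ring.
rewrite big1 // => a _; rewrite big1 // => b _.
have -> : [forall k, (b k + a k == c k + (k == i))%N] = [forall k, (a k + b k == c k + (k == i))%N].
  by apply: eq_forallb => k; rewrite addnC.
case: forallP => [/(_ i)|]; rewrite ?addr0 // eqxx addn1 => /eqP e.
rewrite [g b * f a]mulrC -mulrDl -natrD e.
have -> : (c i).+1 = p by apply/eqP; rewrite eqn_leq ltn_ord ltnS leqNgt hi.
by rewrite natp0 mul0r.
Qed.

Lemma dA_comm i j (f : tpoly) : dA i (dA j f) = dA j (dA i f).
Proof.
have [-> //|ne] := eqVneq i j; apply/ffunP=> a.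
have upE k l b : k != l -> (up_mon b k) l = b l.
  by move=> kl; apply: val_inj; rewrite ffunE /= eq_sym (negPf kl) addn0 inordK.
have ne' : j != i by rewrite eq_sym.
rewrite !dAE !upE //.
case: ifP => hi; case: ifP => hj //; rewrite ?mulr0 //.
rewrite mulrCA; congr (_ * (_ * f _)); apply/ffunP=> k; apply: val_inj; rewrite !ffunE /=.
have ltk := ltn_ord (a k); case: (eqVneq k i) hi => [->|ki] hi.
  by rewrite (negPf ne) !addn0 !addn1 !inordK //; lia.
by case: (eqVneq k j) hj => [->|kj] hj; rewrite ?addn0 ?addn1 !inordK //; lia.
Qed.

(** Exponents are arbitrary natural numbers and give 0 when out of range, so they can be shifted
    without case distinctions. *)
Definition xm (v : 'I_n -> nat) : tpoly := [ffun a : Mon => [forall k, (a k : nat) == v k]%:R].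

Lemma eq_xm v w : v =1 w -> xm v = xm w.
Proof. by move=> e; apply/ffunP=> a; rewrite !ffunE; congr (nat_of_bool _)%:R; apply: eq_forallb => k; rewrite e. Qed.

Lemma xm0 : xm (fun=> 0%N) = 1. Proof. by []. Qed.

Lemma xm_oob v k : (p <= v k)%N -> xm v = 0.
Proof.
move=> hk; apply/ffunP=> a; rewrite !ffunE; case: forallP => // /(_ k) /eqP e.
by have := ltn_ord (a k); rewrite e; lia.
Qed.

Lemma xmM v w : xm v * xm w = xm (fun k => v k + w k)%N.
Proof.
apply/ffunP=> c; rewrite tpolyM mulAE ffunE.
transitivity (\sum_(a : Mon | [forall k, (a k : nat) == v k])
   \sum_(b : Mon | [forall k, (b k : nat) == w k]) (adds a b c)%:R : F).
  rewrite [RHS]big_mkcond; apply: eq_bigr => a _; rewrite ffunE; case: ifP => _; last first.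
    by rewrite big1 // => b _; rewrite mul0r if_same.
  rewrite [RHS]big_mkcond; apply: eq_bigr => b _; rewrite ffunE mul1r.
  by case: ifP; case: ifP.
rewrite sum_mon sum_mon.
case: (boolP [forall k, (c k : nat) == (v k + w k)%N]) => [/forallP h|/negP h].
  have hv k : (v k < p)%N by have := h k; have := ltn_ord (c k); lia.
  have hw k : (w k < p)%N by have := h k; have := ltn_ord (c k); lia.
  rewrite (introT forallP hv) (introT forallP hw); case: forallP => // h'; case: h' => k.
  by rewrite !ffunE !inordK // eq_sym; exact: h.
case: forallP => // hv; case: forallP => // hw; case: forallP => // h'; case: h.
by apply/forallP=> k; have := h' k; rewrite !ffunE !inordK // eq_sym.
Qed.

(** For [v i = 0] the truncated subtraction has coefficient 0; for [v i = p] the left side is 0 and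
    so is the coefficient. *)
Lemma dA_xm i v : dA i (xm v) = (v i)%:R * xm (fun k => v k - (k == i))%N.
Proof.
apply/ffunP=> a; rewrite dAE ffunE.
have -> : ((v i)%:R * xm (fun k => v k - (k == i))%N : tpoly) a
   = (v i)%:R * [forall k, (a k : nat) == (v k - (k == i))%N]%:R.
  by rewrite mulr_natl ffunMnE ffunE mulr_natl.
have [vi0|vi0] := posnP (v i).
  rewrite vi0 mul0r; case: ifP => // hi; case: forallP => [/(_ i)|]; rewrite ?mulr0 //.
  by rewrite ffunE vi0 eqxx addn1 inordK.
case: (boolP [forall k, (a k : nat) == (v k - (k == i))%N]) => [/forallP h|/forallP h].
  rewrite mulr1; have hi := eqP (h i); rewrite eqxx subn1 in hi.
  case: ifP => ha; last first.
    have -> : v i = p.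
      by move/negbT: ha; have := ltn_ord (a i); rewrite hi; move: vi0; clear; lia.
    by rewrite natp0.
  rewrite (introT forallP _) ?mulr1 => [|k]; first by rewrite hi (prednK vi0).
  have := eqP (h k); rewrite ffunE; case: (eqVneq k i) => [->|ki] /=.
    by rewrite addn1 inordK // => e; apply/eqP; lia.
  by rewrite subn0 addn0 inordK // => ->.
rewrite mulr0; case: ifP => // ha; case: forallP => h'; rewrite ?mulr0 //; case: h => k.
have := eqP (h' k); rewrite ffunE; case: (eqVneq k i) => [->|ki] /=.
  by rewrite addn1 inordK // => <-; rewrite subn1.
by rewrite subn0 addn0 inordK // => ->.
Qed.

End TruncatedAlgebra.

(** * The contact algebra *)

Section ContactAlgebra.
Variables (F : fieldType) (p' r : nat).
Local Notation p := p'.+1.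
Local Notation n := (2 * r).+1.
Local Notation Rn := (tpoly F p' n).
Hypothesis charF : p \in [pchar F].
Hypothesis p_gt2 : (2 < p)%N.

Let natp0 : p%:R = 0 :> F := pcharf0 charF.
Let two0 : 2 != 0 :> F.
Proof. by rewrite (natF_neq0 charF). Qed.

Let h : pred 'I_n := fun j => (j < 2 * r)%N.
Let t : 'I_n := tK r.
Local Notation pr := (@primeK r).
Let sg (j : 'I_n) : Rn := if (j < r)%N then 1 else -1.
Let x (j : 'I_n) : Rn := xvar F p j.
Let d (j : 'I_n) (f : Rn) : Rn := dA j f.

Lemma horizE j : h j = (j != t).
Proof. by rewrite /h -val_eqE /=; have := ltn_ord j; lia. Qed.

Lemma primeK_val j : h j -> pr j = (if (j < r)%N then j + r else j - r)%N :> nat.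
Proof. by rewrite /h => hj; rewrite inordK //; case: ifP; lia. Qed.

Lemma horiz_prime j : h j -> h (pr j).
Proof. by move=> hj; move: (hj); rewrite /h primeK_val //; case: ifP; lia. Qed.

Lemma primeKK j : h j -> pr (pr j) = j.
Proof.
move=> hj; apply: val_inj; rewrite /= (primeK_val (horiz_prime hj)) (primeK_val hj).
move: hj; rewrite /h; case: (ltnP j r) => h1 hj.
  by rewrite ifF ?addnK //; apply/negbTE; lia.
by rewrite ifT ?subnK //; lia.
Qed.

Lemma primeK_neq j : h j -> pr j != j.
Proof. by move=> hj; rewrite -val_eqE /= primeK_val //; move: hj; rewrite /h; case: ifP; lia. Qed.

Lemma sg_prime j : h j -> sg (pr j) = - sg j.
Proof.
move=> hj; rewrite /sg (primeK_val hj); move: hj; rewrite /h; case: (ltnP j r) => h1 hj.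
  by rewrite ifF //; apply/negbTE; lia.
by rewrite ifT ?opprK //; lia.
Qed.

Lemma sg_sq j : sg j * sg j = 1.
Proof. by rewrite /sg; case: ifP => _; rewrite ?mulrNN mulr1. Qed.

Lemma xvarE j : x j = xm F p' (fun k => (k == j) : nat).
Proof.
apply/ffunP=> a; rewrite !ffunE; have -> : forall b : bool, (if b then 1 else 0) = b%:R :> F by case.
by congr (nat_of_bool _)%:R; apply: eq_forallb => k; case: eqP.
Qed.

Lemma xpowE j e : xpow F p j e = xm F p' (fun k : 'I_n => if k == j then e else 0%N) :> Rn.
Proof. by apply/ffunP=> a; rewrite !ffunE; case: ifP. Qed.

Lemma d_var i j : d i (x j) = (i == j)%:R.
Proof.
rewrite xvarE /d dA_xm //; case: eqP => [->|_] /=; last by rewrite mul0r.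
rewrite mul1r -(xm0 F p' n); apply: eq_xm => k; by rewrite subnn.
Qed.

Let dD i f g : d i (f + g) = d i f + d i g. Proof. exact: dAD. Qed.
Let dM i f g : d i (f * g) = d i f * g + f * d i g. Proof. exact: dAM. Qed.
Let dC i j f : d i (d j f) = d j (d i f). Proof. exact: dA_comm. Qed.
Let d1 i : d i 1 = 0.
Proof. by rewrite -xm0 /d dA_xm // mul0r. Qed.
Let d_sg i j : d i (sg j) = 0.
Proof.
rewrite /sg; case: ifP => _; first exact: d1.
have d0 : d i 0 = 0 by rewrite -[0 in LHS](mulr0 0) dM mulr0 mul0r addr0.
by apply: (addIr (d i 1)); rewrite -dD addNr d1 addr0 d0.
Qed.

Local Notation compK := (ccomp h t pr sg x d).
Local Notation capK := (cap h t pr sg x d).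
Local Notation brK := (cbr h t pr sg x d).

Lemma scaleA_natE m (f : Rn) : scaleA m%:R f = m%:R * f :> Rn.
Proof. by apply/ffunP=> a; rewrite !mulr_natl ffunMnE ffunE mulr_natl. Qed.

Lemma two_reg (z : Rn) : 2 * z = 0 -> z = 0.
Proof.
rewrite -scaleA_natE => /ffunP hz; apply/ffunP=> a; have := hz a; rewrite !ffunE => /eqP.
by rewrite mulf_eq0 (negPf two0) => /eqP.
Qed.

Lemma scaleA_sigma j (f : Rn) : scaleA (sigmaK F j) f = sg j * f :> Rn.
Proof.
by rewrite /sigmaK /sg; case: ifP => _; apply/ffunP=> a; rewrite ?mul1r ?mulN1r !ffunE ?mul1r ?mulN1r.
Qed.

Lemma DKE (f : Rn) j : DK f j = compK f j.
Proof.
rewrite /DK ffunE /ccomp -/(h j); case: ifP => hj.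
  by rewrite /DKcomp scaleA_sigma.
rewrite (scaleA_natE 2); congr (_ - _); apply: eq_bigr => k hk.
by rewrite scaleA_sigma /DKcomp scaleA_sigma.
Qed.

Lemma applyWE (D : Wder F p n) (g : Rn) : applyW D g = \sum_i (D i : Rn) * d i g.
Proof. by []. Qed.

Lemma brWE (D E : Wder F p n) j : brW D E j = applyW D (E j) - applyW E (D j).
Proof. by rewrite ffunE. Qed.

Lemma brW_DK (f g : Rn) : brW (DK f) (DK g) = DK (brK f g).
Proof.
apply/ffunP=> j; rewrite brWE [RHS]DKE.
rewrite -(ccomp_cbr horizE horiz_prime primeKK primeK_neq sg_prime sg_sq dD dM dC d_var d_sg).
have ap (u : Rn) (v : Rn) : applyW (DK u) v = capK u v.
  by rewrite applyWE; apply: eq_bigr => i _; rewrite DKE.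
by rewrite !ap !DKE.
Qed.

(** Scalars become ring elements, so that linearity reduces to ring identities. *)
Definition cst (c : F) : Rn := scaleA c (1 : Rn).

Lemma scaleAE c (f : Rn) : scaleA c f = cst c * f :> Rn.
Proof.
have sM (u v : Rn) : (scaleA c u : Rn) * v = scaleA c (u * v) :> Rn.
  apply/ffunP=> a; rewrite !tpolyM [RHS]ffunE !mulAE mulr_sumr; apply: eq_bigr => b _.
  rewrite mulr_sumr; apply: eq_bigr => e _; rewrite ffunE.
  by case: ifP; rewrite ?mulr0 ?mulrA.
by rewrite /cst sM mul1r.
Qed.

Let d_cst i c : d i (cst c) = 0.
Proof.
apply/ffunP=> a; rewrite /d dAE; case: ifP => ha; rewrite !ffunE //.
by case: forallP => [/(_ i)|_]; rewrite ?mulr0 // ffunE eqxx addn1 inordK.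
Qed.

Lemma compK_lin c (f g : Rn) j : compK (cst c * f + g) j = cst c * compK f j + compK g j.
Proof.
have hl k : hcomp t pr sg x d (cst c * f + g) k
    = cst c * hcomp t pr sg x d f k + hcomp t pr sg x d g k.
  by rewrite /hcomp !dD !dM !d_cst; ring.
rewrite /ccomp; case: ifP => _; first exact: hl.
have -> : \sum_(k | h k) sg k * (x k * hcomp t pr sg x d (cst c * f + g) (pr k))
   = cst c * (\sum_(k | h k) sg k * (x k * hcomp t pr sg x d f (pr k)))
     + \sum_(k | h k) sg k * (x k * hcomp t pr sg x d g (pr k)).
  by rewrite mulr_sumr -big_split; apply: eq_bigr => k _ /=; rewrite hl; ring.
by ring.
Qed.

Lemma compKZ c (f : Rn) j : compK (cst c * f) j = cst c * compK f j.
Proof.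
have c1 : cst 1 = 1 by apply/ffunP=> a; rewrite !ffunE mul1r.
have k0 : compK 0 j = 0.
  have := compK_lin 1 0 0 j; rewrite c1 mulr0 addr0 mul1r => e.
  by apply: (addIr (compK 0 j)); rewrite -e add0r.
by have := compK_lin c f 0 j; rewrite k0 !addr0.
Qed.

Definition gvec (f : Rn) : 'rV[F]_(NK p r) := vecW (DK f).

Lemma vecW_lin c (D E H : Wder F p n) : (forall j, H j = (cst c * (D j : Rn) + E j : Rn)) ->
  vecW H = c *: vecW D + vecW E.
Proof.
move=> hH; rewrite /vecW -linearP; congr mxvec; apply/matrixP=> i k; rewrite !mxE hH.
by rewrite -scaleAE !ffunE.
Qed.

Lemma gvec_lin c (f g : Rn) : gvec (cst c * f + g) = c *: gvec f + gvec g.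
Proof. by apply: vecW_lin => j; rewrite !DKE compK_lin. Qed.

Lemma gvecZ c f : gvec (cst c * f) = c *: gvec f.
Proof.
have g0 : gvec 0 = 0.
  have := gvec_lin 1 0 0; rewrite mulr0 addr0 scale1r => e.
  by apply: (addIr (gvec 0)); rewrite -e add0r.
by have := gvec_lin c f 0; rewrite g0 !addr0.
Qed.

Lemma gvec0 : gvec 0 = 0.
Proof. by have := gvecZ 0 0; rewrite mulr0 scale0r. Qed.

Lemma gvecD f g : gvec (f + g) = gvec f + gvec g.
Proof.
have c1 : cst 1 = 1 by apply/ffunP=> a; rewrite !ffunE mul1r.
by have := gvec_lin 1 f g; rewrite c1 mul1r scale1r.
Qed.

Lemma gvec_nat m f : gvec (m%:R * f) = m%:R *: gvec f.
Proof. by rewrite -scaleA_natE scaleAE gvecZ. Qed.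

Lemma gvec_sum (f : Rn) : gvec f = \sum_(a : Mon p n) f a *: gvec (xmon F a).
Proof.
have -> : \sum_(a : Mon p n) f a *: gvec (xmon F a)
    = gvec (\sum_(a : Mon p n) cst (f a) * (xmon F a : Rn)).
  rewrite (big_morph gvec gvecD gvec0); apply: eq_bigr => a _; by rewrite gvecZ.
congr gvec; apply/ffunP=> b; rewrite sum_ffunE (bigD1 b) //= big1 => [|a ne].
  by rewrite -scaleAE !ffunE eqxx mulr1 addr0.
by rewrite -scaleAE !ffunE eq_sym (negPf ne) mulr0.
Qed.

Lemma vecWK : cancel (@vecW F p r) (@unvecW F p r).
Proof.
by move=> D; apply/ffunP=> i; apply/ffunP=> a; rewrite !ffunE /vecW mxvecK mxE enum_rankK.
Qed.

(** Once the horizontal components vanish, the component at [t] is [2 f]. *)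
Lemma gvec_inj f : gvec f = 0 -> f = 0.
Proof.
move=> /(congr1 (@unvecW F p r)); rewrite vecWK => e.
have {}e j : compK f j = 0.
  by rewrite -DKE e; apply/ffunP=> a; rewrite !ffunE linear0 mxE.
have hc j : h j -> hcomp t pr sg x d f j = 0 by move=> hj; have := e j; rewrite /ccomp hj.
have := e t; rewrite /ccomp horizE eqxx /= big1 ?subr0; first exact: two_reg.
by move=> k hk; rewrite hc ?horiz_prime // !mulr0.
Qed.

Definition Gmx : 'M[F]_(#|{: Mon p n}|, NK p r) := \matrix_k gvec (xmon F (enum_val k)).

Lemma Gmx_free : row_free Gmx.
Proof.
apply: inj_row_free => v vG; pose f : Rn := [ffun a => v 0 (enum_rank a)].
have : gvec f = 0.
  rewrite gvec_sum -[RHS]vG mulmx_sum_row [RHS](reindex enum_rank) /=; last first.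
    by apply: onW_bij; apply: enum_rank_bij.
  by apply: eq_bigr => a _; rewrite rowK enum_rankK ffunE.
move/gvec_inj=> f0; apply/rowP=> k; rewrite mxE.
by have /ffunP/(_ (enum_val k)) := f0; rewrite !ffunE enum_valK.
Qed.

Lemma gvec_pinv a : gvec (xmon F a) *m pinvmx Gmx = delta_mx 0 (enum_rank a).
Proof.
have -> : gvec (xmon F a) = delta_mx 0 (enum_rank a) *m Gmx by rewrite -rowE rowK enum_rankK.
by rewrite -mulmxA mulmxVp ?Gmx_free // mulmx1.
Qed.

(** [lin1_mx] records only the images of basis vectors, so linearity of the bracket map has to be
    established before it is evaluated on [gvec g]. *)
Lemma actKE i (g : Rn) :
  gvec g *m actK F r i = 2^-1 *: gvec (brK (xpow F p t i) g).
Proof.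
pose f (v : 'rV[F]_(NK p r)) := vecW (brW (ThetaK F r i) (unvecW v)).
have flin c u v : f (c *: u + v) = c *: f u + f v.
  apply: vecW_lin => j; rewrite !brWE.
  have uv k : unvecW (c *: u + v) k = cst c * (unvecW u k : Rn) + unvecW v k :> Rn.
    by apply/ffunP=> a; rewrite -scaleAE !ffunE linearP !mxE.
  rewrite !applyWE !uv mulrBr addrACA -opprD !mulr_sumr -!big_split /=; congr (_ - _); apply: eq_bigr => k _.
    by rewrite dD dM d_cst mul0r add0r mulrDr mulrCA.
  by rewrite uv mulrDl mulrA.
have -> : gvec g *m actK F r i = f (gvec g).
  have f0 : f 0 = 0.
    have := flin 1 0 0; rewrite scaler0 addr0 scale1r => e.
    by apply: (addIr (f 0)); rewrite -e add0r.
  rewrite /actK -/f [in RHS](matrix_sum_delta (gvec g)) big_ord1 mulmx_sum_row.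
  have fS (s : seq 'I_(NK p r)) (G : 'I_(NK p r) -> 'rV_(NK p r)) (c : 'I_(NK p r) -> F) :
     f (\sum_(k <- s) c k *: G k) = \sum_(k <- s) c k *: f (G k).
    by elim: s => [|k s IH]; rewrite ?big_nil ?f0 // !big_cons flin IH.
  rewrite fS; apply: eq_bigr => k _; congr (_ *: _).
  by apply/rowP=> l; rewrite !mxE.
rewrite /f vecWK -gvecZ /gvec; congr vecW; apply/ffunP=> j.
rewrite [RHS]DKE compKZ -DKE -brW_DK !brWE.
have Th k : ThetaK F r i k = cst 2^-1 * (DK (xpow F p t i) k : Rn) :> Rn.
  by rewrite ffunE scaleAE.
rewrite !applyWE mulrBr !mulr_sumr; congr (_ - _); apply: eq_bigr => k _; rewrite Th.
  by rewrite mulrA.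
by rewrite dM d_cst mul0r add0r mulrCA.
Qed.

Lemma monE (a : Mon p n) : xmon F a = xm F p' (fun k => a k).
Proof.
apply/ffunP=> c; rewrite !ffunE; congr (nat_of_bool _)%:R; apply/eqP/forallP=> [-> //|h0].
by apply/ffunP=> k; apply: val_inj; exact/eqP/h0.
Qed.

Lemma xm_mon v : (forall k, (v k < p)%N) -> xm F p' v = xmon F (mk_mon p' v) :> Rn.
Proof. by move=> hv; rewrite monE; apply: eq_xm => k; rewrite ffunE inordK. Qed.

Lemma brK_tpow (i : nat) (v w : 'I_n -> nat) :
  (forall k, w k = if k == t then (v t + i).-1 else v k) ->
  brK (xpow F p t i) (xm F p' v) =
  (2 * v t + i * \sum_(j | h j) v j)%:R * xm F p' w - (2 * i)%:R * xm F p' w.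
Proof.
move=> hw; rewrite xpowE.
have dt0 j : h j -> d j (xm F p' (fun k => if k == t then i else 0%N)) = 0.
  by rewrite horizE => /negPf jt; rewrite /d dA_xm // jt mul0r.
rewrite (cbr_flat _ horizE horiz_prime primeKK sg_prime sg_sq) //; last exact: two_reg.
have -> : \sum_(j | h j) x j * d j (xm F p' v) = (\sum_(j | h j) v j)%:R * xm F p' v.
  rewrite natr_sum mulr_suml; apply: eq_bigr => j hj; rewrite /d dA_xm // xvarE mulrCA xmM.
  have [->|v0] := posnP (v j); first by rewrite !mul0r.
  congr (_ * _); apply: eq_xm => k; case: eqP => [->|_] /=; last by rewrite subn0.
  by rewrite add1n subn1 prednK.
have e1 : (xm F p' (fun k => if k == t then i else 0%N)) * d t (xm F p' v) = (v t)%:R * xm F p' w.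
  rewrite /d dA_xm // mulrCA xmM; have [->|v0] := posnP (v t); first by rewrite !mul0r.
  congr (_ * _); apply: eq_xm => k; rewrite hw; case: eqP => [->|_] /=; last by rewrite subn0.
  by rewrite subn1 addnC -(prednK v0) addSn.
have e2 : d t (xm F p' (fun k => if k == t then i else 0%N)) * xm F p' v = i%:R * xm F p' w.
  rewrite /d dA_xm // eqxx -mulrA xmM; have [->|i0] := posnP i; first by rewrite !mul0r.
  congr (_ * _); apply: eq_xm => k; rewrite hw; case: eqP => [->|_] /=; last by rewrite subn0.
  by rewrite subn1 [RHS]/(_.-1) addnC -{2}(prednK i0) addnS.
rewrite e1 [xm F p' v * _]mulrC [d t _ * (_ * _)]mulrCA !e2 natrD !natrM; ring.
Qed.

Lemma gvec_act (i : 'I_p) (v w : 'I_n -> nat) :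
  (forall k, w k = if k == tK r then (v (tK r) + i).-1 else v k) ->
  gvec (xm F p' v) *m actK F r i =
  (2^-1 * ((2 * v (tK r) + i * \sum_(j < n | (j < 2 * r)%N) v j)%:R - (2 * i)%:R))
    *: gvec (xm F p' w).
Proof.
move=> hw; rewrite actKE (brK_tpow hw) gvecD gvec_nat -scalerA scalerBl; congr (_ *: (_ + _)).
have <- : cst (-1) * ((2 * i)%:R * xm F p' w) = - ((2 * i)%:R * xm F p' w) :> Rn.
  by rewrite -scaleAE; apply/ffunP=> a; rewrite !ffunE mulN1r.
by rewrite gvecZ gvec_nat scaleN1r.
Qed.

Lemma brK_var j (v : 'I_n -> nat) : h j -> brK (x j) (xm F p' v) =
  (v t)%:R * (x j * xm F p' (fun k => v k - (k == t))%N)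
  + sg j * ((v (pr j))%:R * xm F p' (fun k => v k - (k == pr j))%N).
Proof.
move=> hj; rewrite (cbr_var horizE horiz_prime primeKK sg_prime sg_sq d_var) //.
by rewrite /d !dA_xm // mulrCA.
Qed.

Let top : Mon p n := [ffun => ord_max].

Lemma brK_top (f g : Rn) : (p %| 2 * r + 4)%N -> brK f g top = 0.
Proof.
move=> dv; pose J (f : Rn) : F := f top.
have JD u v : J (u + v) = J u + J v by rewrite /J ffunE.
have Jd i u : J (d i u) = 0 by rewrite /J /d dAE ffunE ltnn.
have := J_cbr horizE horiz_prime primeKK sg_prime sg_sq dD dM dC d_var d_sg JD Jd two0 f g.
have -> : #|h| = (2 * r)%N.
  rewrite -sum1_card big_mkcond big_ord_recr /= unfold_in /h ltnn addn0.
  by under eq_bigr => i _ do rewrite unfold_in /= ltn_ord; rewrite sum_nat_const card_ord muln1.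
move=> e; rewrite -[LHS]/(J _) e.
have /eqP -> : (2 * r + 4)%:R == 0 :> F by rewrite (natF_eq0 charF).
by rewrite mul0r.
Qed.

Lemma Kspace_sub (U : 'M[F]_(NK p r)) :
  (forall a : Mon p n, ~~ ((p %| 2 * r + 4)%N && (a == top)) -> (gvec (xmon F a) <= U)%MS) ->
  (Kspace F p r <= U)%MS.
Proof.
move=> hU; rewrite genmxE; apply/row_subP=> k.
have -> : row k (Kgens F p r) = gvec (brK (xmon F (enum_val k).1) (xmon F (enum_val k).2)).
  by rewrite /gvec -brW_DK; apply/rowP=> l; rewrite !mxE.
rewrite gvec_sum; apply: summx_sub => a _.
case: (boolP ((p %| 2 * r + 4)%N && (a == top))) => [/andP[dv /eqP ->]|ha].
  by rewrite brK_top // scale0r sub0mx.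
by rewrite scalemx_sub // hU.
Qed.

Lemma brK_Kspace v w : (gvec (brK (xm F p' v) (xm F p' w)) <= Kspace F p r)%MS.
Proof.
have br0 f g : f = 0 \/ g = 0 -> gvec (brK f g) = 0.
  move=> fg; have <- : gvec 0 = 0 by apply: gvec0.
  rewrite /gvec; congr vecW; apply/ffunP=> j; rewrite -brW_DK !brWE !applyWE.
  have k0 i : DK 0 i = 0 :> Rn.
    by rewrite DKE; have := compKZ 0 0 i; rewrite mulr0 => ->; rewrite -scaleAE; apply/ffunP=> a; rewrite !ffunE mul0r.
  have d00 i : d i 0 = 0 by rewrite -[0 in LHS](mulr0 0) dM mulr0 mul0r addr0.
  have s1 (G : Rn) : \sum_i (DK 0 i : Rn) * d i G = 0 by apply: big1 => i _; rewrite k0 mul0r.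
  have s2 (D : Wder F p n) : \sum_i (D i : Rn) * d i 0 = 0 by apply: big1 => i _; rewrite d00 mulr0.
  by case: fg => ->; rewrite k0 s1 s2 subrr.
have range u : xm F p' u = 0 \/ (xm F p' u : Rn) = xmon F (mk_mon p' u).
  case: (boolP [forall k, (u k < p)%N]) => [/forallP hu|]; first by right; apply: xm_mon.
  by rewrite negb_forall => /existsP[k hk]; left; apply: (@xm_oob _ _ _ _ k); rewrite leqNgt.
case: (range v) => [v0|->]; first by rewrite br0 ?sub0mx //; left.
case: (range w) => [w0|->]; first by rewrite br0 ?sub0mx //; right.
rewrite genmxE.
have := row_sub (enum_rank (mk_mon p' v : Mon p n, mk_mon p' w : Mon p n)) (Kgens F p r).
congr (_ <= _)%MS; rewrite /gvec -brW_DK; apply/rowP=> l; rewrite !mxE enum_rankK //.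
Qed.

(** Bracketing with 1 is [2 d/dt], and the exponent of [t] can be raised by one without reaching
    [p]. *)
Lemma gvec_tK v : (v t < p')%N -> (gvec (xm F p' v) <= Kspace F p r)%MS.
Proof.
move=> hv; pose w k := (v k + (k == t))%N.
have := brK_Kspace (fun=> 0%N) w.
have -> : xm F p' (fun=> 0%N) = xpow F p t 0 :> Rn.
  by rewrite xpowE; apply: eq_xm => k; case: eqP.
rewrite (@brK_tpow 0 w v) => [|k]; last first.
  by rewrite /w eqxx addn0 addn1; case: eqP => [->|_] //; rewrite addn0.
rewrite mul0n addn0 muln0 mul0r subr0 gvec_nat (eqmx_scale _ _) //.
by rewrite /w eqxx addn1 natrM mulf_neq0 // (natF_neq0 charF).
Qed.

(** Let [a t = p - 1]. If some horizontal [a j] is below [p - 1], bracketing the variable conjugate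
    to [x_j] with [x^(a + e_j)] gives a nonzero multiple of [x^a] plus a term of smaller exponent in
    [t]. Otherwise [x^a] is the top monomial, and bracketing with [t] multiplies it by a scalar. *)
Lemma gvec_Kspace (a : Mon p n) : ~~ ((p %| 2 * r + 4)%N && (a == top)) ->
  (gvec (xmon F a) <= Kspace F p r)%MS.
Proof.
move=> ha; rewrite monE.
case: (ltnP (a t) p') => hat; first exact: gvec_tK.
have at' : a t = p' :> nat by have := ltn_ord (a t); lia.
pose va k := nat_of_ord (a k).
case: (boolP [exists j, h j && (a j < p')%N]) => [/existsP[j /andP[hj aj]]|].
  have hpj := horiz_prime hj; have tj : (t == j) = false by move: hj; rewrite horizE eq_sym => /negbTE.
  pose w k := (a k + (k == j))%N.
  have := brK_Kspace (fun k => (k == pr j) : nat) w; rewrite -(xvarE (pr j)) (brK_var _ hpj) (primeKK hj).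
  have tpj : (t == pr j) = false by move: hpj; rewrite horizE eq_sym => /negbTE.
  rewrite xvarE xmM gvecD gvec_nat.
  set y := xm F p' (fun k => (k == pr j) + (w k - (k == t)))%N.
  have yK : (gvec y <= Kspace F p r)%MS.
    by apply: gvec_tK; rewrite /w tpj tj add0n addn0 eqxx at' subn1 prednK //; lia.
  have -> : xm F p' (fun k => w k - (k == j))%N = xm F p' va by apply: eq_xm => k; rewrite /w addnK.
  rewrite -scaleA_sigma scaleAE gvecZ gvec_nat => hK.
  have {}hK : (sigmaK F (pr j) *: ((w j)%:R *: gvec (xm F p' va)) <= Kspace F p r)%MS.
    have := addmx_sub hK (_ : (- ((w t)%:R *: gvec y) <= Kspace F p r)%MS).
    by rewrite eqmx_opp scalemx_sub // addrC addKr; apply.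
  have sig0 : sigmaK F (pr j) != 0.
    by rewrite /sigmaK; case: ifP => _; rewrite ?oppr_eq0 oner_eq0.
  have wj0 : (w j)%:R != 0 :> F by rewrite /w eqxx addn1 (natF_neq0 charF).
  by move: hK; rewrite (eqmx_scale _ sig0) (eqmx_scale _ wj0).
rewrite negb_exists => /forallP hall.
have atop : a = top.
  apply/ffunP=> k; apply: val_inj; rewrite ffunE /=; have := hall k; have := ltn_ord (a k).
  by rewrite horizE; case: (eqVneq k t) => [-> _ _ //|_] /=; lia.
have ndv : ~~ (p %| 2 * r + 4)%N by move: ha; rewrite atop eqxx andbT.
have := brK_Kspace (fun k => if k == t then 1%N else 0%N) va.
rewrite -xpowE (@brK_tpow 1 va va) => [|k]; last by rewrite addn1 /=; case: eqP => [->|].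
have -> : (\sum_(j | h j) va j = 2 * r * p')%N.
  rewrite big_mkcond big_ord_recr /= /h ltnn addn0.
  under eq_bigr => i _ do rewrite /= ltn_ord /va atop ffunE /=.
  by rewrite sum_nat_const card_ord.
rewrite -mulrBl -natrB; last by rewrite /va at'; lia.
rewrite gvec_nat (eqmx_scale _ _) // (natF_eq0 charF).
(* The scalar is congruent to [-(2r + 4)] modulo [p]. *)
have -> : (2 * va t + 1 * (2 * r * p') - 2 * 1 = (2 * r + 2) * p - (2 * r + 4))%N.
  by rewrite /va at'; lia.
apply: contra ndv => hd; rewrite -(@dvdn_subr p ((2 * r + 2) * p)) //; last exact: dvdn_mull.
by nia.
Qed.

End ContactAlgebra.

(** The map [s] embeds each fibre of [f] in the next; going once around the cycle, all fibres have
    the same size. *)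
Lemma card_fibre_cyclic (T : finType) (p : nat) (f : T -> nat) (s : T -> T) :
  (forall x, (f x < p)%N) -> injective s -> (forall x, f (s x) = (f x).+1 %% p)%N ->
  forall l, (l < p)%N -> #|T| = (p * #|[pred x | f x == l]|)%N.
Proof.
move=> f_lt s_inj fs; pose c l := #|[pred x | f x == l]|.
have c_step l : (l < p)%N -> (c l <= c (l.+1 %% p))%N.
  move=> lp; rewrite /c -(card_image s_inj); apply/subset_leq_card/subsetP=> y.
  by case/imageP=> z; rewrite !inE => /eqP fz ->; rewrite fs fz.
have c_iter l m : (l < p)%N -> (c l <= c ((l + m) %% p))%N.
  move=> lp; elim: m => [|m IHm]; first by rewrite addn0 modn_small.
  have -> : ((l + m.+1) %% p = ((l + m) %% p).+1 %% p)%N.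
    by rewrite addnS -addn1 -[in RHS]addn1 modnDml.
  by apply: leq_trans IHm _; apply: c_step; rewrite ltn_mod; lia.
have c_eq l l' : (l < p)%N -> (l' < p)%N -> c l = c l'.
  move=> lp lp'; apply/eqP; rewrite eqn_leq.
  have := c_iter l (p - l + l')%N lp; have := c_iter l' (p - l' + l)%N lp'.
  rewrite !addnA !subnKC ?(ltnW lp) ?(ltnW lp') // !modnDl !modn_small // => -> ->.
  by [].
move=> l lp.
have -> : #|T| = (\sum_(i < p) \sum_(x : T | f x == i) 1)%N.
  rewrite -sum1_card (partition_big (fun x => Ordinal (f_lt x)) xpredT) //=.
rewrite (eq_bigr (fun=> c l)) ?sum_nat_const ?card_ord // => i _.
by rewrite -(c_eq i l) // sum1_card.
Qed.

(** * The blocks of the contact algebra *)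

Section Blocks.
Variables (F : fieldType) (p' r : nat).
Local Notation p := p'.+1.
Local Notation n := (2 * r).+1.
Local Notation Bt := (Mon p (2 * r)).
Hypothesis charF : p \in [pchar F].
Hypothesis p_gt2 : (2 < p)%N.

Let natp0 : p%:R = 0 :> F := pcharf0 charF.
Let two0 : 2 != 0 :> F.
Proof. by rewrite (natF_neq0 charF). Qed.

Definition ext_exp (b : Bt) (k : nat) (j : 'I_n) : nat :=
  if unlift ord_max j is Some j' then b j' else k.

Definition block_deg (b : Bt) := (\sum_(j < 2 * r) b j)%N.

(* The solution of [2 (lam + 2) = block_deg b] modulo [p]; [p.+1./2] is the
   inverse of 2. *)
Definition block_lam (b : Bt) := ((block_deg b * p.+1./2 + (p - 2)) %% p)%N.

Definition block_top : Bt := [ffun => ord_max].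

Lemma ext_exp_t b k : ext_exp b k (tK r) = k.
Proof. by rewrite /ext_exp unlift_none. Qed.

Lemma ext_exp_lift b k j : ext_exp b k (lift ord_max j) = b j.
Proof. by rewrite /ext_exp liftK. Qed.

Lemma ext_exp_lt b k j : (k < p)%N -> (ext_exp b k j < p)%N.
Proof. by rewrite /ext_exp; case: unliftP. Qed.

Lemma sum_ext_exp b k : (\sum_(j < n | (j < 2 * r)%N) ext_exp b k j = block_deg b)%N.
Proof.
rewrite big_mkcond big_ord_recr /= ltnn addn0; apply: eq_bigr => i _; rewrite /= ltn_ord.
have -> : widen_ord (leqnSn (2 * r)) i = lift ord_max i by apply: val_inj; rewrite /= /bump leqNgt ltn_ord.
exact: ext_exp_lift.
Qed.

Lemma natF_mod m : (m %% p)%:R = m%:R :> F.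
Proof. by rewrite [in RHS](divn_eq m p) natrD natrM natp0 mulr0 add0r. Qed.

Lemma block_lamP b : (block_deg b)%:R = (2 * (block_lam b + 2))%:R :> F.
Proof.
have odd_p : odd p by case: (even_prime (pcharf_prime charF)) => // e; lia.
have h2 : (2 * p.+1./2)%:R = 1 :> F.
  have -> : (2 * p.+1./2 = p + 1)%N.
    by rewrite mul2n -[RHS](odd_double_half (p + 1)) oddD odd_p addn1.
  by rewrite natrD natp0 add0r.
rewrite natrM natrD natF_mod -natrD -natrM -addnA.
have -> : (p - 2 + 2 = p)%N by lia.
by rewrite mulnDr mulnCA natrD natrM h2 mulr1 natrM natp0 mulr0 addr0.
Qed.

Lemma block_lam_lt b : (block_lam b < p)%N.
Proof. by rewrite ltn_mod. Qed.

(** Raising the first exponent by 2 modulo [p] raises [block_lam] by 1 modulo [p]; a first exponent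
    exists because [r] is positive. *)
Lemma card_block_lam l : (0 < r)%N -> (l < p)%N -> #|[pred b | block_lam b == l]| = (p ^ (2 * r - 1))%N.
Proof.
move=> r_gt0 lp; have r2 : (0 < 2 * r)%N by lia.
pose j0 : 'I_(2 * r) := Ordinal r2.
pose s (b : Bt) : Bt := [ffun j => if j == j0 then inord ((b j + 2) %% p) else b j].
have s_inj : injective s.
  move=> b b' /ffunP e; apply/ffunP=> j; have := e j; rewrite !ffunE; case: eqP => // _.
  move/(congr1 val); rewrite /= !inordK ?ltn_mod // => /eqP; rewrite eqn_modDr.
  by rewrite !modn_small // => /eqP h; apply: val_inj.
have deg_s b : (block_deg (s b))%:R = (block_deg b + 2)%:R :> F.
  rewrite /block_deg (bigD1 j0) //= [in RHS](bigD1 j0) //= ffunE eqxx inordK ?ltn_mod //.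
  rewrite !natrD natF_mod natrD (eq_bigr (fun j => nat_of_ord (b j))); first by ring.
  by move=> j /negPf hj; rewrite ffunE hj.
have lam_s b : block_lam (s b) = ((block_lam b).+1 %% p)%N.
  apply: (natF_inj charF); rewrite ?block_lam_lt ?ltn_mod // natF_mod.
  apply: (mulfI two0); apply: (addIr 4%:R); rewrite -!natrM -!natrD.
  have -> : (2 * block_lam (s b) + 4 = 2 * (block_lam (s b) + 2))%N by lia.
  rewrite -block_lamP deg_s natrD block_lamP -natrD; congr _%:R; lia.
have := card_fibre_cyclic block_lam_lt s_inj lam_s lp.
rewrite card_ffun !card_ord.
have -> : (p ^ (2 * r) = p * p ^ (2 * r - 1))%N by rewrite -expnS; congr (_ ^ _)%N; lia.
by move/eqP; rewrite eqn_pmul2l // => /eqP <-.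
Qed.

Lemma block_lam_top : (p %| 2 * r + 4)%N -> block_lam block_top = 0%N.
Proof.
rewrite -(natF_eq0 charF) => /eqP dv; apply: (natF_inj charF); rewrite ?block_lam_lt //.
apply: (mulfI two0); rewrite mulr0 -natrM.
have : (block_deg block_top + 2 * r)%:R = 0 :> F.
  have -> : (block_deg block_top + 2 * r = 2 * r * p)%N.
    rewrite /block_deg (eq_bigr (fun=> p')) => [|j _]; last by rewrite ffunE.
    by rewrite sum_nat_const card_ord mulnS addnC.
  by rewrite natrM natp0 mulr0.
rewrite natrD block_lamP -natrD.
have -> : (2 * (block_lam block_top + 2) + 2 * r = 2 * block_lam block_top + (2 * r + 4))%N by lia.
by rewrite natrD dv addr0.
Qed.

Definition block_mx b : 'M[F]_(p, NK p r) := \matrix_(k < p) gvec (xm F p' (ext_exp b k)).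

(** [pinvmx] recovers the coefficients of [f] from [D_K f], and those of one block are selected.
    Blocks use disjoint sets of monomials, so these matrices are dual to the [block_mx]. *)
Definition block_coord b : 'M[F]_(NK p r, p) :=
  pinvmx (Gmx F p' r) *m
  \matrix_(a < #|{: Mon p n}|, l < p) (enum_val a == mk_mon p' (ext_exp b l))%:R.

Lemma mk_ext_inj b b' (k k' : 'I_p) :
  (mk_mon p' (ext_exp b k) == mk_mon p' (ext_exp b' k')) = (b == b') && (k == k').
Proof.
apply/eqP/andP=> [e|[/eqP -> /eqP ->] //].
have {}e j : ext_exp b k j = ext_exp b' k' j.
  by have /ffunP/(_ j)/(congr1 val) := e; rewrite !ffunE /= !inordK ?ext_exp_lt.
split; last by apply/eqP/val_inj; have := e (tK r); rewrite !ext_exp_t.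
by apply/eqP/ffunP=> j; apply: val_inj; have := e (lift ord_max j); rewrite !ext_exp_lift.
Qed.

Lemma gvec_ext b (k : 'I_p) :
  gvec (xm F p' (ext_exp b k)) = gvec (xmon F (mk_mon p' (ext_exp b k))).
Proof. by rewrite xm_mon // => j; apply: ext_exp_lt. Qed.

Lemma block_mx_coord b' b :
  block_mx b' *m block_coord b = if b' == b then 1%:M else 0.
Proof.
apply/row_matrixP=> k; rewrite row_mul rowK gvec_ext /block_coord mulmxA (gvec_pinv charF p_gt2).
rewrite -rowE; apply/rowP=> l; rewrite !mxE enum_rankK mk_ext_inj.
by case: (b' == b); rewrite !mxE.
Qed.

Lemma Xn_block_mx b m : poly_rV 'X^m *m block_mx b = gvec (xm F p' (ext_exp b m)).
Proof.
case: (ltnP m p) => hm; first by rewrite (poly_rV_delta F (Ordinal hm)) -rowE rowK.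
rewrite poly_rVXn_ge // mul0mx (@xm_oob _ _ _ _ (tK r)) ?ext_exp_t //.
by rewrite (gvec0 r charF).
Qed.

Lemma block_mx_act b (i : 'I_p) :
  block_mx b *m actK F r i = densA F (block_lam b).+1 i *m block_mx b.
Proof.
apply/row_matrixP=> k; rewrite !row_mul rowK.
rewrite (@gvec_act _ _ _ charF p_gt2 _ _ (ext_exp b (k + i).-1)); last first.
  move=> j; rewrite ext_exp_t; case: eqP => [->|/eqP jt]; first exact: ext_exp_t.
  by rewrite /ext_exp; case: unliftP jt => // ->; rewrite eqxx.
rewrite ext_exp_t sum_ext_exp.
(* With block degree [2 (lam + 2)], half of [2 k + i (2 lam + 4) - 2 i] is [k + i (lam + 1)]. *)
have -> : 2^-1 * ((2 * k + i * block_deg b)%:R - (2 * i)%:R)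
    = (k + i * (block_lam b).+1)%:R :> F.
  apply: (mulfI two0); rewrite mulrA mulfV // mul1r natrD natrM [(i * _)%:R]natrM block_lamP.
  by rewrite -[(block_lam b).+1]addn1 !natrM !natrD natrM; ring.
by rewrite rowE -poly_rV_delta (densA_Xn charF) // -scalemxAl Xn_block_mx.
Qed.

(** The blocks exhaust the monomials; a missing top monomial is the entry [k = p - 1] of the block
    [block_top], which [Lm] leaves out. *)
Lemma Kspace_blocks :
  (Kspace F p r == \sum_b <<Lm F p' block_top (p %| 2 * r + 4)%N b *m block_mx b>>)%MS.
Proof.
set dv := (p %| 2 * r + 4)%N.
have top_ext b (k : 'I_p) : (mk_mon p' (ext_exp b k) == [ffun => ord_max])
    = (b == block_top) && (k == ord_max).
  rewrite -mk_ext_inj; congr (_ == _); apply/ffunP=> j; rewrite !ffunE; apply: val_inj.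
  rewrite /= /ext_exp; case: unliftP => [j' _|_]; by rewrite ?ffunE inordK.
apply/andP; split.
  apply: (Kspace_sub charF p_gt2) => a ha.
  pose b : Bt := [ffun j => a (lift ord_max j)]; pose k : 'I_p := a (tK r).
  have aE : a = mk_mon p' (ext_exp b k).
    apply/ffunP=> j; apply: val_inj; rewrite ffunE /= inordK ?ext_exp_lt //.
    by rewrite /ext_exp; case: unliftP => [j' ->|->]; rewrite ?ffunE.
  rewrite (sumsmx_sup b) // genmxE aE -gvec_ext -Xn_block_mx; apply: submxMr.
  rewrite /Lm Xn_sub_pid; case: ifP => // /andP[hdv hb].
  move: ha; rewrite -/dv hdv aE top_ext hb /= -val_eqE /=; have := ltn_ord k; lia.
apply/sumsmx_subP=> b _; rewrite genmxE; apply/row_subP=> k; rewrite row_mul row_pid_mx.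
case: ifP => hk; last by rewrite mul0mx sub0mx.
rewrite -poly_rV_delta Xn_block_mx gvec_ext; apply: (gvec_Kspace charF p_gt2).
rewrite top_ext -/dv; apply/negP=> /and3P[hdv hb /eqP hk'].
by move: hk; rewrite /cut hdv hb hk' ltnn.
Qed.

End Blocks.

(** In the divisible case one [V(0)] is traded for [L(p-1)], so that only one factor [L(0)] is
    lost. *)
Lemma count_Kdecomp p' r l : (1 < p')%N -> (0 < r)%N -> (l < p'.+1)%N ->
  count_mem l (flatten (map (summand_factors p') (Kdecomp p'.+1 r))) = Kmult p'.+1 r l.
Proof.
move=> p'1 r0 lp; have q0 : (0 < p'.+1 ^ (2 * r - 1))%N by rewrite expn_gt0.
rewrite /Kdecomp /Kmult; set q := (_ ^ _)%N in q0 *.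
pose cnt s := count_mem l (flatten (map (summand_factors p') s)).
have cnt_cat s1 s2 : cnt (s1 ++ s2) = (cnt s1 + cnt s2)%N.
  by rewrite /cnt map_cat flatten_cat count_cat.
have cnt_nseq m s : cnt (nseq m s) = (m * count_mem l (summand_factors p' s))%N.
  by elim: m => //= m IH; rewrite /cnt /= count_cat -/(cnt _) IH mulSn.
have cnt_mid (s : seq nat) : cnt (flatten [seq nseq q (SL i) | i <- s]) = (q * count_mem l s)%N.
  elim: s => [|i s IH] /=; first by rewrite muln0.
  by rewrite cnt_cat IH cnt_nseq /= addn0 mulnDr.
have c_mid : count_mem l (iota 1 (p'.+1 - 2)) = ((0 < l) && (l < p'))%N.
  rewrite count_uniq_mem ?iota_uniq // mem_iota; congr (nat_of_bool (_ && _)); lia.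
have p'0 : p' == 0%N = false by apply/negbTE; lia.
rewrite -/(cnt _) /=; case: ifP => _; rewrite !cnt_cat !cnt_nseq cnt_mid c_mid /= p'0 ?addn0 /=.
  rewrite /cnt /= addn0.
  have [->|l0] := posnP l; first by rewrite eqxx [p' == 0%N]p'0; nia.
  rewrite [0%N == l]eq_sym (gtn_eqF l0) eq_sym; case: eqP => [->|/eqP lp']; first by rewrite ltnn; nia.
  have -> : (l < p')%N by lia.
  by nia.
have [->|l0] := posnP l; first by rewrite eqxx p'0; nia.
rewrite [0%N == l]eq_sym (gtn_eqF l0) eq_sym; case: eqP => [->|/eqP lp']; first by rewrite ltnn; nia.
have -> : (l < p')%N by lia.
by nia.
Qed.

Theorem theorem6p2 (F : closedFieldType) (p r : nat)
  (charF : p \in [pchar F]) (p_gt2 : (2 < p)%N) (r_ge1 : (1 <= r)%N) :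
  decomposes_as (Kmod F p r) (Kdecomp p r) /\
  (exists m Us, comp_series (Kmod F p r) m Us) /\
  (forall m Us, comp_series (Kmod F p r) m Us ->
     (forall k : 'I_m, exists2 lam, (lam < p)%N & factor_is_L (Kmod F p r) Us k lam) /\
     (forall lam, (lam < p)%N ->
        exists2 S : {set 'I_m}, #|S| = Kmult p r lam &
          forall k, k \in S <-> factor_is_L (Kmod F p r) Us k lam)).
Proof.
case: p charF p_gt2 => // p' charF p_gt2.
pose q := (p'.+1 ^ (2 * r - 1))%N; have q0 : (0 < q)%N by rewrite expn_gt0.
have UE := @Kspace_blocks F p' r charF p_gt2.
have card_lam l := @card_block_lam F p' r charF p_gt2 l r_ge1.
have types : map (block_type p' (@block_lam p' r) (block_top p' r) (p'.+1 %| 2 * r + 4)%N)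
   (block_list p' (@block_lam p' r) (block_top p' r) (p'.+1 %| 2 * r + 4)%N) = Kdecomp p'.+1 r.
  rewrite (block_list_types p_gt2 (@block_lam_top F p' r charF p_gt2) card_lam).
  by rewrite /Kdecomp -/q; case: ifP => _ /=; rewrite ?subn0 ?cats0.
have [] := composition_factors charF p_gt2 (@block_lam_lt p' r) (@block_lam_top F p' r charF p_gt2)
   (@block_mx_coord F p' r charF p_gt2) (@block_mx_act F p' r charF p_gt2) UE
   (bs := block_list p' (@block_lam p' r) (block_top p' r) (p'.+1 %| 2 * r + 4)%N).
- apply: (uniq_block_list p_gt2 (@block_lam_lt p' r) (@block_lam_top F p' r charF p_gt2) card_lam q0).
  rewrite card_ffun !card_ord -expnS; congr (_ ^ _)%N; lia.
- exact: (mem_block_list p_gt2 (@block_lam_lt p' r) (@block_lam_top F p' r charF p_gt2)).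
rewrite types => dec ex fac; split=> //; split=> // m Us cs.
have [f1 f2] := fac m Us cs; split=> // l lp.
have [S cS hS] := f2 l lp; exists S => //.
by rewrite cS count_Kdecomp.
Qed.
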